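(* Let $G^{(7)}\simeq \mathrm{SL}_2(3)$ be the umbral group attached to the Niemeier root system $A_6^{\oplus 4}$, let $W^{(7)}_{\mathrm{tw}}=A(\mathfrak e)_{\mathrm{tw}}\otimes A(\mathfrak a)_{\mathrm{tw}}\otimes \underline{A}(\mathfrak b)_{\mathrm{tw}}$ (with $\dim\mathfrak e=\dim\mathfrak a=2$, $\dim\mathfrak b=4$) be the canonically twisted module, equipped with the action of $G^{(7)}$ and the operators $J_{\mathfrak e}(0)$, $(-1)^F$, $J(0)$, $L(0)$, specified in the context. For $g\in G^{(7)}$ define the formal series $$\widetilde\psi^{(7)}_g:=-\mathrm{tr}\left((g+g^{-1})\,J_{\mathfrak e}(0)\,(-1)^F\,y^{J(0)}q^{L(0)}\,\middle|\,W^{(7)}_{\mathrm{tw}}\right)\in\mathbb C[y][[y^{-1}]][[q]].$$ Then for every $g\in G^{(7)}$ the series $\widetilde\psi^{(7)}_g$ is the expansion of the meromorphic Jacobi form $\psi^{(7)}_g$ in the domain $0<-\mathrm{Im}(z)<\mathrm{Im}(\tau)$; that is, after the substitution $q=e^{2\pi i\tau}$, $y=e^{2\pi i z}$ the series converges to $\psi^{(7)}_g(\tau,z)$ for all $\tau\in\mathbb H$, $z\in\mathbb C$ with $0<-\mathrm{Im}(z)<\mathrm{Im}(\tau)$.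
   Context: **Clifford modules.** Let $\mathfrak a$ be a complex vector space of finite even dimension $d$ with a non-degenerate symmetric bilinear form $\langle\cdot,\cdot\rangle$ and a polarization $\mathfrak a=\mathfrak a^+\oplus\mathfrak a^-$ (both summands isotropic). For a space $\mathfrak u$ with symmetric form, $\mathrm{Cliff}(\mathfrak u)=T(\mathfrak u)/(u\otimes u'+u'\otimes u-\langle u,u'\rangle\mathbf 1)$. For $r\in\frac12\mathbb Z$ let $\mathfrak a(r)=\{a(r)\mid a\in\mathfrak a\}$ be a copy of $\mathfrak a$; put $\hat{\mathfrak a}=\bigoplus_{n\in\mathbb Z}\mathfrak a(n+\frac12)$, $\hat{\mathfrak a}_{\mathrm{tw}}=\bigoplus_{n\in\mathbb Z}\mathfrak a(n)$, with $\langle a(r),a'(r')\rangle=\langle a,a'\rangle\delta_{r+r',0}$. Put $\hat{\mathfrak a}^+=\bigoplus_{n\ge0}\mathfrak a(n+\frac12)$ and $\hat{\mathfrak a}_{\mathrm{tw}}^+=\mathfrak a^+(0)\oplus\bigoplus_{n>0}\mathfrak a(n)$. Then $A(\mathfrak a)=\mathrm{Cliff}(\hat{\mathfrak a})\otimes_{\langle\hat{\mathfrak a}^+\rangle}\mathbb C\mathbf v$ and $A(\mathfrak a)_{\mathrm{tw}}=\mathrm{Cliff}(\hat{\mathfrak a}_{\mathrm{tw}})\otimes_{\langle\hat{\mathfrak a}_{\mathrm{tw}}^+\rangle}\mathbb C\mathbf v_{\mathrm{tw}}$, where $\langle\cdot\rangle$ denotes the unital subalgebra generated, and $\hat{\mathfrak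 a}^+\mathbf v=0$, $\hat{\mathfrak a}_{\mathrm{tw}}^+\mathbf v_{\mathrm{tw}}=0$. $A(\mathfrak a)$ has the unique super vertex algebra structure with vacuum $\mathbf v$ and $Y(a(-\frac12)\mathbf v,z)=\sum_{n\in\mathbb Z}a(n+\frac12)z^{-n-1}$, and $A(\mathfrak a)_{\mathrm{tw}}$ has the unique canonically twisted $A(\mathfrak a)$-module structure with $Y_{\mathrm{tw}}(a(-\frac12)\mathbf v,z)=\sum_{n\in\mathbb Z}a(n)z^{-n-\frac12}$. With bases $\{a_i^\pm\}$ of $\mathfrak a^\pm$ such that $\langle a_i^\mp,a_j^\pm\rangle=\delta_{ij}$, put $\omega=\frac12\sum_i(a_i^+(-\frac32)a_i^-(-\frac12)-a_i^+(-\frac12)a_i^-(-\frac32))\mathbf v$ (Virasoro element, $c=\frac d2$) and $\jmath=\sum_i a_i^+(-\frac12)a_i^-(-\frac12)\mathbf v$. Writing $J(0)$ for the coefficient of $z^{-1}$ in $Y_{\mathrm{tw}}(\jmath,z)$ and $L(0)$ for that of $z^{-2}$ in $Y_{\mathrm{tw}}(\omega,z)$, $$\mathrm{tr}(y^{J(0)}q^{L(0)-c/24}|A(\mathfrak a)_{\mathrm{tw}})=y^{d/4}q^{d/24}\prod_{n>0}(1+y^{-1}q^{n-1})^{d/2}(1+yq^n)^{d/2}.$$ **Weyl modules.** Let $\mathfrak b$ be a complex vector space of finite even dimension $d$ with a non-degenerate anti-symmetric form $\langle\!\langle\cdot,\cdot\rangle\!\rangle$ and polarization $\mathfrak b=\mathfrak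 b^+\oplus\mathfrak b^-$. Replace the Clifford algebra by the Weyl algebra $T(\mathfrak u)/(u\otimes u'-u'\otimes u-\langle\!\langle u,u'\rangle\!\rangle\mathbf 1)$ and repeat the construction verbatim (same index sets, $\hat{\mathfrak b}^+=\bigoplus_{n\ge0}\mathfrak b(n+\frac12)$, $\hat{\mathfrak b}_{\mathrm{tw}}^+=\mathfrak b^+(0)\oplus\bigoplus_{n>0}\mathfrak b(n)$, same formulas for $Y$ and $Y_{\mathrm{tw}}$ on generators) to get a super vertex algebra $\underline A(\mathfrak b)$ and canonically twisted module $\underline A(\mathfrak b)_{\mathrm{tw}}$. With bases such that $\langle\!\langle b_i^\mp,b_j^\pm\rangle\!\rangle=\pm\delta_{ij}$, put $\omega=\frac12\sum_i(b_i^+(-\frac32)b_i^-(-\frac12)-b_i^+(-\frac12)b_i^-(-\frac32))\mathbf v$ ($c=-\frac d2$) and $\jmath=\sum_ib_i^+(-\frac12)b_i^-(-\frac12)\mathbf v$; then $$\mathrm{tr}(y^{J(0)}q^{L(0)-c/24}|\underline A(\mathfrak b)_{\mathrm{tw}})=y^{-d/4}q^{-d/24}\prod_{n>0}(1-y^{-1}q^{n-1})^{-d/2}(1-yq^n)^{-d/2},$$ with $(1-X)^{-1}=\sum_{k\ge0}X^k$. **Group actions.** $g\in\mathrm{GL}(\mathfrak a^+)$ acts on $\mathfrak a=\mathfrak a^+\oplus\mathfrak a^-$ as $(g,g')$, where $g'\in\mathrm{GL}(\mathfrak a^-)$ is determined by $\langle ga,g'a'\rangle=\langle a,a'\rangle$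 for $a\in\mathfrak a^+,a'\in\mathfrak a^-$, and on $A(\mathfrak a)$ and $A(\mathfrak a)_{\mathrm{tw}}$ by $g\cdot a_1(r_1)\cdots a_n(r_n)\mathbf v=(ga_1)(r_1)\cdots(ga_n)(r_n)\mathbf v$ (resp. with $\mathbf v_{\mathrm{tw}}$). Similarly $\mathrm{GL}(\mathfrak b^+)$ acts on $\underline A(\mathfrak b)$, $\underline A(\mathfrak b)_{\mathrm{tw}}$. **The case $\ell=7$.** Let $\mathfrak e,\mathfrak a$ be $2$-dimensional with non-degenerate symmetric forms and $\mathfrak b$ $4$-dimensional with a non-degenerate anti-symmetric form, all with fixed polarizations. Set $W^{(7)}=A(\mathfrak e)\otimes A(\mathfrak a)\otimes\underline A(\mathfrak b)$, $W^{(7)}_{\mathrm{tw}}=A(\mathfrak e)_{\mathrm{tw}}\otimes A(\mathfrak a)_{\mathrm{tw}}\otimes\underline A(\mathfrak b)_{\mathrm{tw}}$, $\omega^{(7)}=\omega\otimes\mathbf v\otimes\mathbf v+\mathbf v\otimes\omega\otimes\mathbf v+\mathbf v\otimes\mathbf v\otimes\omega$, $\jmath^{(7)}=4\,\mathbf v\otimes\jmath\otimes\mathbf v+\mathbf v\otimes\mathbf v\otimes\jmath$, $\jmath_{\mathfrak e}=\jmath\otimes\mathbf v\otimes\mathbf v$. On $W^{(7)}_{\mathrm{tw}}$: $J_{\mathfrak e}(0)$ and $J(0)$ are the coefficients of $z^{-1}$ in $Y_{\mathrm{tw}}(\jmath_{\mathfrak e},z)$ and $Y_{\mathrm{tw}}(\jmath^{(7)},z)$,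 $L(0)$ is the coefficient of $z^{-2}$ in $Y_{\mathrm{tw}}(\omega^{(7)},z)$, and $(-1)^F=(-I)\otimes(-I)\otimes I\in \mathrm{GL}(\mathfrak e^+)\otimes\mathrm{GL}(\mathfrak a^+)\otimes\mathrm{GL}(\mathfrak b^+)$. **Group.** $G^{(7)}=\mathrm{Aut}(N)/\mathrm{Inn}(N)$, where $N$ is the Niemeier lattice with root system $A_6^{\oplus4}$ and $\mathrm{Inn}(N)$ is generated by reflections in roots; $G^{(7)}\simeq\mathrm{SL}_2(3)$. Its conjugacy classes are 1A, 2A, 4A, 3A, 6A, 3B, 6B (the number is the element order). With $b_3=(-1+\sqrt{-3})/2$, the irreducible characters $\chi_2,\chi_6$ take on these classes, in this order, the values $\chi_2:1,1,1,b_3,\overline{b_3},\overline{b_3},b_3$ and $\chi_6:2,-2,0,-\overline{b_3},b_3,-b_3,\overline{b_3}$. Choose homomorphisms $\varrho:G^{(7)}\to\mathrm{GL}(\mathfrak a^+)$ and $\underline\varrho:G^{(7)}\to\mathrm{GL}(\mathfrak b^+)$ with characters $\chi_2$ and $\chi_6$; $g\in G^{(7)}$ acts on $W^{(7)}$ and $W^{(7)}_{\mathrm{tw}}$ as $I\otimes\varrho(g)\otimes\underline\varrho(g)$. **The functions $\psi^{(7)}_g$.** With $q=e^{2\pi i\tau}$, $y=e^{2\pi iz}$: $\eta(\tau)=q^{1/24}\prod_{n>0}(1-q^n)$, $\theta_1(\tau,z)=-iq^{1/8}y^{1/2}\prod_{n>0}(1-y^{-1}q^{n-1})(1-yq^n)(1-q^n)$,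 $\theta_2(\tau,z)=q^{1/8}y^{1/2}\prod_{n>0}(1+y^{-1}q^{n-1})(1+yq^n)(1-q^n)$ (where $y^{1/2}=e^{\pi i z}$). The meromorphic Jacobi form $\psi^{(7)}_g$ of umbral moonshine depends only on the class of $g$: - 1A: $2i\,\eta(\tau)^3\theta_1(\tau,4z)/\theta_1(\tau,z)^2$ - 2A: $-2i\,\eta(\tau)^3\theta_1(\tau,4z)/\theta_2(\tau,z)^2$ - 4A: $-2i\,\eta(\tau)\eta(2\tau)\theta_1(\tau,4z)/\theta_2(2\tau,2z)$ - 3A, 3B: $-i\frac{\eta(3\tau)}{\theta_1(3\tau,3z)}\left(\theta_1(\tau,4z+\frac13)\theta_1(\tau,z-\frac13)+\theta_1(\tau,4z-\frac13)\theta_1(\tau,z+\frac13)\right)$ - 6A, 6B: $-i\frac{\eta(3\tau)}{\theta_2(3\tau,3z)}\left(\theta_1(\tau,4z+\frac13)\theta_1(\tau,z+\frac16)-\theta_1(\tau,4z-\frac13)\theta_1(\tau,z-\frac16)\right)$ *)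

(* Defs.v *)
From HB Require Import structures.
From mathcomp Require Import all_boot all_order all_algebra.
From mathcomp Require Import ring_quotient generic_quotient.
From mathcomp Require Import finmap.
From mathcomp Require Import all_classical all_reals all_analysis.
From mathcomp Require Import complex.
From mathcomp Require Import(canonicals) monalg.

Set Implicit Arguments.
Unset Strict Implicit.
Unset Printing Implicit Defensive.

Import Order.TTheory GRing.Theory Num.Theory.
Import numFieldNormedType.Exports.
Import Quotient.Exports.

Local Open Scope classical_set_scope.
Local Open Scope ring_scope.

Section Span.
Context (K : nzRingType) (V : lmodType K).
Implicit Type S : set V.

Inductive lspan S : V -> Prop :=
| lspan0 : lspan S 0
| lspanZD (c : K) (x y : V) : S x -> lspan S y -> lspan S (c *: x + y).

Lemma lspanD S x y : lspan S x -> lspan S y -> lspan S (x + y).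
Proof.
move=> Sx Sy; elim: Sx => [|c u v Su _ IH]; first by rewrite add0r.
by rewrite -addrA; apply: lspanZD.
Qed.

Lemma lspanZ S c x : lspan S x -> lspan S (c *: x).
Proof.
elim=> [|d u v Su _ IH]; first by rewrite scaler0; apply: lspan0.
by rewrite scalerDr scalerA; apply: lspanZD.
Qed.

Definition lspan_mem S : {pred V} := fun x => `[< lspan S x >].

Lemma lspan_mem_zmod S : zmod_closed (lspan_mem S).
Proof.
split=> [|x y /asboolP Sx /asboolP Sy]; apply/asboolP; first exact: lspan0.
by apply: lspanD => //; rewrite -scaleN1r; apply: lspanZ.
Qed.

HB.instance Definition _ S :=
  GRing.isZmodClosed.Build V (lspan_mem S) (lspan_mem_zmod S).

Definition lquot S := Quotient.quot (lspan_mem S).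

HB.instance Definition _ S := GRing.Zmodule.on (lquot S).
HB.instance Definition _ S :=
  EqQuotient.copy (lquot S) (Quotient.quot (lspan_mem S)).

Section Scale.
Variable S : set V.
Local Open Scope quotient_scope.

Definition lquot_scale (c : K) (x : lquot S) : lquot S :=
  \pi_(lquot S) (c *: repr x).

Lemma lquot_piE (x y : V) :
  (\pi_(lquot S) x == \pi_(lquot S) y) = (x - y \in lspan_mem S).
Proof. by rewrite Quotient.idealrBE. Qed.

Lemma lquot_scale_pi c x :
  lquot_scale c (\pi_(lquot S) x) = \pi_(lquot S) (c *: x).
Proof.
have /asboolP Sx : repr (\pi_(lquot S) x) - x \in lspan_mem S.
  by rewrite -lquot_piE reprK.
by apply/eqP; rewrite lquot_piE -scalerBr; apply/asboolP/lspanZ.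
Qed.

Lemma lquot_piD (x y : V) :
  \pi_(lquot S) (x + y) = \pi_(lquot S) x + \pi_(lquot S) y.
Proof. by have piD := Quotient.pi_add (lspan_mem S) x y; apply piD. Qed.

Lemma lquotP (x : lquot S) : exists v, x = \pi_(lquot S) v.
Proof. by exists (repr x); rewrite reprK. Qed.

Lemma lquot_scaleA a b x :
  lquot_scale a (lquot_scale b x) = lquot_scale (a * b) x.
Proof. by have [v ->] := lquotP x; rewrite !lquot_scale_pi scalerA. Qed.

Lemma lquot_scale1 : left_id 1 lquot_scale.
Proof. by move=> x; have [v ->] := lquotP x; rewrite lquot_scale_pi scale1r. Qed.

Lemma lquot_scaleDr : right_distributive lquot_scale +%R.
Proof.
move=> a x y; have [u ->] := lquotP x; have [v ->] := lquotP y.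
by rewrite -lquot_piD !lquot_scale_pi scalerDr lquot_piD.
Qed.

Lemma lquot_scaleDl x : {morph lquot_scale^~ x : a b / a + b}.
Proof.
move=> a b; have [v ->] := lquotP x.
by rewrite !lquot_scale_pi scalerDl lquot_piD.
Qed.

HB.instance Definition _ := GRing.Zmodule_isLmodule.Build K (lquot S)
  lquot_scaleA lquot_scale1 lquot_scaleDr lquot_scaleDl.
End Scale.

End Span.

Notation "{ 'free' K [ T ] }" := (monalg.malg T K)
  (at level 0, K, T at level 2, format "{ 'free'  K [ T ] }") : type_scope.
Notation "<| t |>" := (monalg.mkmalgU t 1) (at level 0) : ring_scope.

Section Presented.
Context (K : nzRingType) (T : choiceType).
Implicit Type Rel : set {free K[T]}.

Definition presented Rel : lmodType K := lquot Rel.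

Definition gen Rel (t : T) : presented Rel := (\pi_(lquot Rel) <|t|>)%qT.

(* The linear map t |-> f t out of a presented space.  It is only meaningful *)
(* when the linear extension of f to the free space kills the relations.     *)
Definition plift Rel (V : lmodType K) (f : T -> V) (x : presented Rel) : V :=
  let y : {free K[T]} := repr (x : lquot Rel) in
  \sum_(t <- monalg.msupp y) monalg.mcoeff t y *: f t.

End Presented.

Section Tensor.
Context (K : nzRingType).

Inductive tensor_rel (U V : lmodType K) : {free K[(U * V)%type]} -> Prop :=
| TensorL c u u' v :
    tensor_rel (<|(c *: u + u', v)|> - c *: <|(u, v)|> - <|(u', v)|>)
| TensorR c u v v' :
    tensor_rel (<|(u, c *: v + v')|> - c *: <|(u, v)|> - <|(u, v')|>).

Definition tensor (U V : lmodType K) : lmodType K :=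
  presented (@tensor_rel U V).

Definition tens (U V : lmodType K) (u : U) (v : V) : tensor U V :=
  gen (@tensor_rel U V) (u, v).

Definition tensor_map (U V U' V' : lmodType K) (f : U -> U') (g : V -> V')
    : tensor U V -> tensor U' V' :=
  plift (fun uv : U * V => tens (f uv.1) (g uv.2)).

End Tensor.

(* The bit p is the parity of the generating fields: p = true is the         *)
(* symmetric (Clifford) case, p = false the anti-symmetric (Weyl) case.      *)
Record polarized (K : fieldType) (p : bool) (d : nat) := Polarized {
  pol_space :> vectType K;
  pol_form : pol_space -> pol_space -> K;
  pol_pos : {vspace pol_space};
  pol_neg : {vspace pol_space};
  pol_dim : \dim {: pol_space} = d;
  pol_form_linear : forall c x x' y,
    pol_form (c *: x + x') y = c * pol_form x y + pol_form x' y;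
  pol_form_sym : forall x y, pol_form y x = (-1) ^+ (~~ p) * pol_form x y;
  pol_form_nondeg : forall x, (forall y, pol_form x y = 0) -> x = 0;
  pol_sum : (pol_pos + pol_neg = fullv)%VS;
  pol_cap : (pol_pos :&: pol_neg = 0)%VS;
  pol_pos_isotropic : {in pol_pos &, forall x y, pol_form x y = 0};
  pol_neg_isotropic : {in pol_neg &, forall x y, pol_form x y = 0}
}.

(* With pol_form_sym, the condition <a_i^-, a_j^+> = delta_ij also gives     *)
(* <a_i^+, a_j^-> = delta_ij (p = true), resp. - delta_ij (p = false).       *)
Record dual_bases (K : fieldType) (p : bool) (d : nat) (X : polarized K p d) :=
  DualBases {
  db_pos : (d./2).-tuple X;
  db_neg : (d./2).-tuple X;
  db_pos_basis : basis_of (pol_pos X) db_pos;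
  db_neg_basis : basis_of (pol_neg X) db_neg;
  db_dual : forall i j,
    pol_form (tnth db_neg i) (tnth db_pos j) = (i == j)%:R
}.

Section Fock.
Context (K : fieldType) (p : bool) (d : nat) (X : polarized K p d).

(* The letter (a, n) stands for a(n + 1/2) if tw = false, and for a(n) if    *)
(* tw = true; a word stands for the product of its letters.                  *)
Definition letter : choiceType := (X * int)%type.

Definition mode_form (tw : bool) (s t : letter) : K :=
  pol_form s.1 t.1 *+ (s.2 + t.2 + (~~ tw : nat)%:Z == 0).

Definition annihilator (tw : bool) (s : letter) : Prop :=
  (0 < s.2) \/ (s.2 = 0 /\ (tw -> s.1 \in pol_pos X)).

(* Relations defining the induced module Cliff(u) (x)_<u^+> C v, that is     *)
(* T(u) modulo the two-sided ideal of Cliff(u) and the left ideal T(u) u^+:  *)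
(* linearity of a |-> a(r), (anti)commutators, annihilation of v.            *)
Inductive fock_rel (tw : bool) : {free K[seq letter]} -> Prop :=
| FockLinear (w w' : seq letter) c x y n :
    fock_rel tw (<|w ++ (c *: x + y, n) :: w'|>
                 - c *: <|w ++ (x, n) :: w'|> - <|w ++ (y, n) :: w'|>)
| FockForm (w w' : seq letter) s t :
    fock_rel tw (<|w ++ s :: t :: w'|> - (-1) ^+ p *: <|w ++ t :: s :: w'|>
                 - mode_form tw s t *: <|w ++ w'|>)
| FockVacuum (w : seq letter) s :
    annihilator tw s -> fock_rel tw <|rcons w s|>.

Definition fock (tw : bool) : lmodType K := presented (fock_rel tw).

Definition word (tw : bool) (w : seq letter) : fock tw := gen (fock_rel tw) w.

Definition vac (tw : bool) : fock tw := word tw [::].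

Definition mode (tw : bool) (x : X) (n : int) : fock tw -> fock tw :=
  plift (fun w => word tw ((x, n) :: w)).

Definition fock_parity (tw : bool) : fock tw -> fock tw :=
  plift (fun w => (-1) ^+ (p && odd (size w)) *: word tw w).

(* exp(2 pi i L(0)): the canonical involution of the untwisted space, acting *)
(* as -1 on each generator a(-1/2)v, whatever its parity.                    *)
Definition fock_theta : fock false -> fock false :=
  plift (fun w => (-1) ^+ (odd (size w)) *: word false w).

(* g in GL(a^+) acts on a as (g, g') with <g a, g' a'> = <a, a'>.            *)
Definition gl_ext (g : 'End(subvs_of (pol_pos X))) : 'End(X) :=
  xget 0 [set f : 'End(X) |
    [/\ forall x, f (vsval x) = vsval (g x),
        forall y, y \in pol_neg X -> f y \in pol_neg X &
        forall x y, x \in pol_pos X -> y \in pol_neg X ->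
          pol_form (f x) (f y) = pol_form x y]].

Definition gl_act (tw : bool) (g : 'End(subvs_of (pol_pos X)))
    : fock tw -> fock tw :=
  plift (fun w => word tw [seq (gl_ext g s.1, s.2) | s : letter <- w]).

Definition conformal (b : dual_bases X) : fock false :=
  2^-1 *: \sum_(i < d./2)
    (word false [:: (tnth (db_pos b) i, -2); (tnth (db_neg b) i, -1)]
     - word false [:: (tnth (db_pos b) i, -1); (tnth (db_neg b) i, -2)]).

Definition current (b : dual_bases X) : fock false :=
  \sum_(i < d./2)
    word false [:: (tnth (db_pos b) i, -1); (tnth (db_neg b) i, -1)].

End Fock.

Arguments vac {K p d} X tw.
Arguments mode {K p d X} tw x n.
Arguments fock_parity {K p d X} tw.
Arguments fock_theta {K p d X}.
Arguments gl_act {K p d X} tw g.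

Section VertexAlgebra.
Context (K : numFieldType).

Definition gbinom (x : K) (r : nat) : K :=
  (\prod_(i < r) (x - i%:R)) / (r`!)%:R.

(* Y u n is the coefficient of z^(-n-1) in Y(u,z); the superspace structure  *)
(* is given by its parity involution par; the last field is the Borcherds    *)
(* (Jacobi) identity, in which all the sums are finite by va_trunc.          *)
Record super_vertex_algebra (V : lmodType K) (par : V -> V) (vac : V)
    (Y : V -> int -> V -> V) : Prop := SuperVertexAlgebra {
  va_linear_l : forall n v c u u',
    Y (c *: u + u') n v = c *: Y u n v + Y u' n v;
  va_linear_r : forall n u c v v',
    Y u n (c *: v + v') = c *: Y u n v + Y u n v';
  va_parity : forall u n v, par (Y u n v) = Y (par u) n (par v);
  va_parity_vac : par vac = vac;
  va_trunc : forall u v, exists N : int, forall n, N <= n -> Y u n v = 0;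
  va_vacuum : forall n v, Y vac n v = if n == -1 then v else 0;
  va_creation : forall u n, 0 <= n -> Y u n vac = 0;
  va_creation_1 : forall u, Y u (-1) vac = u;
  va_borcherds : forall (i j : bool) u v w (l m n : int),
    par u = (-1) ^+ i *: u -> par v = (-1) ^+ j *: v ->
    \sum_(r \in [set: nat])
        gbinom m%:~R r *: Y (Y u (l + r%:Z) v) (m + n - r%:Z) w =
    \sum_(r \in [set: nat]) ((-1) ^+ r * gbinom l%:~R r) *:
        (Y u (m + l - r%:Z) (Y v (n + r%:Z) w)
         - ((-1) ^+ (i && j) * (-1) ^ l) *:
           Y v (n + l - r%:Z) (Y u (m + r%:Z) w))
}.

(* Modes are indexed by doubled integers: Yt u k is the coefficient of       *)
(* z^(-k/2-1) in Y_tw(u,z).  On the (-1)^s-eigenspace of the canonical       *)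
(* involution theta only the exponents in s/2 + Z occur.                     *)
Record twisted_module (V : lmodType K) (par theta : V -> V) (vac : V)
    (Y : V -> int -> V -> V) (M : lmodType K) (parM : M -> M)
    (Yt : V -> int -> M -> M) : Prop := TwistedModule {
  tw_linear_l : forall k w c u u',
    Yt (c *: u + u') k w = c *: Yt u k w + Yt u' k w;
  tw_linear_r : forall k u c w w',
    Yt u k (c *: w + w') = c *: Yt u k w + Yt u k w';
  tw_parity : forall u k w, parM (Yt u k w) = Yt (par u) k (parM w);
  tw_trunc : forall u w, exists N : int, forall k, N <= k -> Yt u k w = 0;
  tw_vacuum : forall k w, Yt vac k w = if k == -2 then w else 0;
  tw_exponents : forall (s : bool) u k w,
    theta u = (-1) ^+ s *: u -> odd `|k|%N != s -> Yt u k w = 0;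
  tw_borcherds : forall (i j s t : bool) u v w (l k k' : int),
    par u = (-1) ^+ i *: u -> par v = (-1) ^+ j *: v ->
    theta u = (-1) ^+ s *: u -> theta v = (-1) ^+ t *: v ->
    odd `|k|%N = s -> odd `|k'|%N = t ->
    \sum_(r \in [set: nat]) gbinom (k%:~R / 2) r *:
        Yt (Y u (l + r%:Z) v) (k + k' - 2 * r%:Z) w =
    \sum_(r \in [set: nat]) ((-1) ^+ r * gbinom l%:~R r) *:
        (Yt u (k + 2 * l - 2 * r%:Z) (Yt v (k' + 2 * r%:Z) w)
         - ((-1) ^+ (i && j) * (-1) ^ l) *:
           Yt v (k' + 2 * l - 2 * r%:Z) (Yt u (k + 2 * r%:Z) w))
}.

(* The super vertex algebra structure on A and the canonically twisted       *)
(* A-module structure on A_tw determined by their values on the generators   *)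
(* a(-1/2)v; since z^(-n-1/2) = z^(-k/2-1) for k = 2n-1, a(n) is the mode    *)
(* 2n-1 in the indexing of Yt.                                               *)
Record fock_fields (p : bool) (d : nat) (X : polarized K p d) := FockFields {
  ff_Y : fock X false -> int -> fock X false -> fock X false;
  ff_Ytw : fock X false -> int -> fock X true -> fock X true;
  ff_va : super_vertex_algebra (fock_parity false) (vac X false) ff_Y;
  ff_gen : forall x n w,
    ff_Y (mode false x (-1) (vac X false)) n w = mode false x n w;
  ff_twisted : twisted_module (fock_parity false) fock_theta (vac X false)
    ff_Y (fock_parity true) ff_Ytw;
  ff_gen_tw : forall x n w,
    ff_Ytw (mode false x (-1) (vac X false)) (2 * n - 1) w = mode true x n w
}.

(* Y_tw(u1 (x) u2, z)(x1 (x) x2)                                             *)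
(*   = (-1)^(|u2||x1|) Y_tw(u1,z)x1 (x) Y_tw(u2,z)x2,                        *)
(* u2 being split into its components of parity j = 0, 1.  The indices obey  *)
(* k1 + k2 = k - 2 because z^(-k1/2-1) z^(-k2/2-1) = z^(-k/2-1).             *)
Definition tensor_Ytw (V1 V2 M1 M2 : lmodType K) (par2 : V2 -> V2)
    (parM1 : M1 -> M1) (Y1 : V1 -> int -> M1 -> M1) (Y2 : V2 -> int -> M2 -> M2)
    (u : tensor V1 V2) (k : int) (x : tensor M1 M2) : tensor M1 M2 :=
  plift (fun u12 : V1 * V2 => plift (fun x12 : M1 * M2 =>
    \sum_(j : bool) \sum_(k1 \in [set: int])
      tens (Y1 u12.1 k1 (if j then parM1 x12.1 else x12.1))
           (Y2 (2^-1 *: (u12.2 + (-1) ^+ j *: par2 u12.2)) (k - 2 - k1) x12.2))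
    x) u.

End VertexAlgebra.

Section Trace.
Context (K : fieldType) (V : lmodType K).

(* S is a finite-dimensional subspace preserved by T, and T|S has trace t.   *)
Definition has_trace (S : set V) (T : V -> V) (t : K) : Prop :=
  exists (n : nat) (e : 'I_n -> V) (A : 'M[K]_n),
    [/\ S = [set x | exists c : 'I_n -> K, x = \sum_i c i *: e i],
        forall c : 'I_n -> K, \sum_i c i *: e i = 0 -> forall i, c i = 0,
        forall i, T (e i) = \sum_j A i j *: e j
      & t = \tr A].

(* tr (T y^J q^L | V) = sum_(m,n) t m n y^m q^n: V is spanned by the joint   *)
(* eigenvectors of J and L with eigenvalues (m, n) in Z x N, each joint      *)
(* eigenspace is finite-dimensional, and T has trace t m n on it.            *)
Definition graded_trace (T J L : V -> V) (t : int -> nat -> K) : Prop :=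
  let E m n := [set w | J w = m%:~R *: w /\ L w = n%:R *: w] in
  (forall w, lspan [set u | exists m n, E m n u] w) /\
  (forall m n, has_trace (E m n) T (t m n)).

End Trace.

Section W7.
Context (K : numFieldType).
Variables (E A : polarized K true 2) (B : polarized K false 4).

Definition W7 : lmodType K :=
  tensor (tensor (fock E false) (fock A false)) (fock B false).
Definition W7tw : lmodType K :=
  tensor (tensor (fock E true) (fock A true)) (fock B true).

Variables (FE : fock_fields E) (FA : fock_fields A) (FB : fock_fields B).

Definition W7_Ytw : W7 -> int -> W7tw -> W7tw :=
  tensor_Ytw (fock_parity false)
    (tensor_map (fock_parity true) (fock_parity true))
    (tensor_Ytw (fock_parity false) (fock_parity true) (ff_Ytw FE) (ff_Ytw FA))
    (ff_Ytw FB).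

Variables (bE : dual_bases E) (bA : dual_bases A) (bB : dual_bases B).

Let vE := vac E false.
Let vA := vac A false.
Let vB := vac B false.

Definition W7_omega : W7 :=
  tens (tens (conformal bE) vA) vB + tens (tens vE (conformal bA)) vB
  + tens (tens vE vA) (conformal bB).

Definition W7_j : W7 :=
  4 *: tens (tens vE (current bA)) vB + tens (tens vE vA) (current bB).

Definition W7_je : W7 := tens (tens (current bE) vA) vB.

Definition W7_J0 : W7tw -> W7tw := W7_Ytw W7_j 0.
Definition W7_Je0 : W7tw -> W7tw := W7_Ytw W7_je 0.
Definition W7_L0 : W7tw -> W7tw := W7_Ytw W7_omega 2.

Definition W7_gl (gE : 'End(subvs_of (pol_pos E)))
    (gA : 'End(subvs_of (pol_pos A))) (gB : 'End(subvs_of (pol_pos B)))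
    : W7tw -> W7tw :=
  tensor_map (tensor_map (gl_act true gE) (gl_act true gA)) (gl_act true gB).

Definition W7_F : W7tw -> W7tw := W7_gl (- \1%VF) (- \1%VF) \1%VF.

End W7.

Section Niemeier.
Variable N : 'M[int]_24. (* Gram matrix; the lattice is 'cV[int]_24 *)

Definition lat_form (x y : 'cV[int]_24) : int := (x^T *m N *m y) 0 0.

Definition even_unimodular : Prop :=
  [/\ N^T = N, forall x, x != 0 -> 0 < lat_form x x,
      forall x, (2 %| lat_form x x)%Z & \det N = 1].

Definition lat_root (r : 'cV[int]_24) : Prop := lat_form r r = 2.

Definition cartan_A6_4 : 'M[int]_24 :=
  \matrix_(i, j) if i == j then 2
    else if (i %/ 6 == j %/ 6)%N && ((i.+1 == j :> nat) || (j.+1 == i :> nat))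
    then -1 else 0.

(* The columns of P are roots forming a base of the root system.             *)
Definition root_system_A6_4 : Prop :=
  exists P : 'M[int]_24, P^T *m N *m P = cartan_A6_4 /\
    forall r, lat_root r -> exists x, r = P *m x.

Definition lat_aut (g : 'M[int]_24) : Prop := g^T *m N *m g = N.

Definition reflection (r : 'cV[int]_24) : 'M[int]_24 := 1%:M - r *m (r^T *m N).

Inductive lat_inn : 'M[int]_24 -> Prop :=
| lat_inn1 : lat_inn 1%:M
| lat_innM r g : lat_root r -> lat_inn g -> lat_inn (reflection r *m g).

(* pi exhibits G as the quotient Aut(N)/Inn(N).                              *)
Definition umbral_quotient (G : groupType) (pi : 'M[int]_24 -> G) : Prop :=
  [/\ forall g h, lat_aut g -> lat_aut h -> pi (g *m h) = (pi g * pi h)%g,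
      forall x, exists2 g, lat_aut g & pi g = x
    & forall g, lat_aut g -> (pi g = 1%g <-> lat_inn g)].

End Niemeier.

Inductive class7 := c1A | c2A | c4A | c3A | c6A | c3B | c6B.

Definition class_order (c : class7) : nat :=
  match c with
  | c1A => 1 | c2A => 2 | c4A => 4 | c3A | c3B => 3 | c6A | c6B => 6
  end.

(* cl labels the conjugacy classes of G by their Atlas-style names.          *)
Definition class_labelling (G : groupType) (cl : G -> class7) : Prop :=
  [/\ forall x y, cl x = cl y <-> exists h, y = (x ^ h)%g,
      forall c, exists x, cl x = c
    & forall x, (x ^+ class_order (cl x))%g = 1%g /\
        forall m, (0 < m < class_order (cl x))%N -> (x ^+ m)%g != 1%g].

Definition gl_hom (G : groupType) (K : fieldType) (U : vectType K)
    (rho : G -> 'End(U)) : Prop :=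
  rho 1%g = \1%VF /\ forall x y, rho (x * y)%g = (rho x \o rho y)%VF.

Section Analytic.
Context (R : realType).
Local Notation C := R[i].
Local Notation "'i" := ('i%C : C).

Definition b3 : C := (-1 + 'i * (Num.sqrt 3)%:C%C) / 2.

Definition chi2 (c : class7) : C :=
  match c with
  | c1A | c2A | c4A => 1 | c3A | c6B => b3 | c6A | c3B => b3^*
  end.

Definition chi6 (c : class7) : C :=
  match c with
  | c1A => 2 | c2A => -2 | c4A => 0
  | c3A => - b3^* | c6A => b3 | c3B => - b3 | c6B => b3^*
  end.

Definition cexp (x : C) : C :=
  Complex (expR (complex.Re x) * cos (complex.Im x))
          (expR (complex.Re x) * sin (complex.Im x)).

Definition e2pi (x : C) : C := cexp (2 * pi%:C%C * 'i * x).

Definition infprod (f : nat -> C) : C :=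
  lim ((\prod_(1 <= n < m.+1) f n : C^o) @[m --> \oo]).

Definition eta (tau : C) : C :=
  e2pi (tau / 24) * infprod (fun n => 1 - e2pi tau ^+ n).

Definition theta1 (tau z : C) : C :=
  let q := e2pi tau in let y := e2pi z in
  - 'i * e2pi (tau / 8) * e2pi (z / 2) *
  infprod (fun n => (1 - y^-1 * q ^+ n.-1) * (1 - y * q ^+ n) * (1 - q ^+ n)).

Definition theta2 (tau z : C) : C :=
  let q := e2pi tau in let y := e2pi z in
  e2pi (tau / 8) * e2pi (z / 2) *
  infprod (fun n => (1 + y^-1 * q ^+ n.-1) * (1 + y * q ^+ n) * (1 - q ^+ n)).

Definition psi7 (c : class7) (tau z : C) : C :=
  match c with
  | c1A => 2 * 'i * eta tau ^+ 3 * theta1 tau (4 * z) / theta1 tau z ^+ 2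
  | c2A => - 2 * 'i * eta tau ^+ 3 * theta1 tau (4 * z) / theta2 tau z ^+ 2
  | c4A => - 2 * 'i * eta tau * eta (2 * tau) * theta1 tau (4 * z)
           / theta2 (2 * tau) (2 * z)
  | c3A | c3B =>
      - 'i * (eta (3 * tau) / theta1 (3 * tau) (3 * z)) *
      (theta1 tau (4 * z + 1 / 3) * theta1 tau (z - 1 / 3)
       + theta1 tau (4 * z - 1 / 3) * theta1 tau (z + 1 / 3))
  | c6A | c6B =>
      - 'i * (eta (3 * tau) / theta2 (3 * tau) (3 * z)) *
      (theta1 tau (4 * z + 1 / 3) * theta1 tau (z + 1 / 6)
       - theta1 tau (4 * z - 1 / 3) * theta1 tau (z - 1 / 6))
  end.

(* Unconditional (equivalently, absolute) convergence of a family to s.      *)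
Definition has_sum (I : choiceType) (f : I -> C) (s : C) : Prop :=
  forall eps : R, 0 < eps -> exists F0 : {fset I}, forall F : {fset I},
    (F0 `<=` F)%fset -> `|\sum_(i <- F) f i - s| < (eps%:C)%C.

End Analytic.

(* Main.v *)
(* Ordered monomials in the creation modes form bases of the Fock spaces: they
   span by reordering, and they are independent because the vacuum functional,
   defined by Wick's rule, pairs them with monomials in annihilation modes.  The
   Borcherds identity shows that the commutators of J(0) and L(0) with a mode
   are multiples of that mode, and gives their values on the twisted vacuum, so
   both are diagonal on monomials.  Diagonalizing g on b^+ by a suitable choice
   of dual bases makes g diagonal as well, and the trace becomes a sum over
   monomials that factors into q-products.  On the factor of e the sum is
   sum (1/2 + charge) (-1)^size q^weight, the y-derivative at y = 1 of a product
   with a vanishing zero-mode factor, hence prod (1 - q^n)^2.  This gives, for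
   eigenvalues chi of g on a^+ and l1, l2 on b^+, and P(x) the product of
   (1 - x^-1 q^(n-1)) (1 - x q^n),
     y prod (1 - q^n)^2 P(chi y^4) / (P(l1 y) P(l2 y)),
   and psi_g is minus the sum of this and of the same expression for g^-1.  The
   eigenvalues follow from the characters and the orders of g; products over
   square or cube roots of unity turn P at q, y into P at q^2, y^2 or q^3, y^3. *)

Require Import Defs.
From HB Require Import structures.
From mathcomp Require Import all_boot all_order all_algebra.
From mathcomp Require Import ring_quotient generic_quotient.
From mathcomp Require Import finmap.
From mathcomp Require Import all_classical all_reals all_analysis.
From mathcomp Require Import complex.
From mathcomp Require Import(canonicals) monalg.
From mathcomp Require Import ring lra zify.

Set Implicit Arguments.
Unset Strict Implicit.
Unset Printing Implicit Defensive.

Import Order.TTheory GRing.Theory Num.Theory.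
Import numFieldNormedType.Exports.
Local Open Scope ring_scope.

(** * Presented spaces and Fock spaces *)

(** The vertex operators are known only through the axioms in [fock_fields], so every eigenvalue of
    J(0) and L(0) has to be extracted from an instance of the Borcherds identity. The half-integral
    binomials of its twisted form produce the vacuum values 1/2 and 1/8 per dual pair, with opposite
    signs in the Weyl case. In W_tw they add up to charge 4/2 - 1 = 1, which is the leading factor
    y, and to weight 0.

    The current and the Virasoro element refer to fixed dual bases, while the monomials need a basis
    that diagonalizes g. The charge and weight of a mode depend only on the polarization and the
    mode number, so the two bases are kept independent.

    The trace groups monomials by charge and weight, whereas only sums over boxes of monomials
    factor into products. A bound on the sums of moduli, uniform in the box, permits the regrouping.
    The domain says |y^-1| < 1 and |y q| < 1, and g has eigenvalues of modulus one on b^+, so the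
    geometric series of the bosonic modes converge. *)

Section LinearMaps.
Context (K : nzRingType) (U V : lmodType K) (f : U -> V).
Hypothesis lf : linear f.

Lemma lin0 : f 0 = 0.
Proof. by move: (lf 1 0 0); rewrite !scale1r addr0 => /eqP; rewrite -subr_eq0 opprD addrA subrr add0r oppr_eq0 => /eqP. Qed.

Lemma linD x y : f (x + y) = f x + f y.
Proof. by rewrite -[x]scale1r lf !scale1r. Qed.

Lemma linZ c x : f (c *: x) = c *: f x.
Proof. by rewrite -[c *: x]addr0 lf lin0 addr0. Qed.

Lemma linN x : f (- x) = - f x.
Proof. by rewrite -scaleN1r linZ scaleN1r. Qed.

Lemma linB x y : f (x - y) = f x - f y.
Proof. by rewrite linD linN. Qed.

Lemma lin_sum (I : Type) (r : seq I) (P : pred I) (F : I -> U) :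
  f (\sum_(i <- r | P i) F i) = \sum_(i <- r | P i) f (F i).
Proof.
elim: r => [|i r IH]; first by rewrite !big_nil lin0.
by rewrite !big_cons; case: (P i); rewrite ?linD IH.
Qed.

Lemma lin_lspan (S : set U) (T : set V) :
  (forall x, S x -> lspan T (f x)) -> forall x, lspan S x -> lspan T (f x).
Proof.
move=> ST x; elim=> [|c u v Su _ IH]; first by rewrite lin0; apply: lspan0.
by rewrite lf; apply: lspanD => //; apply/lspanZ/ST.
Qed.

End LinearMaps.

Lemma lspan_mono (K : nzRingType) (V : lmodType K) (S T : set V) :
  (forall x, S x -> lspan T x) -> forall x, lspan S x -> lspan T x.
Proof. by move=> ST; apply: (@lin_lspan _ _ _ id). Qed.

Lemma lspan_id (K : nzRingType) (V : lmodType K) (S : set V) x :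
  S x -> lspan S x.
Proof.
by move=> Sx; rewrite -[x]scale1r -[_ *: _]addr0; apply: lspanZD => //; apply: lspan0.
Qed.

Lemma lspan_sum (K : nzRingType) (V : lmodType K) (S : set V) (I : Type)
    (r : seq I) (P : pred I) (F : I -> V) :
  (forall i, lspan S (F i)) -> lspan S (\sum_(i <- r | P i) F i).
Proof.
move=> SF; elim: r => [|i r IH]; first by rewrite big_nil; apply: lspan0.
by rewrite big_cons; case: (P i) => //; apply: lspanD.
Qed.

Lemma lin_ext_span (K : nzRingType) (U V : lmodType K) (S : set U)
    (f g : U -> V) : linear f -> linear g ->
  (forall x, lspan S x) -> (forall x, S x -> f x = g x) -> f =1 g.
Proof.
move=> lf lg HS fg x; elim: (HS x) => [|c u v Su _ IH].
  by rewrite !lin0.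
by rewrite lf lg fg // IH.
Qed.

Section FreeExtension.
Context (K : nzRingType) (T : choiceType) (V : lmodType K) (f : T -> V).

Definition free_ext (y : {free K[T]}) : V :=
  \sum_(t <- monalg.msupp y) monalg.mcoeff t y *: f t.

Lemma free_extEw (d : {fset T}) y : (monalg.msupp y `<=` d)%fset ->
  free_ext y = \sum_(t <- d) monalg.mcoeff t y *: f t.
Proof.
move=> le; rewrite /free_ext; apply: big_fset_incl => // t _ /monalg.mcoeff_outdom ->.
by rewrite scale0r.
Qed.

Lemma free_ext_linear : linear free_ext.
Proof.
move=> c x y; pose d := (monalg.msupp x `|` monalg.msupp y `|` monalg.msupp (c *: x + y))%fset.
have sx : (monalg.msupp x `<=` d)%fset by apply/fsubsetP => t; rewrite !inE => ->.
have sy : (monalg.msupp y `<=` d)%fset by apply/fsubsetP => t; rewrite !inE => ->; rewrite orbT.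
have sz : (monalg.msupp (c *: x + y) `<=` d)%fset by apply/fsubsetP => t; rewrite !inE => ->; rewrite orbT.
rewrite (free_extEw sx) (free_extEw sy) (free_extEw sz) scaler_sumr -big_split /=.
by apply: eq_bigr => t _; rewrite monalg.mcoeffD monalg.mcoeffZ scalerDl scalerA.
Qed.

Lemma free_extU t : free_ext <|t|> = f t.
Proof.
rewrite (@free_extEw [fset t]%fset) ?big_seq_fset1 ?monalg.mcoeffUU ?scale1r //.
exact: monalg.msuppU_le.
Qed.

End FreeExtension.

Section Presented.
Context (K : nzRingType) (T : choiceType) (Rel : set {free K[T]}).

Lemma gen_linear_pi : linear (\pi_(lquot Rel)%qT : {free K[T]} -> presented Rel).
Proof. by move=> c x y; rewrite lquot_piD -lquot_scale_pi. Qed.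

Lemma gen_span (x : presented Rel) : lspan [set u | exists t, u = gen Rel t]%classic x.
Proof.
have [v ->] := lquotP (x : lquot Rel).
rewrite [v]monalg.monalgE (lin_sum gen_linear_pi).
apply: lspan_sum => t.
have -> : monalg.mkmalgU t (monalg.mcoeff t v) = monalg.mcoeff t v *: <|t|>.
  by apply/monalg.malgP => k; rewrite monalg.mcoeffZ !monalg.mcoeffU mulrnAr mulr1.
rewrite (linZ gen_linear_pi); apply: lspanZ; apply: lspan_id; by exists t.
Qed.

Lemma gen_rel y : Rel y -> (\pi_(lquot Rel)%qT y : presented Rel) = 0.
Proof.
move=> Ry; rewrite -(lin0 gen_linear_pi); apply/eqP.
by rewrite lquot_piE subr0; apply/asboolP/lspan_id.
Qed.

Context (V : lmodType K) (f : T -> V).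
Hypothesis fRel : forall y, Rel y -> free_ext f y = 0.

Lemma free_ext_lspan y : lspan Rel y -> free_ext f y = 0.
Proof.
elim=> [|c u v Ru _ IH]; first exact: (lin0 (free_ext_linear f)).
by rewrite free_ext_linear fRel // scaler0 add0r.
Qed.

(** The representative chosen by [plift] differs from [y] by an element of the span of [Rel], on
    which the linear extension vanishes. *)
Lemma plift_pi y : plift f (\pi_(lquot Rel)%qT y : presented Rel) = free_ext f y.
Proof.
rewrite -[LHS]/(free_ext f (repr (\pi_(lquot Rel)%qT y))).
apply/eqP; rewrite -subr_eq0 -(linB (free_ext_linear f)); apply/eqP/free_ext_lspan.
by apply/asboolP; rewrite -[X in is_true X]/(_ \in lspan_mem Rel) -lquot_piE reprK.
Qed.

Lemma plift_gen t : plift f (gen Rel t) = f t.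
Proof. by rewrite /gen plift_pi free_extU. Qed.

Lemma plift_linear : linear (plift f : presented Rel -> V).
Proof.
move=> c x y.
have [u ->] := lquotP (x : lquot Rel); have [v ->] := lquotP (y : lquot Rel).
by rewrite -gen_linear_pi !plift_pi free_ext_linear.
Qed.

End Presented.

(** All three lifts evaluate at the same representative of [x], so the identity is termwise. It
    yields linearity in a parameter of the lifted function, such as the vector of a mode. *)
Lemma plift_comb (K : comNzRingType) (T : choiceType) (Rel : set {free K[T]})
    (V : lmodType K) (c : K) (f g h : T -> V) (x : presented Rel) :
  (forall t, f t = c *: g t + h t) -> plift f x = c *: plift g x + plift h x.
Proof.
move=> E; rewrite /plift scaler_sumr -big_split /=; apply: eq_bigr => t _.
by rewrite E scalerDr !scalerA mulrC.
Qed.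

Section Form.
Context (K : fieldType) (p : bool) (d : nat) (X : polarized K p d).

Lemma pform_linear_r c (x y y' : X) :
  pol_form x (c *: y + y') = c * pol_form x y + pol_form x y'.
Proof.
rewrite [LHS]pol_form_sym pol_form_linear (pol_form_sym y x) (pol_form_sym y' x).
by rewrite mulrDr mulrCA.
Qed.

Lemma pformDl (x x' y : X) : pol_form (x + x') y = pol_form x y + pol_form x' y.
Proof. by rewrite -[x]scale1r pol_form_linear mul1r scale1r. Qed.

Lemma pformDr (x y y' : X) : pol_form x (y + y') = pol_form x y + pol_form x y'.
Proof. by rewrite -[y]scale1r pform_linear_r mul1r scale1r. Qed.

Lemma pform0l (y : X) : pol_form 0 y = 0.
Proof. by apply: (addrI (pol_form (0 : X) y)); rewrite -pformDl !addr0. Qed.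

Lemma pform0r (y : X) : pol_form y 0 = 0.
Proof. by rewrite pol_form_sym pform0l mulr0. Qed.

Lemma pformZl c (x y : X) : pol_form (c *: x) y = c * pol_form x y.
Proof. by rewrite -[c *: x]addr0 pol_form_linear pform0l addr0. Qed.

Lemma pformZr c (x y : X) : pol_form y (c *: x) = c * pol_form y x.
Proof. by rewrite -[c *: x]addr0 pform_linear_r pform0r addr0. Qed.

Lemma pform_suml I (r : seq I) (P : pred I) (F : I -> X) y :
  pol_form (\sum_(i <- r | P i) F i) y = \sum_(i <- r | P i) pol_form (F i) y.
Proof. by apply: (big_morph (fun x => pol_form x y)) => [u v|]; rewrite ?pformDl ?pform0l. Qed.

Lemma pform_sumr I (r : seq I) (P : pred I) (F : I -> X) y :
  pol_form y (\sum_(i <- r | P i) F i) = \sum_(i <- r | P i) pol_form y (F i).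
Proof. by apply: (big_morph (fun x => pol_form y x)) => [u v|]; rewrite ?pformDr ?pform0r. Qed.

Lemma pform_swap (x y : X) : pol_form y x = - (-1) ^+ p * pol_form x y.
Proof. by rewrite pol_form_sym; congr (_ * _); case: (p); rewrite /= ?expr1 ?expr0 ?opprK. Qed.

End Form.

Section Fock.
Context (K : fieldType) (p : bool) (d : nat) (X : polarized K p d) (tw : bool).
Local Notation F := (fock X tw).
Local Notation word := (@word K p d X tw).
Local Notation mode := (@mode K p d X tw).

(** The criterion for [plift f] to be well defined on a Fock space, with one hypothesis for each
    constructor of [fock_rel]. *)
Lemma fock_relP (V : lmodType K) (f : seq (letter X) -> V) :
  (forall w w' c x y n, f (w ++ (c *: x + y, n) :: w') =
     c *: f (w ++ (x, n) :: w') + f (w ++ (y, n) :: w')) ->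
  (forall w w' s t, f (w ++ s :: t :: w') = (-1) ^+ p *: f (w ++ t :: s :: w')
     + mode_form tw s t *: f (w ++ w')) ->
  (forall w s, annihilator tw s -> f (rcons w s) = 0) ->
  forall y, fock_rel tw y -> free_ext f y = 0.
Proof.
move=> fL fF fV y.
case=> [w w' c u v n|w w' s t|w s As]; last by rewrite free_extU fV.
- rewrite !(linB (free_ext_linear f)) (linZ (free_ext_linear f)) !free_extU fL.
  by apply/eqP; rewrite -addrA -opprD subr_eq0.
- rewrite !(linB (free_ext_linear f)) !(linZ (free_ext_linear f)) !free_extU fF.
  by apply/eqP; rewrite -addrA -opprD subr_eq0.
Qed.

Lemma word_linear w w' c x y n : word (w ++ (c *: x + y, n) :: w') =
  c *: word (w ++ (x, n) :: w') + word (w ++ (y, n) :: w').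
Proof.
have := gen_rel (FockLinear tw w w' c x y n).
rewrite !(linB (gen_linear_pi _)) (linZ (gen_linear_pi _)) => /eqP.
by rewrite -addrA -opprD subr_eq0 => /eqP.
Qed.

Lemma word_form w w' s t : word (w ++ s :: t :: w') =
  (-1) ^+ p *: word (w ++ t :: s :: w') + mode_form tw s t *: word (w ++ w').
Proof.
have := gen_rel (FockForm tw w w' s t).
rewrite !(linB (gen_linear_pi _)) !(linZ (gen_linear_pi _)) => /eqP.
by rewrite -addrA -opprD subr_eq0 => /eqP.
Qed.

Lemma word_vacuum w s : annihilator tw s -> word (rcons w s) = 0.
Proof. by move=> As; apply: gen_rel; apply: FockVacuum. Qed.

Lemma fock_span (v : F) : lspan [set u | exists w, u = word w]%classic v.
Proof. exact: gen_span. Qed.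

Lemma fock_lin_ext (V : lmodType K) (f g : F -> V) : linear f -> linear g ->
  (forall w, f (word w) = g (word w)) -> f =1 g.
Proof.
by move=> lf lg fg; apply: (lin_ext_span lf lg fock_span) => _ [w ->]; apply: fg.
Qed.

Lemma mode_rel x n y : fock_rel tw y ->
  free_ext (fun w : seq (letter X) => word ((x, n) :: w)) y = 0.
Proof.
move: y; apply: fock_relP => [w w' c u v m|w w' s t|w s As].
- exact: (word_linear ((x, n) :: w)).
- exact: (word_form ((x, n) :: w)).
- by rewrite -rcons_cons word_vacuum.
Qed.

Lemma mode_word x n w : mode x n (word w) = word ((x, n) :: w).
Proof. exact: (plift_gen (mode_rel x n)). Qed.

Lemma mode_linear x n : linear (mode x n).
Proof. exact: (plift_linear (mode_rel x n)). Qed.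

Lemma mode_linear_l c x y n v :
  mode (c *: x + y) n v = c *: mode x n v + mode y n v.
Proof. by apply: plift_comb => w; apply: (word_linear [::]). Qed.

Lemma mode_comm x m y n v : mode x m (mode y n v) =
  (-1) ^+ p *: mode y n (mode x m v) + mode_form tw (x, m) (y, n) *: v.
Proof.
move: v; apply: fock_lin_ext => [c u v|c u v|w].
- by rewrite !mode_linear.
- by rewrite !mode_linear !scalerDr !scalerA mulrC [_ * c]mulrC addrACA.
- by rewrite !mode_word (word_form [::]).
Qed.

Lemma mode_vac x n : annihilator tw (x, n) -> mode x n (vac X tw) = 0.
Proof. by move=> An; rewrite /vac mode_word (@word_vacuum [::]). Qed.

Lemma mode0 n v : mode 0 n v = 0.
Proof. by have := mode_linear_l (-1) 0 0 n v; rewrite scaler0 addr0 scaleN1r addNr. Qed.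

Lemma mode_suml I (r : seq I) (P : pred I) (G : I -> X) n v :
  mode (\sum_(i <- r | P i) G i) n v = \sum_(i <- r | P i) mode (G i) n v.
Proof.
apply: (big_morph (fun x => mode x n v)) => [x y|]; last exact: mode0.
by rewrite -[x]scale1r mode_linear_l !scale1r.
Qed.

Lemma modeZl c x n v : mode (c *: x) n v = c *: mode x n v.
Proof. by rewrite -[c *: x]addr0 mode_linear_l mode0 addr0. Qed.

End Fock.

Arguments mode_linear {K p d X tw} x n.

Section Parity.
Context (K : fieldType) (p : bool) (d : nat) (X : polarized K p d).

(** With [a = p] this serves the parity, with [a = true] the involution theta. The commutator
    relation drops two letters at once and so respects the sign. *)
Lemma sign_word_rel (a tw : bool) y : fock_rel tw y ->
  free_ext (fun w : seq (letter X) => (-1) ^+ (a && odd (size w)) *: word tw w) y = 0.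
Proof.
move: y; apply: fock_relP => [w w' c u v m|w w' s t|w s As].
- by rewrite word_linear !size_cat /= scalerDr !scalerA mulrC.
- rewrite word_form !size_cat /= !addnS /= negbK scalerDr !scalerA mulrC.
  by rewrite [_ * mode_form _ _ _]mulrC.
- by rewrite word_vacuum // scaler0.
Qed.

Lemma fock_parity_word tw w :
  fock_parity tw (word tw w) = (-1) ^+ (p && odd (size w)) *: word (X := X) tw w.
Proof. exact: (plift_gen (@sign_word_rel p tw)). Qed.

Lemma fock_parity_linear tw : linear (@fock_parity K p d X tw).
Proof. exact: (plift_linear (@sign_word_rel p tw)). Qed.

Lemma fock_theta_word w :
  fock_theta (word false w) = (-1) ^+ odd (size w) *: word (X := X) false w.
Proof. exact: (plift_gen (@sign_word_rel true false)). Qed.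

Lemma fock_theta_linear : linear (@fock_theta K p d X).
Proof. exact: (plift_linear (@sign_word_rel true false)). Qed.

End Parity.

(** * The vacuum functional *)

Section Bases.
Context (K : fieldType) (p : bool) (d : nat) (X : polarized K p d).
Context (b : dual_bases X).
Local Notation h := (d./2).

Definition dpos (i : 'I_h) : X := tnth (db_pos b) i.
Definition dneg (i : 'I_h) : X := tnth (db_neg b) i.

Lemma dpos_mem i : dpos i \in pol_pos X.
Proof. by apply: (basis_mem (db_pos_basis b)); apply: mem_tnth. Qed.

Lemma dneg_mem i : dneg i \in pol_neg X.
Proof. by apply: (basis_mem (db_neg_basis b)); apply: mem_tnth. Qed.

Lemma form_neg_pos i j : pol_form (dneg i) (dpos j) = (i == j)%:R.
Proof. exact: db_dual. Qed.

Lemma form_pos_neg i j : pol_form (dpos i) (dneg j) = - (-1) ^+ p * (i == j)%:R.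
Proof. by rewrite pform_swap form_neg_pos eq_sym. Qed.

Lemma form_pos_pos x y : x \in pol_pos X -> y \in pol_pos X -> pol_form x y = 0.
Proof. by move=> xp yp; apply: pol_pos_isotropic. Qed.

Lemma form_neg_neg x y : x \in pol_neg X -> y \in pol_neg X -> pol_form x y = 0.
Proof. by move=> xp yp; apply: pol_neg_isotropic. Qed.

(** The projections onto the two summands of the polarization. The sign in [neg_part] is the value
    of <a_i^+, a_i^->, which is its own inverse. *)
Definition pos_part (x : X) : X := \sum_i pol_form (dneg i) x *: dpos i.
Definition neg_part (x : X) : X := \sum_i (- (-1) ^+ p * pol_form (dpos i) x) *: dneg i.

Lemma signMM : (- (-1) ^+ p * (- (-1) ^+ p)) = 1 :> K.
Proof. by rewrite mulrNN -expr2 sqrr_sign. Qed.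

Lemma pos_part_id x : x \in pol_pos X -> pos_part x = x.
Proof.
move=> xp; rewrite {2}(coord_basis (db_pos_basis b) xp) /pos_part.
apply: eq_bigr => i _; rewrite /dpos (tnth_nth 0); congr (_ *: _).
rewrite {1}(coord_basis (db_pos_basis b) xp) pform_sumr (bigD1 i) //= big1 => [|j ji].
  by rewrite pformZr -tnth_nth form_neg_pos eqxx mulr1 addr0.
by rewrite pformZr -tnth_nth form_neg_pos eq_sym (negPf ji) mulr0.
Qed.

Lemma neg_part_id x : x \in pol_neg X -> neg_part x = x.
Proof.
move=> xp; rewrite {2}(coord_basis (db_neg_basis b) xp) /neg_part.
apply: eq_bigr => i _; rewrite /dneg (tnth_nth 0); congr (_ *: _).
rewrite {1}(coord_basis (db_neg_basis b) xp) pform_sumr (bigD1 i) //= big1 => [|j ji].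
  by rewrite pformZr -tnth_nth form_pos_neg eqxx mulr1 addr0 mulrC -mulrA signMM mulr1.
by rewrite pformZr -tnth_nth form_pos_neg eq_sym (negPf ji) !mulr0.
Qed.

Lemma pos_part_neg x : x \in pol_neg X -> pos_part x = 0.
Proof.
by move=> xn; apply: big1 => i _; rewrite form_neg_neg ?scale0r ?dneg_mem.
Qed.

Lemma neg_part_pos x : x \in pol_pos X -> neg_part x = 0.
Proof.
by move=> xn; apply: big1 => i _; rewrite form_pos_pos ?mulr0 ?scale0r ?dpos_mem.
Qed.

Lemma pos_part_linear : linear pos_part.
Proof.
move=> c x y; rewrite /pos_part scaler_sumr -big_split; apply: eq_bigr => i _ /=.
by rewrite pform_linear_r scalerDl scalerA.
Qed.

Lemma neg_part_linear : linear neg_part.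
Proof.
move=> c x y; rewrite /neg_part scaler_sumr -big_split; apply: eq_bigr => i _ /=.
by rewrite pform_linear_r mulrDr scalerDl scalerA mulrCA.
Qed.

Lemma pos_neg_part x : x = pos_part x + neg_part x.
Proof.
have : x \in (pol_pos X + pol_neg X)%VS by rewrite pol_sum memvf.
case/memv_addP => u up [v vn] ->.
rewrite (linD pos_part_linear) (linD neg_part_linear) (pos_part_id up).
by rewrite (neg_part_id vn) (pos_part_neg vn) (neg_part_pos up) addr0 add0r.
Qed.

Lemma pos_part_mem x : pos_part x \in pol_pos X.
Proof. by apply: memv_suml => i _; apply/memvZ/dpos_mem. Qed.

Lemma neg_part_mem x : neg_part x \in pol_neg X.
Proof. by apply: memv_suml => i _; apply/memvZ/dneg_mem. Qed.

End Bases.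

Lemma sign_cases (K : pzRingType) (p : bool) :
  (-1) ^+ p = 1 :> K \/ (-1) ^+ p = -1 :> K.
Proof. by case: p; [right|left]. Qed.

Section Vev.
Context (K : fieldType) (p : bool) (d : nat) (X : polarized K p d).
Context (b : dual_bases X).
Local Notation L := (letter X).
Local Notation sg := ((-1) ^+ p : K).
Local Notation mf := (@mode_form K p d X true).

Definition creation (s : L) : Prop := s.2 < 0 \/ (s.2 = 0 /\ s.1 \in pol_neg X).

(** The two-point function of the vacuum: the annihilating part of [s] paired with [t]. At mode zero
    only the component in a^+ annihilates. *)
Definition contr (s t : L) : K :=
  if 0 < s.2 then mf s t
  else if s.2 == 0 then mf (pos_part b s.1, 0) t else 0.

Lemma mf_linear_l c x y n t : mf (c *: x + y, n) t = c * mf (x, n) t + mf (y, n) t.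
Proof. by rewrite /mode_form /= pol_form_linear; case: (_ == 0); rewrite ?mulr1n // !mulr0n mulr0 addr0. Qed.

Lemma mf_linear_r c x y n t : mf t (c *: x + y, n) = c * mf t (x, n) + mf t (y, n).
Proof. by rewrite /mode_form /= pform_linear_r; case: (_ == 0); rewrite ?mulr1n // !mulr0n mulr0 addr0. Qed.

Lemma contr_linear_l c x y n t :
  contr (c *: x + y, n) t = c * contr (x, n) t + contr (y, n) t.
Proof.
rewrite /contr /=; case: ifP => _; first exact: mf_linear_l.
case: ifP => _; last by rewrite mulr0 addr0.
by rewrite pos_part_linear mf_linear_l.
Qed.

Lemma contr_linear_r c x y n t :
  contr t (c *: x + y, n) = c * contr t (x, n) + contr t (y, n).
Proof.
by rewrite /contr; case: ifP => _; [|case: ifP => _]; rewrite ?mf_linear_r // mulr0 addr0.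
Qed.

Lemma contr_creation s t : creation s -> contr s t = 0.
Proof.
rewrite /contr; case=> [s0|[-> sn]].
  by rewrite ltNge (ltW s0) /= lt_eqF.
by rewrite ltxx eqxx pos_part_neg // /mode_form pform0l mul0rn.
Qed.

Lemma contr_annihilator s t : annihilator true s -> contr t s = 0.
Proof.
rewrite /contr /mode_form /= addr0; case: s t => [x m] [y n] /=.
case=> /= [m0|[-> /(_ isT) xp]].
  case: ifP => n0.
    have /negPf -> : n + m != 0 by rewrite gt_eqF // addr_gt0.
    by rewrite mulr0n.
  by case: ifP => // _; rewrite addr0 add0r gt_eqF.
case: ifP => n0; first by rewrite ?addr0 gt_eqF.
case: ifP => // _; rewrite form_pos_pos ?mul0rn //; exact: pos_part_mem.
Qed.

(** The form pairs opposite modes, so at nonzero modes exactly one of the two contractions carries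
    it. At mode zero the isotropy of the summands leaves the two mixed terms, one from each
    contraction. *)
Lemma contr_comm s t : contr s t - sg * contr t s = mf s t.
Proof.
rewrite /contr /mode_form /= !addr0; case: s t => [x m] [y n] /=; rewrite ?addr0 ?add0r.
have [m0|m0|->] := ltgtP m 0.
- have [n0|n0|->] := ltgtP n 0.
  + by rewrite mulr0 subr0 lt_eqF ?mulr0n // -[0]addr0 ltrD.
  + rewrite sub0r addrC; case: (_ == 0); last by rewrite !mulr0n mulr0 oppr0.
    by rewrite !mulr1n (pform_swap x y) !mulNr mulrN opprK mulrA -expr2 sqrr_sign mul1r.
  + by rewrite addr0 lt_eqF ?mulr0n // mulr0 subr0.
- have [n0|n0|->] := ltgtP n 0.
  + by rewrite mulr0 subr0.
  + have -> : (m + n == 0) = false by rewrite gt_eqF // addr_gt0.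
    have -> : (n + m == 0) = false by rewrite gt_eqF // addr_gt0.
    by rewrite !mulr0n mulr0 subr0.
  + by rewrite mulr0n mulr0 subr0.
have [n0|n0|->] := ltgtP n 0.
- by rewrite mulr0 subr0 add0r (lt_eqF n0).
- by rewrite addr0 add0r (gt_eqF n0) mulr0n mulr0 oppr0 add0r (gt_eqF n0).
rewrite addr0 eqxx !mulr1n.
rewrite [in RHS](pos_neg_part b x) [in RHS](pos_neg_part b y) (pform_swap x).
rewrite {2}(pos_neg_part b x) {1}(pos_neg_part b y) !pformDl !pformDr.
rewrite !(@form_pos_pos _ _ _ _ (pos_part _ _) (pos_part _ _)) ?pos_part_mem //.
rewrite !(@form_neg_neg _ _ _ _ (neg_part _ _) (neg_part _ _)) ?neg_part_mem //.
by rewrite !add0r addr0 mulrA mulrN -expr2 sqrr_sign mulN1r opprK.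
Qed.

(* Wick's rule: the vacuum functional vev contracts the first letter with    *)
(* each of the others.                                                        *)
Fixpoint contr_word (s : L) (w : seq L) (phi : seq L -> K) : K :=
  if w is t :: w' then
    contr s t * phi w' + sg * contr_word s w' (fun u => phi (t :: u))
  else 0.

Lemma contr_word_ext s w phi psi :
  (forall u, (size u < size w)%N -> phi u = psi u) ->
  contr_word s w phi = contr_word s w psi.
Proof.
elim: w phi psi => //= t w IH phi psi E; rewrite E //; congr (_ + _ * _).
by apply: IH => u us; apply: E.
Qed.

Lemma contr_word_linear s w c phi psi :
  contr_word s w (fun u => c * phi u + psi u) =
  c * contr_word s w phi + contr_word s w psi.
Proof.
elim: w phi psi => [|t w IH] phi psi /=; first by rewrite mulr0 addr0.
by rewrite IH; ring.
Qed.

Lemma contr_word_linear_l w c x y n phi :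
  contr_word (c *: x + y, n) w phi =
  c * contr_word (x, n) w phi + contr_word (y, n) w phi.
Proof.
elim: w phi => [|t w IH] phi /=; first by rewrite mulr0 addr0.
by rewrite IH contr_linear_l; ring.
Qed.

(** Both sides run over the ways to contract [s] and [t] with two different letters of [w].
    Exchanging the order of removal changes the number of letters passed by one, hence the sign. *)
Lemma contr_word_comm s t w phi :
  contr_word s w (fun u => contr_word t u phi) =
  sg * contr_word t w (fun u => contr_word s u phi).
Proof.
elim: w phi => [|a w IH] phi /=; first by rewrite mulr0.
rewrite !contr_word_linear.
have E e psi r : contr_word r w (fun u => e * psi u) = e * contr_word r w psi.
  have := contr_word_linear r w e psi (fun=> 0).
  have -> : contr_word r w (fun=> 0) = 0.
    by elim: (w) => //= ? ? ->; rewrite !mulr0 addr0.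
  by rewrite addr0 => <-; apply: contr_word_ext => u _; rewrite addr0.
by rewrite !E IH; have [->|->] := sign_cases K p; ring.
Qed.

Lemma contr_word_creation s w phi : creation s -> contr_word s w phi = 0.
Proof.
by move=> cs; elim: w phi => //= t w IH phi; rewrite IH contr_creation // mul0r mulr0 addr0.
Qed.

Lemma contr_word0 s w : contr_word s w (fun=> 0) = 0.
Proof. by elim: w => //= t w ->; rewrite !mulr0 addr0. Qed.

(** The recursive calls are on words with two letters removed, which are not subterms, so the
    recursion runs on fuel. One unit is spent per contracted pair; this is why [vev_rec_form]
    relates fuel [n.+1] to fuel [n]. Exhausted fuel gives the default 0. *)
Fixpoint vev_rec (n : nat) (w : seq L) : K :=
  match n, w with
  | 0, _ => 0
  | _.+1, [::] => 1
  | n'.+1, s :: w' => contr_word s w' (vev_rec n')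
  end.

Lemma vev_recE n m w : (size w < n)%N -> (size w < m)%N -> vev_rec n w = vev_rec m w.
Proof.
elim: n m w => [|n IH] [|m] [|s w] //= wn wm; apply: contr_word_ext => u us.
by apply: IH; apply: ltn_trans us _.
Qed.

Definition vev_word w := vev_rec (size w).+1 w.

Lemma vev_word_cons s w : vev_word (s :: w) = contr_word s w vev_word.
Proof.
rewrite -[LHS]/(contr_word s w (vev_rec (size w).+1)).
by apply: contr_word_ext => u us; apply: vev_recE => //; apply: ltnW.
Qed.

Let lin_ok (phi : seq L -> K) := forall w w' c x y n,
  phi (w ++ (c *: x + y, n) :: w') = c * phi (w ++ (x, n) :: w') + phi (w ++ (y, n) :: w').

Let form_ok (phi psi : seq L -> K) := forall w w' s t, phi (w ++ s :: t :: w') =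
  sg * phi (w ++ t :: s :: w') + mf s t * psi (w ++ w').

Lemma contr_word_linear_r s phi : lin_ok phi ->
  lin_ok (fun w => contr_word s w phi).
Proof.
move=> Hphi w w' c x y n; elim: w phi Hphi => [|t w IH] phi Hphi /=.
  rewrite contr_linear_r.
  rewrite (@contr_word_ext s w' _ (fun u => c * phi ((x, n) :: u) + phi ((y, n) :: u))).
    by rewrite contr_word_linear; ring.
  by move=> u _; apply: (Hphi [::]).
rewrite Hphi IH; first by ring.
by move=> u *; apply: (Hphi (t :: u)).
Qed.

Lemma contr_word_form s phi psi : form_ok phi psi ->
  form_ok (fun w => contr_word s w phi) (fun w => contr_word s w psi).
Proof.
move=> H w w' a t; elim: w phi psi H => [|e w IH] phi psi H /=.
  rewrite (@contr_word_ext s w' (fun u => phi (a :: t :: u))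
    (fun u => sg * phi (t :: a :: u) + (mf a t * psi u + 0))); last first.
    by move=> u _; rewrite addr0; apply: (H [::]).
  rewrite contr_word_linear contr_word_linear contr_word0.
  by have [->|->] := sign_cases K p; ring.
rewrite H (IH _ (fun u => psi (e :: u))); first by ring.
by move=> u *; apply: (H (e :: u)).
Qed.

Lemma vev_rec_linear n : lin_ok (vev_rec n).
Proof.
elim: n => [|n IH] w w' c x y m /=; first by rewrite mulr0 addr0.
case: w => [|s w] /=; first exact: contr_word_linear_l.
exact: contr_word_linear_r.
Qed.

Lemma vev_rec_form n : form_ok (vev_rec n.+1) (vev_rec n).
Proof.
elim: n => [|n IH] w w' s t.
- have E0 u : vev_rec 0 u = 0 by [].
  have E a u : vev_rec 1 (a :: u) = 0 by exact: contr_word0.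
  by case: w => [|e w]; rewrite ?cat_cons ?cat0s !E E0 !mulr0 addr0.
case: w => [|e w]; last exact: (contr_word_form e IH).
rewrite !cat0s -[vev_rec n.+2 (s :: _)]/(contr s t * vev_rec n.+1 w' +
   sg * contr_word s w' (fun u => contr_word t u (vev_rec n))).
rewrite -[vev_rec n.+2 (t :: _)]/(contr t s * vev_rec n.+1 w' +
   sg * contr_word t w' (fun u => contr_word s u (vev_rec n))).
rewrite -contr_comm contr_word_comm.
by have [->|->] := sign_cases K p; ring.
Qed.

Lemma vev_rec_annihilator n w s : annihilator true s -> vev_rec n (rcons w s) = 0.
Proof.
move=> As; have E t u phi : (forall v, phi (rcons v s) = 0) -> contr_word t (rcons u s) phi = 0.
  elim: u phi => [|a u IH] phi H /=; first by rewrite contr_annihilator // mul0r mulr0 addr0.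
  by rewrite H mulr0 add0r IH ?mulr0 // => v; rewrite -rcons_cons.
elim: n w => // n IH [|t w] /=; last exact: E.
by elim: n {IH}.
Qed.

Lemma vev_word_rel y : fock_rel true y ->
  free_ext (vev_word : seq L -> K^o) y = 0.
Proof.
move: y; apply: fock_relP => [w w' c u v m|w w' s t|w s As].
- rewrite /vev_word !size_cat.
  exact: (vev_rec_linear _ w w' c u v m).
- rewrite /vev_word !size_cat.
  have -> : vev_rec (size w + size w').+1 (w ++ w') =
            vev_rec (size w + size [:: s, t & w']) (w ++ w').
    by apply: vev_recE; rewrite size_cat //= !addnS.
  exact: vev_rec_form.
exact: vev_rec_annihilator.
Qed.

Definition vev : fock X true -> K^o := plift (vev_word : seq L -> K^o).

Lemma vev_linear : linear vev.
Proof. exact: (plift_linear vev_word_rel). Qed.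

Lemma vev_vac : vev (vac X true) = 1.
Proof. exact: (plift_gen vev_word_rel). Qed.

(** Dual to the annihilation of the vacuum: together with [vev_vac] it makes [vev] the coefficient
    of the vacuum. *)
Lemma vev_creation x n v : creation (x, n) -> vev (mode true x n v) = 0.
Proof.
move=> cx; have lf : linear (fun v => vev (mode true x n v)).
  by move=> c u w; rewrite mode_linear vev_linear.
have l0 : linear (fun _ : fock X true => 0 : K^o) by move=> c u w; rewrite scaler0 addr0.
apply: (fock_lin_ext lf l0 _ v) => w; rewrite mode_word.
by rewrite /vev (plift_gen vev_word_rel) vev_word_cons contr_word_creation.
Qed.

End Vev.

(** * Poincare-Birkhoff-Witt bases *)

Section PBW.
Context (K : numFieldType) (p : bool) (d : nat) (X : polarized K p d).
Context (b : dual_bases X).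
Local Notation h := (d./2).
Hypothesis h_gt0 : (0 < h)%N.
Local Notation sg := ((-1) ^+ p : K).
Local Notation mf := (@mode_form K p d X true).
Local Notation md s := (@mode K p d X true s.1 s.2).

Definition letter_pos (k : nat) : X := dpos b (Ordinal (ltn_pmod k./2 h_gt0)).
Definition letter_neg (k : nat) : X := dneg b (Ordinal (ltn_pmod k./2 h_gt0)).

(* Creation letters: k = 2 (h n + i) stands for a_i^-(-n) and                *)
(* k = 2 (h n + i) + 1 for a_i^+(-n-1).                                      *)
Definition cletter (k : nat) : letter X :=
  if odd k then (letter_pos k, - (k./2 %/ h).+1%:Z)
  else (letter_neg k, - (k./2 %/ h)%:Z).

(** The annihilation mode conjugate to [cletter k]: among the creation letters it pairs with that
    one only. *)
Definition aletter (k : nat) : letter X :=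
  if odd k then (letter_neg k, (k./2 %/ h).+1%:Z)
  else (letter_pos k, (k./2 %/ h)%:Z).

Definition aletter_norm (k : nat) : K := if odd k then 1 else - sg.

Lemma aletter_norm_neq0 k : aletter_norm k != 0.
Proof.
by rewrite /aletter_norm; case: ifP; rewrite ?oppr_eq0 ?signr_eq0 ?oner_eq0.
Qed.

Lemma cletter_creation k : creation (cletter k).
Proof.
rewrite /creation /cletter; case: ifP => _ /=; first by left.
case: (_ %/ _)%N => [|n]; [right|left] => //; split => //; exact: dneg_mem.
Qed.

Lemma aletter_annihilator k : annihilator true (aletter k).
Proof.
rewrite /annihilator /aletter; case: ifP => _ /=; first by left.
case: (_ %/ _)%N => [|n]; [right|left] => //; split => // _; exact: dpos_mem.
Qed.

(** If a letter from a^+ is involved, the mode numbers have a negative sum; two letters from a^- are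
    isotropic. *)
Lemma mf_cletter j k : mf (cletter j) (cletter k) = 0.
Proof.
rewrite /mode_form /cletter.
case: ifP => _; case: ifP => _ /=; rewrite ?(form_neg_neg (dneg_mem _ _) (dneg_mem _ _)) ?mul0rn //;
by rewrite (_ : _ == 0 = false) ?mulr0n //; apply/eqP; move: (j./2 %/ h)%N (k./2 %/ h)%N => *; lia.
Qed.

Lemma letter_index_inj j k : odd j = odd k ->
  (j./2 %% h = k./2 %% h)%N -> (j./2 %/ h = k./2 %/ h)%N -> j = k.
Proof.
move=> o m q; rewrite -(odd_double_half j) -(odd_double_half k) o.
by rewrite (divn_eq j./2 h) (divn_eq k./2 h) m q.
Qed.

Lemma mf_aletter j k : mf (aletter j) (cletter k) = aletter_norm j *+ (j == k).
Proof.
rewrite /mode_form /cletter /aletter /aletter_norm /letter_pos /letter_neg.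
have [->|jk] := eqVneq j k.
  by case: ifP => _ /=; rewrite ?form_neg_pos ?form_pos_neg eqxx ?mulr1 addr0 subrr eqxx.
case: ifP => oj; case: ifP => ok /=; rewrite addr0.
- rewrite form_neg_pos -val_eqE /=; case: eqP => [e1|_]; last by rewrite mul0rn.
  case: eqP => [e2|//]; case/eqP: jk; apply: letter_index_inj; rewrite ?oj ?ok //.
  by move: e2; move: (j./2 %/ h)%N (k./2 %/ h)%N => *; lia.
- by rewrite (form_neg_neg (dneg_mem _ _) (dneg_mem _ _)) mul0rn.
- by rewrite (form_pos_pos (dpos_mem _ _) (dpos_mem _ _)) mul0rn.
- rewrite form_pos_neg -val_eqE /=; case: eqP => [e1|_]; last by rewrite mulr0 mul0rn.
  case: eqP => [e2|//]; case/eqP: jk; apply: letter_index_inj; rewrite ?oj ?ok //.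
  by move: e2; move: (j./2 %/ h)%N (k./2 %/ h)%N => *; lia.
Qed.

(* Ordered monomials, without repetition in the Clifford case.               *)
Definition pbw_rel : rel nat := fun m n => if p then (m < n)%N else (m <= n)%N.

Definition pbw (s : seq nat) : fock X true := word true (map cletter s).

Lemma pbw_rel_trans : transitive pbw_rel.
Proof. by rewrite /pbw_rel; case: (p) => l m n; [exact: ltn_trans | exact: leq_trans]. Qed.

Lemma pbw_cons k s : pbw (k :: s) = md (cletter k) (pbw s).
Proof. by rewrite /pbw mode_word -surjective_pairing. Qed.

Lemma pbw_swap j k s : pbw (j :: k :: s) = sg *: pbw (k :: j :: s).
Proof. by rewrite !pbw_cons mode_comm -!surjective_pairing mf_cletter scale0r addr0. Qed.

Lemma pbw_double k s : p -> pbw (k :: k :: s) = 0.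
Proof.
move=> pT; have := pbw_swap k k s.
have -> : sg = -1 by rewrite pT.
rewrite scaleN1r => /eqP; rewrite -addr_eq0 -mulr2n -scaler_nat scaler_eq0 pnatr_eq0 /=.
by move/eqP.
Qed.

(** Insertion sort, with a sign for each letter passed. The permutation is recorded in order to see
    that [t] still precedes the sorted tail. The value 0 occurs when a letter is repeated in the
    Clifford case. *)
Lemma pbw_insert k s : sorted pbw_rel s ->
  pbw (k :: s) = 0 \/
  exists c s', [/\ sorted pbw_rel s', perm_eq s' (k :: s) & pbw (k :: s) = c *: pbw s'].
Proof.
elim: s => [|t s IH] ss.
  by right; exists 1, [:: k]; split => //; rewrite scale1r.
have [kt|tk|->] := ltngtP k t.
- right; exists 1, (k :: t :: s); split; rewrite ?scale1r //= (ss : path _ _ _ = true) andbT /pbw_rel.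
  by case: (p); rewrite // ltnW.
- have /IH[z|[c [s' [s1 s2 s3]]]] : sorted pbw_rel s by apply: path_sorted ss.
    by left; rewrite pbw_swap pbw_cons z (lin0 (mode_linear _ _)) scaler0.
  right; exists (sg * c), (t :: s'); split.
  + rewrite /= path_sortedE ?s1 ?andbT; last exact: pbw_rel_trans.
    rewrite (perm_all _ s2) /=; move: ss; rewrite /= path_sortedE; last exact: pbw_rel_trans.
    by case/andP=> -> _; rewrite andbT /pbw_rel; case: (p); rewrite // ltnW.
  + apply: (@perm_trans _ (t :: k :: s)); first by rewrite perm_cons.
    by apply/permPl; apply: (perm_catCA [:: t] [:: k]).
  + by rewrite pbw_swap pbw_cons s3 (linZ (mode_linear _ _)) scalerA -pbw_cons.
have [pp|pp] : p \/ ~~ p by apply/orP/orbN.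
  by left; rewrite pbw_double.
right; exists 1, (t :: t :: s); split; rewrite ?scale1r //= (ss : path _ _ _ = true) andbT.
by rewrite /pbw_rel (negPf pp).
Qed.

Definition pbw_set : set (fock X true) :=
  [set v | exists2 s, sorted pbw_rel s & v = pbw s]%classic.

Lemma pbw_set_cletter k v : lspan pbw_set v -> lspan pbw_set (md (cletter k) v).
Proof.
apply: lin_lspan; first exact: mode_linear.
move=> _ [s ss ->]; rewrite -pbw_cons.
case: (pbw_insert k ss) => [->|[c [s' [s1 _ ->]]]]; first exact: lspan0.
by apply: lspanZ; apply: lspan_id; exists s'.
Qed.

(** The annihilation mode moves to the right, each commutator leaving a multiple of a shorter
    monomial, until it meets the vacuum. *)
Lemma pbw_set_annihilator x n v : annihilator true (x, n) ->
  lspan pbw_set v -> lspan pbw_set (mode true x n v).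
Proof.
move=> An; apply: lin_lspan; first exact: mode_linear.
move=> _ [s ss ->]; elim: s ss => [|t s IH] ss.
  by rewrite [mode _ _ _ _](mode_vac An); apply: lspan0.
rewrite pbw_cons mode_comm; have s1 : sorted pbw_rel s by apply: path_sorted ss.
apply: lspanD; apply: lspanZ; last by apply: lspan_id; exists s.
by apply: pbw_set_cletter; apply: IH.
Qed.

Lemma cletter_neg i (n : nat) : exists k, cletter k = (dneg b i, - n%:Z).
Proof.
exists (n * h + i).*2; rewrite /cletter odd_double /letter_neg; congr (dneg b _, - (Posz _)).
  by apply: val_inj; rewrite /= doubleK modnMDl modn_small.
by rewrite doubleK divnMDl // divn_small // addn0.
Qed.

Lemma cletter_pos i (n : nat) : exists k, cletter k = (dpos b i, - n.+1%:Z).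
Proof.
exists (n * h + i).*2.+1; rewrite /cletter /= odd_double /letter_pos /=.
congr (dpos b _, - (Posz _.+1)).
  by apply: val_inj; rewrite /= uphalf_double modnMDl modn_small.
by rewrite uphalf_double divnMDl // divn_small // addn0.
Qed.

Lemma pbw_set_mode x n v : lspan pbw_set v -> lspan pbw_set (mode true x n v).
Proof.
move=> Sv; rewrite (pos_neg_part b x) -[pos_part b x]scale1r mode_linear_l scale1r.
have [n0|n0] := ltrP 0 n.
  by apply: lspanD; apply: pbw_set_annihilator => //; left.
apply: lspanD; rewrite mode_suml; apply: lspan_sum => i; rewrite modeZl; apply: lspanZ; last first.
  have [k E] := cletter_neg i `|n|%N.
  have := pbw_set_cletter k Sv; rewrite E /=.
  by have -> : (- `|n|%N%:Z = n) by lia.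
have [n1|n1] := eqVneq n 0.
  by apply: pbw_set_annihilator => //; right; split=> // _; apply: dpos_mem.
have [k E] := cletter_pos i `|n|%N.-1.
have := pbw_set_cletter k Sv; rewrite E /=.
by have -> : (- `|n|%N.-1.+1%:Z = n) by lia.
Qed.

Lemma pbw_span v : lspan pbw_set v.
Proof.
apply: lspan_mono (fock_span v) => _ [w ->]; elim: w => [|[x n] w IH].
  by apply: lspan_id; exists [::].
by rewrite -mode_word; apply: pbw_set_mode.
Qed.

(** The functional dual to the monomial [s]: the conjugate annihilation modes strip its letters one
    by one, then the vacuum coefficient is taken. *)
Fixpoint pbw_pair (s : seq nat) (v : fock X true) : K^o :=
  if s is k :: s' then pbw_pair s' (md (aletter k) v) else vev b v.

Lemma pbw_pair_linear s : linear (pbw_pair s).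
Proof.
elim: s => [|k s IH] c u v /=; first exact: vev_linear.
by rewrite mode_linear IH.
Qed.

Lemma aletter_pbw_notin k s : k \notin s -> md (aletter k) (pbw s) = 0.
Proof.
elim: s => [|t s IH]; first by move=> _; apply: mode_vac; rewrite -surjective_pairing; apply: aletter_annihilator.
rewrite inE negb_or => /andP[kt ks]; rewrite pbw_cons mode_comm IH //.
rewrite (lin0 (mode_linear _ _)) scaler0 add0r -!surjective_pairing.
by rewrite mf_aletter (negPf kt) scale0r.
Qed.

Lemma vev_cletter k v : vev b (md (cletter k) v) = 0.
Proof. by apply: vev_creation; rewrite -surjective_pairing; exact: cletter_creation. Qed.

Lemma pbw_pair_Z s c v : pbw_pair s (c *: v) = c * pbw_pair s v.
Proof. exact: (linZ (pbw_pair_linear s)). Qed.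

Lemma pbw_pair0 s : pbw_pair s 0 = 0.
Proof. exact: (lin0 (pbw_pair_linear s)). Qed.

Lemma pbw_pair_cons k s v : pbw_pair (k :: s) v = pbw_pair s (md (aletter k) v).
Proof. by []. Qed.

Lemma aletter_cletter_comm k t v : k != t ->
  md (aletter t) (md (cletter k) v) = sg *: md (cletter k) (md (aletter t) v).
Proof.
move=> kt; rewrite mode_comm -!surjective_pairing mf_aletter eq_sym (negPf kt).
by rewrite scale0r addr0.
Qed.

Lemma pbw_pair_notin k s v : k \notin s -> pbw_pair s (md (cletter k) v) = 0.
Proof.
elim: s v => [|t s IH] v; first by move=> _; exact: vev_cletter.
rewrite inE negb_or => /andP[kt ks].
by rewrite pbw_pair_cons aletter_cletter_comm // pbw_pair_Z IH // mulr0.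
Qed.

(** The annihilation mode acts as a derivative in its conjugate letter. All copies of [k] stand at
    the front; there is only one in the Clifford case, and in the Weyl case passing a copy costs no
    sign, so the contributions add up. *)
Lemma aletter_pbw k s : sorted pbw_rel (k :: s) ->
  md (aletter k) (pbw (k :: s)) = (aletter_norm k * (count_mem k s).+1%:R) *: pbw s.
Proof.
elim: s => [|t s IH] ss.
  rewrite pbw_cons mode_comm aletter_pbw_notin // (lin0 (mode_linear _ _)).
  by rewrite scaler0 add0r -!surjective_pairing mf_aletter eqxx mulr1.
have [kts|] := boolP (k \in t :: s); last first.
  move=> kts; rewrite pbw_cons mode_comm aletter_pbw_notin // (lin0 (mode_linear _ _)).
  by rewrite scaler0 add0r -!surjective_pairing mf_aletter eqxx (count_memPn kts) mulr1.
have /andP[kt st] : pbw_rel k t && path pbw_rel t s by [].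
have : all (pbw_rel k) (t :: s) by apply: (order_path_min pbw_rel_trans).
move/allP => /(_ k kts) kk.
have pp : ~~ p by apply/negP => pp; move: kk; rewrite /pbw_rel pp ltnn.
have E : t = k.
  move: kts; rewrite inE => /orP[/eqP->//|ks].
  have /allP/(_ _ ks) : all (pbw_rel t) s by apply: (order_path_min pbw_rel_trans).
  by move: kt; rewrite /pbw_rel (negPf pp) => ? ?; apply/eqP; rewrite eqn_leq; apply/andP.
subst t; rewrite pbw_cons mode_comm -!surjective_pairing mf_aletter eqxx IH ?(path_sorted ss) //.
have -> : sg = 1 by rewrite (negPf pp).
rewrite (linZ (mode_linear _ _)) -pbw_cons scale1r -scalerDl /=.
by rewrite eqxx -[X in _ * _ + X]mulr1 -mulrDr natr1.
Qed.

(** Up to sign, the product of the factorials of the multiplicities, hence nonzero in characteristic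
    zero. *)
Fixpoint pbw_norm (s : seq nat) : K :=
  if s is k :: s' then (aletter_norm k * (count_mem k s').+1%:R) * pbw_norm s' else 1.

Lemma pbw_norm_neq0 s : pbw_norm s != 0.
Proof.
by elim: s => [|k s IH] /=; rewrite ?oner_eq0 // !mulf_neq0 // ?aletter_norm_neq0 ?pnatr_eq0.
Qed.

(** If the first letters differ, the smaller one is absent from the other monomial: its annihilation
    mode kills [t], or its creation mode moves through to [vev]. Equal first letters are
    stripped. *)
Lemma pbw_pairE s t : sorted pbw_rel s -> sorted pbw_rel t ->
  pbw_pair s (pbw t) = pbw_norm s *+ (s == t).
Proof.
elim: s t => [|k s IH] [|j t] ss st; first exact: vev_vac.
- by rewrite pbw_cons; apply: vev_cletter.
- by rewrite pbw_pair_cons aletter_pbw_notin // pbw_pair0.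
have notin m u : path pbw_rel m u -> forall l, (l < m)%N -> l \notin m :: u.
  move=> /(order_path_min pbw_rel_trans)/allP mu l lm; rewrite inE negb_or (ltn_eqF lm) /=.
  apply/negP => /mu; rewrite /pbw_rel; case: (p); move: lm; lia.
have [kj|jk|E] := ltngtP k j.
- rewrite pbw_pair_cons aletter_pbw_notin ?notin // pbw_pair0 eqseq_cons.
  by rewrite (ltn_eqF kj).
- rewrite pbw_cons pbw_pair_notin ?notin //.
  by rewrite eqseq_cons (gtn_eqF jk).
rewrite -E in st *; rewrite pbw_pair_cons aletter_pbw // pbw_pair_Z.
rewrite IH ?(path_sorted ss) ?(path_sorted st) // eqseq_cons eqxx /=.
by have [->|_] := eqVneq s t; rewrite //= !mulr0n mulr0.
Qed.

Definition pbw_coord (s : seq nat) (v : fock X true) : K^o :=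
  (pbw_norm s)^-1 * pbw_pair s v.

Lemma pbw_coord_linear s : linear (pbw_coord s).
Proof.
move=> c u v; rewrite /pbw_coord pbw_pair_linear mulrDr.
by rewrite /GRing.scale /= mulrCA.
Qed.

Lemma pbw_coordE s t : sorted pbw_rel s -> sorted pbw_rel t ->
  pbw_coord s (pbw t) = (s == t)%:R.
Proof.
move=> ss st; rewrite /pbw_coord pbw_pairE //; case: eqP => _; last by rewrite mulr0.
by rewrite mulVf ?pbw_norm_neq0.
Qed.

End PBW.

(** * The modes of the current and of the Virasoro element *)

Lemma fsum_nat (V : nmodType) (F : nat -> V) N :
  (forall r, (N <= r)%N -> F r = 0) ->
  \sum_(r \in [set: nat]%classic) F r = \sum_(r < N) F r.
Proof.
move=> F0; rewrite (fsbigE (iota 0 N)) ?iota_uniq //; last first.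
  by move=> r _ /=; rewrite mem_iota /= add0n -leqNgt => /F0.
by rewrite -(big_mkord xpredT F) /index_iota subn0; apply: eq_bigl => r; rewrite in_setT.
Qed.

Section Gbinom.
Context (K : numFieldType).

Lemma gbinom0 (x : K) : gbinom x 0 = 1.
Proof. by rewrite /gbinom big_ord0 fact0 divr1. Qed.

Lemma gbinom1 (x : K) : gbinom x 1 = x.
Proof. by rewrite /gbinom big_ord_recl big_ord0 /= subr0 mulr1 divr1. Qed.

Lemma gbinom2 (x : K) : gbinom x 2 = x * (x - 1) / 2.
Proof. by rewrite /gbinom !big_ord_recl big_ord0 /= subr0 mulr1. Qed.

Lemma gbinom_nat_gt (n r : nat) : (n < r)%N -> gbinom (n%:R : K) r = 0.
Proof.
by move=> nr; rewrite /gbinom (bigD1 (Ordinal nr)) //= subrr !mul0r.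
Qed.

End Gbinom.

Section FreeFieldModes.
Context (K : numFieldType) (p : bool) (X : Type) (form : X -> X -> K).
Context (V W : lmodType K) (par theta : V -> V) (parW : W -> W).
Context (vacV : V) (vacW : W) (Y : V -> int -> V -> V) (Yt : V -> int -> W -> W).
Context (m : X -> int -> V -> V) (mt : X -> int -> W -> W).
Local Notation sg := ((-1) ^+ p : K).
Local Notation gvec x := (m x (-1) vacV).

Hypothesis va : super_vertex_algebra par vacV Y.
Hypothesis tw : twisted_module par theta vacV Y parW Yt.
Hypothesis m_linear : forall x n, linear (m x n).
Hypothesis mt_linear : forall x n, linear (mt x n).
Hypothesis gvec_par : forall x, par (gvec x) = (-1) ^+ p *: gvec x.
Hypothesis gvec_theta : forall x, theta (gvec x) = (-1) ^+ true *: gvec x.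
Hypothesis vac_par : par vacV = (-1) ^+ false *: vacV.
Hypothesis vac_theta : theta vacV = (-1) ^+ false *: vacV.
Hypothesis Y_gvec : forall x n w, Y (gvec x) n w = m x n w.
Hypothesis Yt_gvec : forall x (n : int) w, Yt (gvec x) (2 * n - 1) w = mt x n w.
Hypothesis mode_vacV : forall x (n : int), 0 <= n -> m x n vacV = 0.
Hypothesis mode_gvec : forall x y (n : nat),
  m x n (gvec y) = (form x y *+ (n == 0%N)) *: vacV.

Lemma Y_linear_l n w : linear (fun u => Y u n w).
Proof. by move=> c v u; apply: va_linear_l va _ _ _ _ _. Qed.

Lemma Yt_linear_r u n : linear (Yt u n).
Proof. by move=> c v w; apply: tw_linear_r tw _ _ _ _ _. Qed.

Lemma Yt_linear_l n w : linear (fun u => Yt u n w).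
Proof. by move=> c v u; apply: tw_linear_l tw _ _ _ _ _. Qed.

Lemma sign_m1 : (-1) ^ (-1) = -1 :> K.
Proof. by rewrite exprN1 invrN1. Qed.

Lemma sign_m2 : (-1) ^ (-2) = 1 :> K.
Proof. by rewrite -[(-1) ^ (-2)]/((-1) ^- 2) sqrrN expr1n invr1. Qed.

Lemma sgpp : (-1) ^+ (p && p) = sg.
Proof. by rewrite andbb. Qed.

(** The untwisted index n stands for the mode n + 1/2, so [ovec x y] is x(-1/2) y(-1/2) v and
    [tvec x y] is x(-3/2) y(-1/2) v, the kinds of terms in the current and in the Virasoro
    element. *)
Definition ovec (x y : X) : V := m x (-1) (gvec y).
Definition tvec (x y : X) : V := m x (-2) (gvec y).

(** The Borcherds identity with m = 0, which expresses a mode of a product through products of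
    modes. The binomial leaves r = 0 on the left; on the right, r >= 1 puts a mode of positive index
    on a generator. *)
Lemma Y_pair x y z (l : int) (n : nat) : Y (m x l (gvec y)) n (gvec z) =
  (form y z *+ (n == 0%N)) *: m x l vacV - (sg * (-1) ^ l * form x z) *: m y (n%:Z + l) vacV.
Proof.
have := va_borcherds va (u := gvec x) (v := gvec y) (gvec z) l 0 n (gvec_par x) (gvec_par y).
rewrite (@fsum_nat _ _ 1) => [|[|r] // _]; last first.
  by rewrite (@gbinom_nat_gt _ 0) // scale0r.
rewrite (@fsum_nat _ _ 1) => [|[|r] // _]; last first.
  rewrite !Y_gvec ?add0r (mode_gvec y z (n + r.+1)) !mode_gvec addnS !mulr0n !scale0r.
  by rewrite !(lin0 (m_linear _ _)) scaler0 subr0 scaler0.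
rewrite !big_ord_recl !big_ord0 /= !addr0 !gbinom0 expr0 mulr1 !scale1r.
rewrite !Y_gvec ?add0r ?addr0 ?subr0 (mode_gvec y z n) (mode_gvec x z 0) mulr1n => ->.
by rewrite !(linZ (m_linear _ _)) sgpp scalerA.
Qed.

Lemma Y_ovec x y z : Y (ovec x y) 0 (gvec z) =
  form y z *: gvec x + (sg * form x z) *: gvec y.
Proof.
by rewrite (Y_pair x y z (-1) 0) mulr1n add0r sign_m1 mulrN1 mulNr scaleNr opprK.
Qed.

Lemma Y_tvec1 x y z : Y (tvec x y) 1 (gvec z) = - (sg * form x z) *: gvec y.
Proof.
by rewrite (Y_pair x y z (-2) 1) mulr0n scale0r sub0r sign_m2 mulr1 -scaleNr.
Qed.

Lemma Y_tvec0 x y z : Y (tvec x y) 0 (gvec z) =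
  form y z *: m x (-2) vacV - (sg * form x z) *: m y (-2) vacV.
Proof. by rewrite (Y_pair x y z (-2) 0) mulr1n add0r sign_m2 mulr1. Qed.

Section EvenCommutators.
Context (u : V) (z : X).
Hypothesis u_par : par u = (-1) ^+ false *: u.
Hypothesis u_theta : theta u = (-1) ^+ false *: u.

Lemma odd_index (n : int) : odd `|(2 * n - 1)%R : int|%N = true.
Proof. lia. Qed.

(** The commutator formula, that is, the twisted identity at l = 0 and k = 0, where only the zeroth
    product survives. *)
Lemma Yt_current_comm c n w : Y u 0 (gvec z) = c *: gvec z ->
  Yt u 0 (mt z n w) = mt z n (Yt u 0 w) + c *: mt z n w.
Proof.
move=> H; have := @tw_borcherds _ _ _ _ _ _ _ _ _ tw false p false true u (gvec z) w 0 0 (2 * n - 1)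
  u_par (gvec_par z) u_theta (gvec_theta z) erefl (odd_index n).
rewrite (@fsum_nat _ _ 1) => [|[|r] // _]; last first.
  by rewrite mul0r (@gbinom_nat_gt _ 0) // scale0r.
rewrite (@fsum_nat _ _ 1) => [|[|r] // _]; last first.
  by rewrite (@gbinom_nat_gt _ 0) // mulr0 scale0r.
rewrite !big_ord_recl !big_ord0 /= !gbinom0 ?expr0 ?addr0 ?mulr0 ?scale1r.
rewrite ?add0r ?subr0 ?addr0 H (linZ (Yt_linear_l _ _)) !Yt_gvec expr0z ?mul1r ?mulr1 !scale1r.
by move=> ->; rewrite addrC subrK.
Qed.

(** The state z(-3/2) v is the translate of z(-1/2) v, and its field is the derivative. The identity
    is applied against the vacuum with l = -2 and k' = 0, where no vacuum mode on the right has the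
    index -2 at which it acts. *)
Lemma Yt_shift k w : odd `|k|%N -> Yt (m z (-2) vacV) k w = - (k%:~R / 2) *: Yt (gvec z) (k - 2) w.
Proof.
move=> ko; have := @tw_borcherds _ _ _ _ _ _ _ _ _ tw p false true false (gvec z) vacV w (-2) k 0
  (gvec_par z) vac_par (gvec_theta z) vac_theta ko erefl.
rewrite (@fsum_nat _ _ 2) => [|[|[|r]] // _]; last first.
  have r0 : (0 <= -2 + r.+2%:Z :> int) by lia.
  rewrite Y_gvec mode_vacV //.
  by rewrite (lin0 (Yt_linear_l _ _)) scaler0.
rewrite fsbig1 => [|r _]; last first.
  rewrite !(tw_vacuum tw); case: eqP => [|_]; first by lia.
  case: eqP => [|_]; first by lia.
  by rewrite (lin0 (Yt_linear_r _ _)) scaler0 subr0 scaler0.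
rewrite !big_ord_recl !big_ord0 /= !gbinom0 gbinom1 !addr0 !scale1r !Y_gvec.
move/eqP; rewrite addr_eq0 => /eqP ->.
by rewrite scaleNr.
Qed.

(** The index 2 belongs to L(0), so two products survive: the first gives the conformal weight 1/2,
    the zeroth a derivative evaluated by [Yt_shift]. The sum is -(2n + 1)/2 + 1/2 = -n. *)
Lemma Yt_conformal_comm n w : Y u 1 (gvec z) = 2^-1 *: gvec z ->
  Y u 0 (gvec z) = m z (-2) vacV ->
  Yt u 2 (mt z n w) = mt z n (Yt u 2 w) - n%:~R *: mt z n w.
Proof.
move=> H1 H0; have := @tw_borcherds _ _ _ _ _ _ _ _ _ tw false p false true u (gvec z) w 0 2 (2 * n - 1)
  u_par (gvec_par z) u_theta (gvec_theta z) erefl (odd_index n).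
have two : 2%:~R / 2 = 1%:R :> K by rewrite divff ?pnatr_eq0.
rewrite (@fsum_nat _ _ 2) => [|[|[|r]] // _]; last first.
  by rewrite two (@gbinom_nat_gt _ 1) // scale0r.
rewrite (@fsum_nat _ _ 1) => [|[|r] // _]; last first.
  by rewrite (@gbinom_nat_gt _ 0) // mulr0 scale0r.
rewrite !big_ord_recl !big_ord0 /= !gbinom0 gbinom1 two ?expr0 ?addr0 ?mulr0 ?scale1r.
rewrite ?add0r ?subr0 ?addr0 H0 H1 Yt_shift; last by lia.
have -> : 2 + (2 * n - 1) - 2 * (bump 0 0)%:Z = 2 * n - 1 :> int by rewrite /bump /=; lia.
rewrite (linZ (Yt_linear_l _ _)) !Yt_gvec expr0z ?mul1r ?mulr1 !scale1r => E.
apply/eqP; rewrite -subr_eq0 opprD opprK addrA -E -scalerDl -scalerDl.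
rewrite (_ : _ + _ + _ = 0) ?scale0r //.
by rewrite !rmorphD /= rmorphM /=; field.
Qed.

End EvenCommutators.

Section VacuumValues.
Variables (x y : X).

Definition vac_killed_from z (k : int) := forall r : nat, Yt (gvec z) (k + 2 * r%:Z) vacW = 0.

(** The indices [k] and [k'] are taken so high that each term on the right begins with a mode
    killing the twisted vacuum. What remains is a linear relation with half-integral binomials, the
    origin of the vacuum charge and weight. *)
Lemma Yt_vac_pair l k k' : odd `|k|%N -> odd `|k'|%N ->
  vac_killed_from y k' -> vac_killed_from x k ->
  \sum_(r \in [set: nat]%classic) gbinom (k%:~R / 2) r *:
    Yt (m x (l + r%:Z) (gvec y)) (k + k' - 2 * r%:Z) vacW = 0.
Proof.
move=> ko k'o Hy Hx.
have := @tw_borcherds _ _ _ _ _ _ _ _ _ tw p p true true (gvec x) (gvec y) vacW l k k'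
  (gvec_par x) (gvec_par y) (gvec_theta x) (gvec_theta y) ko k'o.
rewrite [RHS]fsbig1 => [|r _]; last first.
  by rewrite Hx Hy !(lin0 (Yt_linear_r _ _)) scaler0 subr0 scaler0.
move=> E; rewrite -[RHS]E; apply: eq_fsbigr => r _; by rewrite Y_gvec.
Qed.

Lemma Yt_gvec_half z k (n : int) w : k = 2 * n - 1 -> Yt (gvec z) k w = mt z n w.
Proof. by move=> ->. Qed.

Lemma Yt_ovec_gen k k' : k + k' = 0 -> odd `|k|%N -> odd `|k'|%N ->
  vac_killed_from y k' -> vac_killed_from x k ->
  Yt (ovec x y) 0 vacW = - (k%:~R / 2 * form x y) *: vacW.
Proof.
move=> kk ko k'o Hy Hx; have := Yt_vac_pair (-1) ko k'o Hy Hx.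
rewrite (@fsum_nat _ _ 2) => [|[|[|r]] // _]; last first.
  by rewrite (mode_gvec x y r.+1) mulr0n scale0r (lin0 (Yt_linear_l _ _)) scaler0.
rewrite !big_ord_recl !big_ord0 /= gbinom0 gbinom1 !addr0 kk (mode_gvec x y 0).
rewrite (linZ (Yt_linear_l _ _)) (tw_vacuum tw) /= scale1r mulr1n scalerA => /eqP.
by rewrite addr_eq0 scaleNr => /eqP <-.
Qed.

Lemma Yt_tvec_gen k k' : k + k' = 2 -> odd `|k|%N -> odd `|k'|%N ->
  vac_killed_from y k' -> vac_killed_from x k ->
  Yt (tvec x y) 2 vacW =
  - ((k%:~R / 2) *: Yt (ovec x y) 0 vacW + (gbinom (k%:~R / 2) 2 * form x y) *: vacW).
Proof.
move=> kk ko k'o Hy Hx; have := Yt_vac_pair (-2) ko k'o Hy Hx.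
rewrite (@fsum_nat _ _ 3) => [|[|[|[|r]]] // _]; last first.
  by rewrite (mode_gvec x y r.+1) mulr0n scale0r (lin0 (Yt_linear_l _ _)) scaler0.
rewrite !big_ord_recl !big_ord0 /= gbinom0 gbinom1 !addr0 kk (mode_gvec x y 0).
rewrite (linZ (Yt_linear_l _ _)) (tw_vacuum tw) /= scale1r mulr1n scalerA => /eqP.
by rewrite addr_eq0 => /eqP.
Qed.

End VacuumValues.

Section PositiveNegative.
Variables (x y : X).
Hypothesis x_ann : forall n : nat, mt x n vacW = 0.
Hypothesis y_ann : forall n : nat, mt y n.+1 vacW = 0.

Lemma Yt_ovec_vac_pn : Yt (ovec x y) 0 vacW = (2^-1 * form x y) *: vacW.
Proof.
(* A generator at doubled index 2n - 1 is the mode n: [x] kills the vacuum from mode 0, index -1,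
   and [y] from mode 1, index 1. *)
rewrite (@Yt_ovec_gen x y (-1) 1) //.
- by congr (_ *: _); rewrite mulNr mulNr opprK mul1r.
- by move=> r; rewrite (@Yt_gvec_half _ _ r.+1) //; lia.
- by move=> r; rewrite (@Yt_gvec_half _ _ r) //; lia.
Qed.

Lemma Yt_ovec_vac_np : Yt (ovec y x) 0 vacW = - (2^-1 * form y x) *: vacW.
Proof.
rewrite (@Yt_ovec_gen y x 1 (-1)) //.
- by congr (- (_ * _) *: _); rewrite mul1r.
- by move=> r; rewrite (@Yt_gvec_half _ _ r) //; lia.
- by move=> r; rewrite (@Yt_gvec_half _ _ r.+1) //; lia.
Qed.

Lemma Yt_tvec_vac_pn : Yt (tvec x y) 2 vacW = - (8^-1 * form x y) *: vacW.
Proof.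
(* The doubled indices must now add up to 2, so [y] starts at mode 2. Here binom(-1/2, 2) = 3/8, and
   the value is -(-1/4 + 3/8). *)
rewrite (@Yt_tvec_gen x y (-1) 3) //.
- rewrite Yt_ovec_vac_pn scalerA -scalerDl -scaleNr gbinom2; congr (_ *: _).
  by field.
- by move=> r; rewrite (@Yt_gvec_half _ _ r.+2) //; lia.
- by move=> r; rewrite (@Yt_gvec_half _ _ r) //; lia.
Qed.

Lemma Yt_tvec_vac_np : Yt (tvec y x) 2 vacW = (3 / 8 * form y x) *: vacW.
Proof.
(* Both vectors start at mode 1. Here binom(1/2, 2) = -1/8, and the value is -(-1/4 - 1/8). *)
rewrite (@Yt_tvec_gen y x 1 1) //.
- rewrite Yt_ovec_vac_np scalerA -scalerDl -scaleNr gbinom2; congr (_ *: _).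
  by field.
- by move=> r; rewrite (@Yt_gvec_half _ _ r.+1) //; lia.
- by move=> r; rewrite (@Yt_gvec_half _ _ r.+1) //; lia.
Qed.

End PositiveNegative.

Section Sums.
Variables (I : finType) (ap an : I -> X).

Definition osum : V := \sum_i ovec (ap i) (an i).
(** The second term of each summand of the Virasoro element is reordered, at the price of [sg], so
    that the mode -3/2 stands first. *)
Definition tsum : V :=
  2^-1 *: \sum_i (tvec (ap i) (an i) - sg *: tvec (an i) (ap i)).

Lemma Y_osum z : Y osum 0 (gvec z) =
  \sum_i (form (an i) z *: gvec (ap i) + (sg * form (ap i) z) *: gvec (an i)).
Proof. by rewrite (lin_sum (Y_linear_l 0 _)); apply: eq_bigr => i _; rewrite Y_ovec. Qed.

Lemma Y_tsum1 z : Y tsum 1 (gvec z) = 2^-1 *: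
  \sum_i (form (an i) z *: gvec (ap i) - (sg * form (ap i) z) *: gvec (an i)).
Proof.
rewrite (linZ (Y_linear_l 1 _)) (lin_sum (Y_linear_l 1 _)); congr (_ *: _).
apply: eq_bigr => i _; rewrite (linB (Y_linear_l 1 _)) (linZ (Y_linear_l 1 _)).
rewrite !Y_tvec1 scalerA mulrN.
rewrite [sg * (sg * _)]mulrA -expr2 sqrr_sign mul1r !scaleNr opprK.
by rewrite addrC.
Qed.

Lemma Y_tsum0 z : Y tsum 0 (gvec z) =
  \sum_i (form (an i) z *: m (ap i) (-2) vacV - (sg * form (ap i) z) *: m (an i) (-2) vacV).
Proof.
rewrite (linZ (Y_linear_l 0 _)) (lin_sum (Y_linear_l 0 _)) scaler_sumr.
apply: eq_bigr => i _; rewrite (linB (Y_linear_l 0 _)) (linZ (Y_linear_l 0 _)).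
rewrite !Y_tvec0 [sg *: (_ - _)]scalerBr !(scalerA sg) [sg * (sg * _)]mulrA -expr2 sqrr_sign mul1r opprB.
move: (form _ _ *: _) ((sg * _) *: _) => u v.
by rewrite -mulr2n -(scaler_nat 2 (u - v)) scalerA mulVf ?pnatr_eq0 // scale1r.
Qed.

Hypothesis ap_ann : forall i (n : nat), mt (ap i) n vacW = 0.
Hypothesis an_ann : forall i (n : nat), mt (an i) n.+1 vacW = 0.
Hypothesis form_pn : forall i, form (ap i) (an i) = - sg.
Hypothesis form_np : forall i, form (an i) (ap i) = 1.

Lemma osum_vac : Yt osum 0 vacW = (- sg * #|I|%:R / 2) *: vacW.
Proof.
rewrite (lin_sum (Yt_linear_l 0 _)) (eq_bigr (fun i => (- sg / 2) *: vacW)) => [|i _].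
  by rewrite -scaler_suml sumr_const -mulr_natr; congr (_ *: _); ring.
rewrite (Yt_ovec_vac_pn (ap_ann i) (an_ann i)) form_pn; congr (_ *: _); ring.
Qed.

(** Each index contributes one half of sg/8 - 3 sg/8, that is, -sg/8. *)
Lemma tsum_vac : Yt tsum 2 vacW = (- sg * #|I|%:R / 8) *: vacW.
Proof.
rewrite (linZ (Yt_linear_l 2 _)) (lin_sum (Yt_linear_l 2 _)).
rewrite (eq_bigr (fun i => (- sg / 4) *: vacW)) => [|i _].
  by rewrite -scaler_suml sumr_const scalerA -mulr_natr; congr (_ *: _); field.
rewrite (linB (Yt_linear_l 2 _)) (linZ (Yt_linear_l 2 _)).
rewrite (Yt_tvec_vac_pn (ap_ann i) (an_ann i)) (Yt_tvec_vac_np (ap_ann i) (an_ann i)).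
rewrite form_pn form_np scalerA -scalerBl; congr (_ *: _); by field.
Qed.

End Sums.

Section Parity.
Variables (I : finType) (ap an : I -> X) (f : V -> V).
Hypothesis lf : linear f.
Hypothesis f_even : forall x y k l, f (m x k (m y l vacV)) = m x k (m y l vacV).

Lemma osum_even : f (osum ap an) = (-1) ^+ false *: osum ap an.
Proof. by rewrite scale1r (lin_sum lf); apply: eq_bigr => i _; rewrite f_even. Qed.

Lemma tsum_even : f (tsum ap an) = (-1) ^+ false *: tsum ap an.
Proof.
rewrite scale1r (linZ lf) (lin_sum lf); congr (_ *: _); apply: eq_bigr => i _.
by rewrite (linB lf) (linZ lf) !f_even.
Qed.

End Parity.

End FreeFieldModes.

(* Otherwise unification compares distinct words by unfolding them.          *)
Opaque fock word mode tensor tens.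

Section FockFields.
Context (K : numFieldType) (p : bool) (d : nat) (X : polarized K p d).
Context (FX : fock_fields X) (b : dual_bases X).
Local Notation h := (d./2).
Local Notation sg := ((-1) ^+ p : K).
Local Notation Y := (ff_Y FX).
Local Notation Yt := (ff_Ytw FX).
Local Notation vacV := (vac X false).
Local Notation vacW := (vac X true).
Local Notation m := (@mode K p d X false).
Local Notation mt := (@mode K p d X true).

Lemma gvec_par x : fock_parity false (m x (-1) vacV) = (-1) ^+ p *: m x (-1) vacV.
Proof. by rewrite /vac mode_word fock_parity_word /= andbT. Qed.

Lemma gvec_theta x : fock_theta (m x (-1) vacV) = (-1) ^+ true *: m x (-1) vacV.
Proof. by rewrite /vac mode_word fock_theta_word. Qed.

Lemma vac_par tw : fock_parity tw (vac X tw) = (-1) ^+ false *: vac X tw.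
Proof. by rewrite /vac fock_parity_word /= andbF. Qed.

Lemma vac_theta : fock_theta vacV = (-1) ^+ false *: vacV.
Proof. by rewrite /vac fock_theta_word. Qed.

Lemma mode_vacV x (n : int) : 0 <= n -> m x n vacV = 0.
Proof.
rewrite le_eqVlt => /orP[/eqP<-|n0]; apply: mode_vac; [right|left] => //; by split.
Qed.

Lemma mode_gvec x y (n : nat) :
  m x n (m y (-1) vacV) = (pol_form x y *+ (n == 0%N)) *: vacV.
Proof.
rewrite mode_comm mode_vacV // (lin0 (mode_linear _ _)) scaler0 add0r.
by rewrite /mode_form /=; congr (_ *+ nat_of_bool _ *: _); lia.
Qed.

Lemma mode2_par x y n n' : fock_parity false (m x n (m y n' vacV)) = m x n (m y n' vacV).
Proof. by rewrite /vac !mode_word fock_parity_word /= andbF scale1r. Qed.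

Lemma mode2_theta x y n n' : fock_theta (m x n (m y n' vacV)) = m x n (m y n' vacV).
Proof. by rewrite /vac !mode_word fock_theta_word scale1r. Qed.

Local Notation osum := (osum vacV m (dpos b) (dneg b)).
Local Notation tsum := (tsum p vacV m (dpos b) (dneg b)).

Lemma currentE : current b = osum.
Proof. by apply: eq_bigr => i _; rewrite /ovec /vac !mode_word. Qed.

Lemma conformalE : conformal b = tsum.
Proof.
rewrite /conformal /tsum; congr (_ *: _); apply: eq_bigr => i _.
apply: (congr2 (fun u v => u - v)); rewrite /tvec /vac !mode_word // (word_form false [::]).
by rewrite /mode_form /= mulr0n scale0r addr0.
Qed.

Lemma gvec_decomp n z : \sum_i (pol_form (dneg b i) z *: m (dpos b i) n vacV
   + (sg * pol_form (dpos b i) z) *: m (dneg b i) n vacV) =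
  m (pos_part b z) n vacV - m (neg_part b z) n vacV.
Proof.
rewrite /pos_part /neg_part !mode_suml -sumrB; apply: eq_bigr => i _.
by rewrite !modeZl mulNr scaleNr opprK.
Qed.

Lemma gvec_decomp2 n z : \sum_i (pol_form (dneg b i) z *: m (dpos b i) n vacV
   - (sg * pol_form (dpos b i) z) *: m (dneg b i) n vacV) = m z n vacV.
Proof.
rewrite [in RHS](pos_neg_part b z) -[pos_part b z]scale1r mode_linear_l scale1r.
rewrite /pos_part /neg_part !mode_suml -big_split; apply: eq_bigr => i _ /=.
by rewrite !modeZl mulNr scaleNr.
Qed.

Let m_lin := @mode_linear K p d X false.
Let gen := @ff_gen _ _ _ _ FX.
Let gen_tw := @ff_gen_tw _ _ _ _ FX.

Lemma Y_current z : Y (current b) 0 (m z (-1) vacV) =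
  m (pos_part b z) (-1) vacV - m (neg_part b z) (-1) vacV.
Proof.
rewrite currentE -gvec_decomp.
exact: (Y_osum (ff_va FX) m_lin gvec_par gen mode_gvec).
Qed.

Lemma Y_conformal1 z : Y (conformal b) 1 (m z (-1) vacV) = 2^-1 *: m z (-1) vacV.
Proof.
rewrite conformalE -[in RHS]gvec_decomp2.
exact: (Y_tsum1 (ff_va FX) m_lin gvec_par gen mode_gvec).
Qed.

Lemma Y_conformal0 z : Y (conformal b) 0 (m z (-1) vacV) = m z (-2) vacV.
Proof.
rewrite conformalE -[in RHS]gvec_decomp2.
exact: (Y_tsum0 (ff_va FX) m_lin gvec_par gen mode_gvec).
Qed.

Definition J0 := Yt (current b) 0.
Definition L0 := Yt (conformal b) 2.

Lemma current_par : fock_parity false (current b) = (-1) ^+ false *: current b.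
Proof. by rewrite currentE; apply: osum_even mode2_par; apply: fock_parity_linear. Qed.

Lemma current_theta : fock_theta (current b) = (-1) ^+ false *: current b.
Proof. by rewrite currentE; apply: osum_even mode2_theta; apply: fock_theta_linear. Qed.

Lemma conformal_par : fock_parity false (conformal b) = (-1) ^+ false *: conformal b.
Proof. by rewrite conformalE; apply: tsum_even mode2_par; apply: fock_parity_linear. Qed.

Lemma conformal_theta : fock_theta (conformal b) = (-1) ^+ false *: conformal b.
Proof. by rewrite conformalE; apply: tsum_even mode2_theta; apply: fock_theta_linear. Qed.

Lemma J0_comm c z n w : pos_part b z - neg_part b z = c *: z ->
  J0 (mt z n w) = mt z n (J0 w) + c *: mt z n w.
Proof.
move=> H; apply: (Yt_current_comm (ff_twisted FX) gvec_par gvec_theta gen_tw current_par current_theta).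
rewrite Y_current -modeZl -H.
have -> : pos_part b z - neg_part b z = (-1) *: neg_part b z + pos_part b z.
  by rewrite scaleN1r addrC.
by rewrite mode_linear_l scaleN1r addrC.
Qed.

Lemma L0_comm z n w : L0 (mt z n w) = mt z n (L0 w) - n%:~R *: mt z n w.
Proof.
exact: (Yt_conformal_comm (ff_twisted FX) gvec_par gvec_theta (vac_par false) vac_theta
   gen gen_tw mode_vacV conformal_par conformal_theta n w (Y_conformal1 z) (Y_conformal0 z)).
Qed.

Lemma dpos_ann i (n : nat) : mt (dpos b i) n vacW = 0.
Proof.
apply: mode_vac; case: n => [|n]; [right|left] => //; split => // _; exact: dpos_mem.
Qed.

Lemma dneg_ann i (n : nat) : mt (dneg b i) n.+1 vacW = 0.
Proof. by apply: mode_vac; left. Qed.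

Let form_pn i : pol_form (dpos b i) (dneg b i) = - sg.
Proof. by rewrite form_pos_neg eqxx mulr1. Qed.

Let form_np i : pol_form (dneg b i) (dpos b i) = 1.
Proof. by rewrite form_neg_pos eqxx. Qed.

Lemma J0_vac : J0 vacW = (- sg * h%:R / 2) *: vacW.
Proof.
rewrite /J0 currentE -[h in RHS]card_ord.
exact: (osum_vac (ff_twisted FX) gvec_par gvec_theta gen gen_tw mode_gvec
  dpos_ann dneg_ann form_pn).
Qed.

Lemma L0_vac : L0 vacW = (- sg * h%:R / 8) *: vacW.
Proof.
rewrite /L0 conformalE -[h in RHS]card_ord.
exact: (tsum_vac (ff_twisted FX) gvec_par gvec_theta gen gen_tw mode_gvec
  dpos_ann dneg_ann form_pn form_np).
Qed.

End FockFields.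

Section Eigenvalues.
Context (K : numFieldType) (p : bool) (d : nat) (X : polarized K p d).
Context (FX : fock_fields X) (b b' : dual_bases X).
Local Notation h := (d./2).
Hypothesis h_gt0 : (0 < h)%N.
Local Notation sg := ((-1) ^+ p : K).
Local Notation pbw := (pbw b' h_gt0).

Definition pbw_charge (s : seq nat) : int := \sum_(k <- s) (-1) ^+ (~~ odd k).
Definition pbw_weight (s : seq nat) : nat := \sum_(k <- s) (k./2 %/ h + odd k).

(** The current is built on [b] and the monomials on [b']: the charge of a letter is decided by the
    summand of the polarization alone, so [b'] is free to be adapted to a group element. *)
Lemma J0_pbw s : J0 FX b (pbw s) = (- sg * h%:R / 2 + (pbw_charge s)%:~R) *: pbw s.
Proof.
elim: s => [|k s IH]; first by rewrite /pbw_charge big_nil addr0 J0_vac.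
rewrite pbw_cons (@J0_comm _ _ _ _ _ _ ((-1) ^+ (~~ odd k))).
  rewrite IH (linZ (mode_linear _ _)) -scalerDl; congr (_ *: _).
  rewrite /pbw_charge big_cons rmorphD /= rmorphXn /= rmorphN1; ring.
rewrite /cletter; case: ifP => _ /=; rewrite /letter_pos /letter_neg.
  by rewrite pos_part_id ?dpos_mem // neg_part_pos ?dpos_mem // subr0 scale1r.
by rewrite pos_part_neg ?dneg_mem // neg_part_id ?dneg_mem // sub0r scaleN1r.
Qed.

Lemma L0_pbw s : L0 FX b (pbw s) = (- sg * h%:R / 8 + (pbw_weight s)%:R) *: pbw s.
Proof.
elim: s => [|k s IH]; first by rewrite /pbw_weight big_nil addr0 L0_vac.
rewrite pbw_cons L0_comm IH (linZ (mode_linear _ _)) -scalerBl; congr (_ *: _).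
rewrite /pbw_weight big_cons natrD -addrA; congr (_ + _); rewrite [RHS]addrC; congr (_ + _).
by rewrite /cletter; case: ifP => _ /=; rewrite mulrNz opprK -pmulrn ?addn0 ?addn1.
Qed.

End Eigenvalues.

Transparent fock word mode tensor tens.

(** * Tensor products *)

Section TensorBasics.
Context (K : comNzRingType).

Section Two.
Context (U V : lmodType K).

Lemma tensor_relP (W : lmodType K) (f : U * V -> W) :
  (forall v, linear (fun u => f (u, v))) -> (forall u, linear (fun v => f (u, v))) ->
  forall y, tensor_rel y -> free_ext f y = 0.
Proof.
move=> fl fr y [c u u' v|c u v v'];
  rewrite !(linB (free_ext_linear f)) !(linZ (free_ext_linear f)) !free_extU.
  by rewrite fl -addrA -opprD subrr.
by rewrite fr -addrA -opprD subrr.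
Qed.

Lemma tens_linear_l (v : V) : linear (fun u : U => tens u v).
Proof.
move=> c u u'; have := gen_rel (TensorL c u u' v).
rewrite !(linB (gen_linear_pi _)) !(linZ (gen_linear_pi _)) => /eqP.
by rewrite -addrA -opprD subr_eq0 => /eqP.
Qed.

Lemma tens_linear_r (u : U) : linear (fun v : V => tens u v).
Proof.
move=> c v v'; have := gen_rel (TensorR c u v v').
rewrite !(linB (gen_linear_pi _)) !(linZ (gen_linear_pi _)) => /eqP.
by rewrite -addrA -opprD subr_eq0 => /eqP.
Qed.

Lemma tens0l (v : V) : tens (0 : U) v = 0.
Proof. exact: (lin0 (tens_linear_l v)). Qed.

Lemma tens0r (u : U) : tens u (0 : V) = 0.
Proof. exact: (lin0 (tens_linear_r u)). Qed.

Lemma tensor_span (x : tensor U V) :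
  lspan [set w | exists u v, w = tens u v]%classic x.
Proof.
apply: lspan_mono (gen_span x) => _ [[u v] ->].
by apply: lspan_id; exists u, v.
Qed.

Lemma tensor_lin_ext (W : lmodType K) (f g : tensor U V -> W) : linear f -> linear g ->
  (forall u v, f (tens u v) = g (tens u v)) -> f =1 g.
Proof.
move=> lf lg fg; apply: (lin_ext_span lf lg tensor_span) => _ [u [v ->]].
exact: fg.
Qed.

Lemma tensor_span_basis (S : set U) (T : set V) :
  (forall u, lspan S u) -> (forall v, lspan T v) ->
  forall x, lspan [set w | exists u v, [/\ S u, T v & w = tens u v]]%classic x.
Proof.
move=> HS HT x; apply: lspan_mono (tensor_span x) => _ [u [v ->]].
apply: (lin_lspan (tens_linear_l v) _ (HS u)) => {}u Su.
apply: (lin_lspan (tens_linear_r u) _ (HT v)) => {}v Tv.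
by apply: lspan_id; exists u, v.
Qed.

Section Lift.
Context (W : lmodType K) (f : U * V -> W).
Hypothesis fl : forall v, linear (fun u => f (u, v)).
Hypothesis fr : forall u, linear (fun v => f (u, v)).

Lemma tensor_lift_tens u v : plift f (tens u v) = f (u, v).
Proof. exact: (plift_gen (tensor_relP fl fr)). Qed.

Lemma tensor_lift_linear : linear (plift f : tensor U V -> W).
Proof. exact: (plift_linear (tensor_relP fl fr)). Qed.

End Lift.

End Two.

Section Map.
Context (U V U' V' : lmodType K) (f : U -> U') (g : V -> V').
Hypotheses (lf : linear f) (lg : linear g).

Let mapl v : linear (fun u => tens (f (u, v).1) (g (u, v).2)).
Proof. by move=> c u u' /=; rewrite lf tens_linear_l. Qed.

Let mapr u : linear (fun v => tens (f (u, v).1) (g (u, v).2)).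
Proof. by move=> c u1 u' /=; rewrite lg tens_linear_r. Qed.

Lemma tensor_map_tens u v : tensor_map f g (tens u v) = tens (f u) (g v).
Proof. exact: (tensor_lift_tens mapl mapr). Qed.

Lemma tensor_map_linear : linear (tensor_map f g).
Proof. exact: (tensor_lift_linear mapl mapr). Qed.

End Map.
End TensorBasics.

Definition int_window (B : nat) : seq int := [seq i%:Z - B%:Z | i <- iota 0 B.*2.+1].

Lemma int_window_uniq B : uniq (int_window B).
Proof. by rewrite map_inj_uniq ?iota_uniq // => i j; lia. Qed.

Lemma mem_int_window B (n : int) : (n \in int_window B) = (`|n| <= B)%N.
Proof.
apply/mapP/idP; first by case=> k; rewrite mem_iota => kB ->; lia.
move=> nB.
exists (absz (n + B%:Z)); rewrite ?mem_iota; lia.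
Qed.

Lemma fsum_int (V : nmodType) (F : int -> V) (B : nat) :
  (forall n, (B < `|n|)%N -> F n = 0) ->
  \sum_(n \in [set: int]%classic) F n = \sum_(n <- int_window B) F n.
Proof.
move=> F0; rewrite (fsbigE (int_window B)) ?int_window_uniq //; last first.
  by move=> n _ /=; rewrite mem_int_window -ltnNge; apply: F0.
by apply: eq_bigl => r; rewrite in_setT.
Qed.

Section TwistedBilinear.
Context (K : numFieldType).

(** What makes the sum over modes in [tensor_Ytw] finite and its lift well defined. These properties
    pass to the tensor product, so the construction iterates to three factors. *)
Record trunc_bilinear (V M : lmodType K) (Y : V -> int -> M -> M) : Prop := TruncBilinear {
  tb_l : forall k x, linear (fun u => Y u k x);
  tb_r : forall k u, linear (fun x => Y u k x);
  tb_trunc : forall u x, exists N : int, forall k, N <= k -> Y u k x = 0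
}.

Context (V1 V2 M1 M2 : lmodType K) (par2 : V2 -> V2) (parM1 : M1 -> M1).
Context (Y1 : V1 -> int -> M1 -> M1) (Y2 : V2 -> int -> M2 -> M2).
Hypotheses (par2_lin : linear par2) (parM1_lin : linear parM1).
Hypotheses (tb1 : trunc_bilinear Y1) (tb2 : trunc_bilinear Y2).

Let fld (j k1 : int) u1 v2 x1 x2 := tens (Y1 u1 k1 x1) (Y2 v2 (j - k1) x2).

Let Tsum j u1 v2 x1 x2 : tensor M1 M2 := \sum_(k1 \in [set: int]%classic) fld j k1 u1 v2 x1 x2.

Lemma fld_window j u1 v2 x1 x2 : exists B : nat,
  forall k1, (B < `|k1|)%N -> fld j k1 u1 v2 x1 x2 = 0.
Proof.
have [N1 H1] := tb_trunc tb1 u1 x1; have [N2 H2] := tb_trunc tb2 v2 x2.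
exists (`|N1| + `|N2| + `|j|)%N => k1 kB.
have [kN|kN] := leP N1 k1; first by rewrite /fld H1 // tens0l.
by rewrite /fld H2 ?tens0r //; lia.
Qed.

Lemma Tsum_comb (c : K) (j : int) a1 a2 a3 a4 b1 b2 b3 b4 e1 e2 e3 e4 :
  (forall k1, fld j k1 a1 a2 a3 a4 = c *: fld j k1 b1 b2 b3 b4 + fld j k1 e1 e2 e3 e4) ->
  Tsum j a1 a2 a3 a4 = c *: Tsum j b1 b2 b3 b4 + Tsum j e1 e2 e3 e4.
Proof.
move=> H; have [A HA] := fld_window j a1 a2 a3 a4.
have [B HB] := fld_window j b1 b2 b3 b4; have [E HE] := fld_window j e1 e2 e3 e4.
pose D := maxn A (maxn B E).
rewrite /Tsum !(@fsum_int _ _ D).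
- by rewrite scaler_sumr -big_split /=; apply: eq_bigr => k1 _; apply: H.
- by move=> n; rewrite !gtn_max => /andP[_ /andP[_ nE]]; apply: HE.
- by move=> n; rewrite !gtn_max => /andP[_ /andP[nE _]]; apply: HB.
- by move=> n; rewrite !gtn_max => /andP[nE _]; apply: HA.
Qed.

Let pr (j : bool) u2 : V2 := 2^-1 *: (u2 + (-1) ^+ j *: par2 u2).
Let pm (j : bool) x1 : M1 := if j then parM1 x1 else x1.

Let pr_lin j : linear (pr j).
Proof.
move=> c u v; rewrite /pr par2_lin !scalerDr !scalerA addrACA.
by congr (_ *: _ + _ *: _ + _); ring.
Qed.

Let pm_lin j : linear (pm j).
Proof. by rewrite /pm; case: j. Qed.

Let inner (k : int) (u12 : V1 * V2) (x12 : M1 * M2) : tensor M1 M2 :=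
  \sum_(j : bool) Tsum (k - 2) u12.1 (pr j u12.2) (pm j x12.1) x12.2.

Let inner_comb (c : K) k (u12 v12 w12 : V1 * V2) (x12 y12 z12 : M1 * M2) :
  (forall j k1, fld (k - 2) k1 u12.1 (pr j u12.2) (pm j x12.1) x12.2 =
    c *: fld (k - 2) k1 v12.1 (pr j v12.2) (pm j y12.1) y12.2 +
    fld (k - 2) k1 w12.1 (pr j w12.2) (pm j z12.1) z12.2) ->
  inner k u12 x12 = c *: inner k v12 y12 + inner k w12 z12.
Proof.
move=> H; rewrite /inner scaler_sumr -big_split; apply: eq_bigr => j _ /=.
by apply: Tsum_comb => k1; apply: H.
Qed.

Let inner_xl k u12 x2 : linear (fun x1 => inner k u12 (x1, x2)).
Proof.
move=> c x y; apply: inner_comb => j k1 /=.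
by rewrite /fld pm_lin (tb_r tb1) tens_linear_l.
Qed.

Let inner_xr k u12 x1 : linear (fun x2 => inner k u12 (x1, x2)).
Proof.
move=> c x y; apply: inner_comb => j k1 /=.
by rewrite /fld (tb_r tb2) tens_linear_r.
Qed.

Let inner_ul k u2 x12 : linear (fun u1 => inner k (u1, u2) x12).
Proof.
move=> c x y; apply: inner_comb => j k1 /=.
by rewrite /fld (tb_l tb1) tens_linear_l.
Qed.

Let inner_ur k u1 x12 : linear (fun u2 => inner k (u1, u2) x12).
Proof.
move=> c x y; apply: inner_comb => j k1 /=.
by rewrite /fld pr_lin (tb_l tb2) tens_linear_r.
Qed.

Local Notation TY := (tensor_Ytw par2 parM1 Y1 Y2).

Let TYE u k x : TY u k x = plift (fun u12 => plift (inner k u12) x) u.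
Proof. by []. Qed.

Let outer_l k x u2 : linear (fun u1 => plift (inner k (u1, u2)) (x : tensor M1 M2)).
Proof. by move=> c u v; apply: plift_comb => x12; apply: inner_ul. Qed.

Let outer_r k x u1 : linear (fun u2 => plift (inner k (u1, u2)) (x : tensor M1 M2)).
Proof. by move=> c u v; apply: plift_comb => x12; apply: inner_ur. Qed.

Lemma tensor_Ytw_pure u1 u2 k x1 x2 :
  TY (tens u1 u2) k (tens x1 x2) = inner k (u1, u2) (x1, x2).
Proof.
rewrite TYE (tensor_lift_tens (outer_l k _) (outer_r k _)).
by rewrite (tensor_lift_tens (inner_xl _ _) (inner_xr _ _)).
Qed.

Lemma tensor_Ytw_linear_l k x : linear (fun u => TY u k x).
Proof. exact: (tensor_lift_linear (outer_l k x) (outer_r k x)). Qed.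

Lemma tensor_Ytw_linear_r k u : linear (fun x => TY u k x).
Proof.
move=> c x y; apply: plift_comb => u12.
exact: (tensor_lift_linear (inner_xl k u12) (inner_xr k u12)).
Qed.

Lemma tensor_Ytw_tb : trunc_bilinear TY.
Proof.
split; [exact: tensor_Ytw_linear_l | exact: tensor_Ytw_linear_r | move=> u x].
elim: (tensor_span u) => [|c _ v [u1 [u2 ->]] _ [N HN]].
  by exists 0 => k _; rewrite (lin0 (tensor_Ytw_linear_l k x)).
suff [N' HN'] : exists N', forall k, N' <= k -> TY (tens u1 u2) k x = 0.
  exists (Num.max N N') => k; rewrite ge_max => /andP[kN kN'].
  by rewrite tensor_Ytw_linear_l HN // HN' // scaler0 addr0.
elim: (tensor_span x) => [|e _ y [x1 [x2 ->]] _ [N1 HN1]].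
  by exists 0 => k _; rewrite (lin0 (tensor_Ytw_linear_r k _)).
suff [N' HN'] : exists N', forall k, N' <= k -> TY (tens u1 u2) k (tens x1 x2) = 0.
  exists (Num.max N1 N') => k; rewrite ge_max => /andP[kN kN'].
  by rewrite tensor_Ytw_linear_r HN1 // HN' // scaler0 addr0.
have H j : exists N', forall k, N' <= k -> Tsum (k - 2) u1 (pr j u2) (pm j x1) x2 = 0.
  have [A HA] := tb_trunc tb1 u1 (pm j x1); have [B HB] := tb_trunc tb2 (pr j u2) x2.
  exists (A + B + 2) => k kAB; apply: fsbig1 => k1 _.
  have [kN|kN] := leP A k1; first by rewrite /fld HA // tens0l.
  by rewrite /fld HB ?tens0r //; lia.
have [A HA] := H true; have [B HB] := H false.
exists (Num.max A B) => k; rewrite ge_max => /andP[kN kN'].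
by rewrite tensor_Ytw_pure /inner big_bool /= HA // HB // addr0.
Qed.

Let pr_even u : par2 u = (-1) ^+ false *: u -> pr true u = 0 /\ pr false u = u.
Proof.
move=> Hp; rewrite /pr Hp expr1 !scale1r scaleN1r subrr scaler0; split=> //.
by rewrite -mulr2n -(scaler_nat 2 u) scalerA mulVf ?pnatr_eq0 // scale1r.
Qed.

(** The vacuum acts only at index -2 and an even [u2] has no odd component, so a single term without
    a Koszul sign remains. *)
Lemma tensor_Ytw_vacl vac1 u2 k x1 x2 :
  (forall k w, Y1 vac1 k w = if k == -2 then w else 0) -> par2 u2 = (-1) ^+ false *: u2 ->
  TY (tens vac1 u2) k (tens x1 x2) = tens x1 (Y2 u2 k x2).
Proof.
move=> Hv Hp; rewrite tensor_Ytw_pure /inner big_bool /=.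
have [-> ->] := pr_even Hp.
rewrite [X in X + _]fsbig1 => [|k1 _]; last by rewrite /fld (lin0 (tb_l tb2 _ _)) tens0r.
rewrite add0r /Tsum (fsbigE [:: -2]) //; last first.
  by move=> k1 _; rewrite inE => kn; rewrite /fld Hv (negPf kn) tens0l.
rewrite big_cons big_nil in_setT /= addr0 /fld Hv /=.
by have -> : k - 2 - -2 = k by lia.
Qed.

Lemma tensor_Ytw_vacr u1 vac2 k x1 x2 :
  (forall k w, Y2 vac2 k w = if k == -2 then w else 0) -> par2 vac2 = (-1) ^+ false *: vac2 ->
  TY (tens u1 vac2) k (tens x1 x2) = tens (Y1 u1 k x1) x2.
Proof.
move=> Hv Hp; rewrite tensor_Ytw_pure /inner big_bool /=.
have [-> ->] := pr_even Hp.
rewrite [X in X + _]fsbig1 => [|k1 _]; last by rewrite /fld (lin0 (tb_l tb2 _ _)) tens0r.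
rewrite add0r /Tsum (fsbigE [:: k]) //; last first.
  move=> k1 _; rewrite inE => kn; rewrite /fld Hv (_ : _ == -2 = false) ?tens0r //.
  by apply: contraNF kn => /eqP kn; apply/eqP; lia.
rewrite big_cons big_nil in_setT /= addr0 /fld Hv.
by have -> : k - 2 - k == -2 by lia.
Qed.

End TwistedBilinear.

(** * The action of GL(a^+) *)

Section GLAction.
Context (K : numFieldType) (p : bool) (d : nat) (X : polarized K p d).
Context (b : dual_bases X).
Local Notation h := (d./2).
Hypothesis h_gt0 : (0 < h)%N.
Local Notation sg := ((-1) ^+ p : K).
Local Notation EndP := ('End(subvs_of (pol_pos X))).

(** The basis vectors live in [X] and not in the subspace type on which [g] acts, hence the
    quantification over their preimages [x]. *)
Definition gl_diag (g : EndP) (lam : 'I_h -> K) : Prop :=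
  forall i (x : subvs_of (pol_pos X)),
    vsval x = dpos b i -> vsval (g x) = lam i *: dpos b i.

Context (g : EndP) (lam : 'I_h -> K).
Hypothesis lam_neq0 : forall i, lam i != 0.
Hypothesis g_diag : gl_diag g lam.

(** A witness for the conditions defining [gl_ext], which is picked by [xget] and would otherwise be
    the default 0. The eigenvalues on the dual vectors are inverted. *)
Definition gl_fun (x : X) : X :=
  \sum_i (lam i * pol_form (dneg b i) x) *: dpos b i
  + \sum_i ((lam i)^-1 * (- sg * pol_form (dpos b i) x)) *: dneg b i.

Lemma gl_fun_linear : linear gl_fun.
Proof.
move=> c x y; rewrite /gl_fun -!big_split /= scaler_sumr -big_split /=.
apply: eq_bigr => i _; rewrite !pform_linear_r scalerDr !scalerA addrACA -!scalerDl.
by congr (_ *: _ + _ *: _); ring.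
Qed.

HB.instance Definition _ := GRing.isLinear.Build K X X *:%R gl_fun gl_fun_linear.

Definition gl_spec (f : 'End(X)) : Prop :=
  [/\ forall x, f (vsval x) = vsval (g x),
      forall y, y \in pol_neg X -> f y \in pol_neg X &
      forall x y, x \in pol_pos X -> y \in pol_neg X ->
        pol_form (f x) (f y) = pol_form x y].

Lemma gl_spec_dpos f : gl_spec f -> forall i, f (dpos b i) = lam i *: dpos b i.
Proof.
case=> f1 _ _ i; have := f1 (vsproj _ (dpos b i)).
by rewrite vsprojK ?dpos_mem // => ->; apply: g_diag; rewrite vsprojK ?dpos_mem.
Qed.

(** The image stays in the negative summand, and invariance of the form fixes its pairings with the
    eigenvectors [dpos b j], hence all its coordinates. *)
Lemma gl_spec_dneg f : gl_spec f -> forall i, f (dneg b i) = (lam i)^-1 *: dneg b i.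
Proof.
move=> sf i; have [_ f2 f3] := sf.
rewrite -[LHS](neg_part_id b) ?f2 ?dneg_mem // /neg_part (bigD1 i) //= big1 => [|j ji].
  rewrite addr0; congr (_ *: _).
  have := f3 (dpos b i) (dneg b i) (dpos_mem _ _) (dneg_mem _ _).
  rewrite (gl_spec_dpos sf) pformZl form_pos_neg eqxx mulr1 => E.
  by rewrite -[X in _ * X](mulKf (lam_neq0 i)) E mulrCA signMM mulr1.
have := f3 (dpos b j) (dneg b i) (dpos_mem _ _) (dneg_mem _ _).
rewrite (gl_spec_dpos sf) pformZl form_pos_neg (negPf ji) mulr0 => /eqP.
by rewrite mulf_eq0 (negPf (lam_neq0 j)) /= => /eqP ->; rewrite mulr0 scale0r.
Qed.

Lemma gl_fun_dpos i : gl_fun (dpos b i) = lam i *: dpos b i.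
Proof.
rewrite /gl_fun [X in _ + X]big1 => [|j _]; last first.
  by rewrite form_pos_pos ?dpos_mem // !mulr0 scale0r.
rewrite addr0 (bigD1 i) //= big1 => [|j ji]; first by rewrite form_neg_pos eqxx mulr1 addr0.
by rewrite form_neg_pos (negPf ji) mulr0 scale0r.
Qed.

Lemma gl_fun_dneg i : gl_fun (dneg b i) = (lam i)^-1 *: dneg b i.
Proof.
rewrite /gl_fun [X in X + _]big1 => [|j _]; last first.
  by rewrite form_neg_neg ?dneg_mem // !mulr0 scale0r.
rewrite add0r (bigD1 i) //= big1 => [|j ji].
  by rewrite form_pos_neg eqxx addr0 mulr1 signMM mulr1.
by rewrite form_pos_neg (negPf ji) !mulr0 scale0r.
Qed.

Lemma gl_spec_ex : exists f, gl_spec f.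
Proof.
exists (linfun gl_fun); split.
- move=> x; rewrite lfunE /=.
  have E := coord_basis (db_pos_basis b) (subvsP x).
  have Ex : x = \sum_(i < h) coord (db_pos b) i (vsval x) *: vsproj (pol_pos X) (dpos b i).
    apply: val_inj; rewrite /= [LHS]E linear_sum; apply: eq_bigr => i _ /=.
    by rewrite vsprojK ?dpos_mem // /dpos (tnth_nth 0).
  rewrite [in RHS]Ex linear_sum linear_sum /= [in LHS]E linear_sum; apply: eq_bigr => i _ /=.
  rewrite !linearZ /= -tnth_nth -[tnth _ _]/(dpos b i) gl_fun_dpos; congr (_ *: _).
  by rewrite (g_diag (i := i)) ?vsprojK ?dpos_mem.
- move=> y yn; rewrite lfunE /= /gl_fun big1 ?add0r => [|i _].
    by apply: memv_suml => i _; apply/memvZ/dneg_mem.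
  by rewrite form_neg_neg ?dneg_mem // mulr0 scale0r.
move=> x y xp yn; rewrite !lfunE /= -{1}(pos_part_id b xp) -{1}(neg_part_id b yn).
rewrite -{2}(pos_part_id b xp) -{2}(neg_part_id b yn) /pos_part /neg_part !linear_sum /=.
rewrite !pform_suml; apply: eq_bigr => i _; rewrite !pform_sumr; apply: eq_bigr => j _.
rewrite !linearZ /= gl_fun_dpos gl_fun_dneg !pformZl !pformZr form_pos_neg.
have [->|] := eqVneq i j; last by rewrite !mulr0.
by field.
Qed.

Lemma gl_ext_spec : gl_spec (gl_ext g).
Proof. exact: (xgetPex 0 gl_spec_ex). Qed.

Local Notation e := (gl_ext g).

Lemma gl_ext_pos x : x \in pol_pos X -> e x \in pol_pos X.
Proof.
have [e1 _ _] := gl_ext_spec.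
by move=> xp; rewrite -(vsprojK xp) e1; apply: subvsP.
Qed.

Lemma gl_ext_form x y : pol_form (e x) (e y) = pol_form x y.
Proof.
have [_ e2 e3] := gl_ext_spec.
have split z : exists u v, [/\ u \in pol_pos X, v \in pol_neg X & z = u + v].
  by exists (pos_part b z), (neg_part b z); rewrite pos_part_mem neg_part_mem -pos_neg_part.
have [u [v [up vn ->]]] := split x; have [u' [v' [u'p v'n ->]]] := split y.
rewrite !linearD /= !pformDl !pformDr.
rewrite (e3 u v') // (pform_swap (e u') (e v)) (e3 u' v) // -pform_swap.
rewrite (form_pos_pos (gl_ext_pos up) (gl_ext_pos u'p)) (form_pos_pos up u'p).
by rewrite (form_neg_neg (e2 _ vn) (e2 _ v'n)) (form_neg_neg vn v'n).
Qed.

Lemma gl_act_rel tw y : fock_rel tw y ->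
  free_ext (fun w => word tw [seq (e s.1, s.2) | s : letter X <- w]) y = 0.
Proof.
move: y; apply: fock_relP => [w w' c u v n|w w' s t|w s As].
- by rewrite !map_cat /= linearD linearZ /= word_linear.
- by rewrite !map_cat /= word_form; congr (_ + _ *: _); rewrite /mode_form /= gl_ext_form.
rewrite map_rcons word_vacuum //.
case: As => [s0|[s0 s1]]; [left|right] => //; split=> // /s1 sp; exact: gl_ext_pos.
Qed.

Lemma gl_act_linear tw : linear (gl_act tw g).
Proof. exact: (plift_linear (@gl_act_rel tw)). Qed.

Lemma gl_act_word tw w :
  gl_act tw g (word tw w) = word tw [seq (e s.1, s.2) | s : letter X <- w].
Proof. exact: (plift_gen (@gl_act_rel tw)). Qed.

Definition letter_eig (k : nat) : K :=
  let l := lam (Ordinal (ltn_pmod k./2 h_gt0)) in if odd k then l else l^-1.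

Lemma gl_act_pbw s : gl_act true g (pbw b h_gt0 s) =
  (\prod_(k <- s) letter_eig k) *: pbw b h_gt0 s.
Proof.
rewrite /pbw gl_act_word; elim: s => [|k s IH]; first by rewrite big_nil scale1r.
rewrite !map_cons -!mode_word IH (linZ (mode_linear _ _)) big_cons.
rewrite mulrC -scalerA; congr (_ *: _).
have -> : e (cletter b h_gt0 k).1 = letter_eig k *: (cletter b h_gt0 k).1.
  rewrite /cletter /letter_eig; case: ifP => _.
    exact: (gl_spec_dpos gl_ext_spec).
  exact: (gl_spec_dneg gl_ext_spec).
rewrite modeZl.
by rewrite mode_word -surjective_pairing.
Qed.

End GLAction.

(** * Traces of diagonal operators *)

Section DiagonalTrace.
Context (K : numFieldType) (V : lmodType K) (I : choiceType) (D : pred I).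
Context (beta : I -> V) (cf : I -> V -> K^o).
Hypothesis beta_span : forall v, lspan [set u | exists2 i, D i & u = beta i]%classic v.
Hypothesis cf_linear : forall i, linear (cf i).
Hypothesis cf_beta : forall i j, D i -> D j -> cf i (beta j) = (i == j)%:R.

Lemma beta_expand v : exists s : {fset I}, [/\ forall i, i \in s -> D i,
    forall i, D i -> i \notin s -> cf i v = 0 & v = \sum_(i <- s) cf i v *: beta i].
Proof.
elim: (beta_span v) => [|c _ y [i Di ->] _ [s [sD s0 Ey]]].
  exists fset0; split=> [i|i _ _|]; rewrite ?in_fset0 ?big_seq_fset0 //.
  exact: (lin0 (cf_linear i)).
have cfE j : D j -> cf j (c *: beta i + y) = c * (j == i)%:R + cf j y.
  by move=> Dj; rewrite cf_linear cf_beta.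
exists (i |` s)%fset; split=> [j|j Dj|].
- by rewrite !inE => /orP[/eqP->|/sD].
- by rewrite !inE negb_or => /andP[ji js]; rewrite cfE // s0 // (negPf ji) mulr0 addr0.
have -> : \sum_(j <- (i |` s)%fset) cf j (c *: beta i + y) *: beta j =
   \sum_(j <- (i |` s)%fset) (c * (j == i)%:R) *: beta j +
   \sum_(j <- (i |` s)%fset) cf j y *: beta j.
  rewrite -big_split /= [LHS]big_seq [RHS]big_seq; apply: eq_bigr => j.
  by rewrite !inE => js; rewrite -scalerDl cfE //; case/orP: js => [/eqP->|/sD].
congr (_ + _).
  rewrite (big_fsetD1 i) ?inE ?eqxx //= mulr1 big_seq big1 ?addr0 // => j.
  by rewrite !inE => /andP[/negPf -> _]; rewrite mulr0 scale0r.
rewrite {1}Ey; apply: big_fset_incl => [|j]; first exact: fsubsetU1.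
rewrite !inE => /orP[/eqP->|-> //] is_; first by rewrite s0 ?scale0r.
Qed.

Context (J L T : V -> V) (mm : I -> int) (nn : I -> nat) (tau : I -> K).
Hypotheses (J_linear : linear J) (L_linear : linear L).
Hypothesis J_beta : forall i, D i -> J (beta i) = (mm i)%:~R *: beta i.
Hypothesis L_beta : forall i, D i -> L (beta i) = (nn i)%:R *: beta i.
Hypothesis T_beta : forall i, D i -> T (beta i) = tau i *: beta i.
Context (F : int -> nat -> {fset I}).
Hypothesis FP : forall m n i, (i \in F m n) = [&& D i, mm i == m & nn i == n].

Lemma cf_diag (f : V -> V) (e : I -> K) : linear f ->
  (forall i, D i -> f (beta i) = e i *: beta i) ->
  forall i v, D i -> cf i (f v) = e i * cf i v.
Proof.
move=> lf fE i v Di.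
have l1 : linear (fun v => cf i (f v)) by move=> c x y; rewrite lf cf_linear.
have l2 : linear (fun v => (e i * cf i v : K^o)).
  by move=> c x y; rewrite cf_linear mulrDr /GRing.scale /= mulrCA.
apply: (lin_ext_span l1 l2 beta_span) => _ [j Dj ->].
rewrite fE // (linZ (cf_linear i)) cf_beta // /GRing.scale /=.
by have [->|] := eqVneq i j; rewrite ?mulr0.
Qed.

(** The point is that a joint eigenspace contains nothing beyond the basis vectors of its fibre. A
    coordinate of an eigenvector is multiplied by the difference of two integer eigenvalues and must
    give 0, so it vanishes outside the fibre [F m n], which is finite. *)
Lemma diagonal_graded_trace :
  graded_trace T J L (fun m n => \sum_(i <- F m n) tau i).
Proof.
split=> [w|m n].
  apply: lspan_mono (beta_span w) => _ [i Di ->]; apply: lspan_id.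
  by exists (mm i), (nn i); split; [exact: J_beta | exact: L_beta].
pose r := in_tuple (F m n); pose e k := beta (tnth r k).
have rF k : tnth r k \in F m n by rewrite mem_tnth.
have rD k : D (tnth r k) by move: (rF k); rewrite FP => /and3P[].
have rI : injective (tnth r) by apply/tuple_uniqP; apply: fset_uniq.
have cfe j k : cf (tnth r j) (e k) = (j == k)%:R.
  by rewrite cf_beta // (inj_eq rI).
exists (size (F m n)), e, (\matrix_(i, j) (tau (tnth r i) *+ (i == j))); split.
- apply/seteqP; split=> x /=.
    move=> [Jx Lx]; exists (fun k => cf (tnth r k) x).
    have -> : \sum_i cf (tnth r i) x *: e i = \sum_(i <- F m n) cf i x *: beta i.
      by rewrite [RHS]big_tnth.
    have [s [sD s0 {1}->]] := beta_expand x.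
    have cf0 i : D i -> i \notin F m n -> cf i x = 0.
      move=> Di; rewrite FP Di /= => iF.
      have H1 := cf_diag J_linear J_beta x Di; have H2 := cf_diag L_linear L_beta x Di.
      move: H1 H2; rewrite Jx Lx !(linZ (cf_linear i)) /GRing.scale /=.
      move=> /eqP; rewrite -subr_eq0 -mulrBl mulf_eq0 => H1.
      move=> /eqP; rewrite -subr_eq0 -mulrBl mulf_eq0 => H2.
      apply/eqP; case: eqP iF H1 H2 => [->|mi] /=.
        by move=> ni _; rewrite subr_eq0 eqr_nat eq_sym (negPf ni).
      by move=> _; rewrite subr_eq0 eqr_int; case: eqP => // E; case: mi.
    (* The support [s] of the expansion and the fibre need not be comparable; both sums are extended
       to their union. *)
    transitivity (\sum_(i <- (s `|` F m n)%fset) cf i x *: beta i).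
      apply: big_fset_incl; first exact: fsubsetUl.
      move=> i; rewrite inE => /orP[-> //|]; rewrite FP => /and3P[Di _ _] /(s0 _ Di) ->.
      by rewrite scale0r.
    apply/esym; apply: big_fset_incl; first exact: fsubsetUr.
    move=> i; rewrite inE => /orP[/sD Di|-> //] iF.
    by rewrite cf0 ?scale0r.
  move=> [c ->]; split.
    rewrite (lin_sum J_linear) scaler_sumr; apply: eq_bigr => k _.
    rewrite (linZ J_linear) J_beta //; move: (rF k); rewrite FP => /and3P[_ /eqP -> _].
    by rewrite !scalerA mulrC.
  rewrite (lin_sum L_linear) scaler_sumr; apply: eq_bigr => k _.
  rewrite (linZ L_linear) L_beta //; move: (rF k); rewrite FP => /and3P[_ _ /eqP ->].
  by rewrite !scalerA mulrC.
- move=> c c0 i; have := congr1 (cf (tnth r i)) c0.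
  rewrite (lin0 (cf_linear _)) (lin_sum (cf_linear _)) (bigD1 i) //= big1.
    by rewrite addr0 (linZ (cf_linear _)) cfe eqxx /GRing.scale /= mulr1.
  by move=> j ji; rewrite (linZ (cf_linear _)) cfe eq_sym (negPf ji) /GRing.scale /= mulr0.
- move=> i; rewrite T_beta // (bigD1 i) //= big1 ?addr0 => [|j ji].
    by rewrite mxE eqxx.
  by rewrite mxE eq_sym (negPf ji) scale0r.
by rewrite big_tnth /mxtrace; apply: eq_bigr => i _; rewrite mxE eqxx.
Qed.

End DiagonalTrace.

Section TensorCoord.
Context (K : comNzRingType) (U V : lmodType K) (f : U -> K^o) (g : V -> K^o).
Hypotheses (lf : linear f) (lg : linear g).

Definition tensor_coord : tensor U V -> K^o := plift (fun uv => (f uv.1 * g uv.2 : K^o)).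

Let coord_l v : linear (fun u => (f (u, v).1 * g (u, v).2 : K^o)).
Proof. by move=> c u u'; rewrite /= lf mulrDl /GRing.scale /= mulrA. Qed.

Let coord_r u : linear (fun v => (f (u, v).1 * g (u, v).2 : K^o)).
Proof. by move=> c v v'; rewrite /= lg mulrDr /GRing.scale /= mulrCA. Qed.

Lemma tensor_coord_tens u v : tensor_coord (tens u v) = f u * g v.
Proof. exact: (tensor_lift_tens coord_l coord_r). Qed.

Lemma tensor_coord_linear : linear tensor_coord.
Proof. exact: (tensor_lift_linear coord_l coord_r). Qed.

End TensorCoord.

(** * Monomials of W_tw *)

Local Notation h2_gt0 := (isT : 0 < 2./2)%N.
Local Notation h4_gt0 := (isT : 0 < 4./2)%N.

Section FockTruncBilinear.
Context (K : numFieldType) (p : bool) (d : nat) (X : polarized K p d).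
Context (FX : fock_fields X).

Lemma ff_Ytw_tb : trunc_bilinear (ff_Ytw FX).
Proof.
split=> [k x|k u|]; last exact: (tw_trunc (ff_twisted FX)).
- exact: (Yt_linear_l (ff_twisted FX) k x).
- exact: (Yt_linear_r (ff_twisted FX) u k).
Qed.

Lemma ff_Ytw_vac k w : ff_Ytw FX (vac X false) k w = if k == -2 then w else 0.
Proof. exact: (tw_vacuum (ff_twisted FX)). Qed.

End FockTruncBilinear.

Section W7Operators.
Context (K : numFieldType) (E A : polarized K true 2) (B : polarized K false 4).
Context (FE : fock_fields E) (FA : fock_fields A) (FB : fock_fields B).
Context (bE : dual_bases E) (bA : dual_bases A) (bB : dual_bases B).
Local Notation vE := (vac E false).
Local Notation vA := (vac A false).
Local Notation vB := (vac B false).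

Local Notation YEA := (tensor_Ytw (fock_parity false) (fock_parity true) (ff_Ytw FE) (ff_Ytw FA)).

Let tbE := ff_Ytw_tb FE.
Let tbA := ff_Ytw_tb FA.
Let tbB := ff_Ytw_tb FB.
Let plE tw := @fock_parity_linear K true 2 E tw.
Let plA tw := @fock_parity_linear K true 2 A tw.
Let plB tw := @fock_parity_linear K false 4 B tw.
Let tbEA : trunc_bilinear YEA := tensor_Ytw_tb (@plA false) (@plE true) tbE tbA.
Let plEA := tensor_map_linear (@plE true) (@plA true).

Local Notation TEA := (tensor (fock E true) (fock A true)).

(** Allows the product of the first two factors to be treated as one left factor whose vacuum acts
    as the identity. *)
Lemma YEA_vac k w : YEA (tens vE vA) k w = (if k == -2 then w else 0) :> TEA.
Proof.
have l2 : linear (fun w : TEA => (if k == -2 then w else 0) : TEA).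
  by move=> c x y; case: ifP => _ //; rewrite scaler0 addr0.
apply: (tensor_lin_ext (tb_r tbEA k _) l2) => x1 x2.
rewrite (tensor_Ytw_vacl (@plA false) (@plE true) tbE tbA _ _ _ (ff_Ytw_vac FE) (vac_par A false)).
by rewrite (ff_Ytw_vac FA); case: ifP => _ //; rewrite tens0r.
Qed.

Local Notation YW := (W7_Ytw FE FA FB).

Let tbW : trunc_bilinear YW := tensor_Ytw_tb (@plB false) plEA tbEA tbB.

Lemma W7_Ytw_linear_l k x : linear (fun u => YW u k x).
Proof. exact: (tb_l tbW k x). Qed.

Lemma W7_Ytw_linear_r k u : linear (YW u k).
Proof. exact: (tb_r tbW k u). Qed.

Lemma W7_Ytw_E u k x y z : YW (tens (tens u vA) vB) k (tens (tens x y) z) =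
  tens (tens (ff_Ytw FE u k x) y) z.
Proof.
rewrite /W7_Ytw (tensor_Ytw_vacr (@plB false) plEA tbEA tbB _ _ _ _ (ff_Ytw_vac FB) (vac_par B false)).
by rewrite (tensor_Ytw_vacr (@plA false) (@plE true) tbE tbA _ _ _ _ (ff_Ytw_vac FA) (vac_par A false)).
Qed.

Lemma W7_Ytw_A u k x y z : fock_parity false u = (-1) ^+ false *: u ->
  YW (tens (tens vE u) vB) k (tens (tens x y) z) =
  tens (tens x (ff_Ytw FA u k y)) z.
Proof.
move=> pu; rewrite /W7_Ytw (tensor_Ytw_vacr (@plB false) plEA tbEA tbB _ _ _ _ (ff_Ytw_vac FB) (vac_par B false)).
by rewrite (tensor_Ytw_vacl (@plA false) (@plE true) tbE tbA _ _ _ (ff_Ytw_vac FE) pu).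
Qed.

Lemma W7_Ytw_B u k x y z : fock_parity false u = (-1) ^+ false *: u ->
  YW (tens (tens vE vA) u) k (tens (tens x y) z) =
  tens (tens x y) (ff_Ytw FB u k z).
Proof.
by move=> pu; rewrite /W7_Ytw (tensor_Ytw_vacl (@plB false) plEA tbEA tbB _ _ _ YEA_vac pu).
Qed.

Lemma W7_J0_linear : linear (W7_J0 FE FA FB bA bB).
Proof. exact: W7_Ytw_linear_r. Qed.

Lemma W7_Je0_linear : linear (W7_Je0 FE FA FB bE).
Proof. exact: W7_Ytw_linear_r. Qed.

Lemma W7_L0_linear : linear (W7_L0 FE FA FB bE bA bB).
Proof. exact: W7_Ytw_linear_r. Qed.

Lemma W7_Je0_tens x y z :
  W7_Je0 FE FA FB bE (tens (tens x y) z) = tens (tens (J0 FE bE x) y) z.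
Proof. exact: W7_Ytw_E. Qed.

Lemma W7_J0_tens x y z : W7_J0 FE FA FB bA bB (tens (tens x y) z) =
  4 *: tens (tens x (J0 FA bA y)) z + tens (tens x y) (J0 FB bB z).
Proof.
rewrite /W7_J0 /W7_j W7_Ytw_linear_l.
exact: (congr2 (fun a b => 4 *: a + b) (W7_Ytw_A 0 x y z (current_par bA))
  (W7_Ytw_B 0 x y z (current_par bB))).
Qed.

Lemma W7_L0_tens x y z : W7_L0 FE FA FB bE bA bB (tens (tens x y) z) =
  tens (tens (L0 FE bE x) y) z + tens (tens x (L0 FA bA y)) z
  + tens (tens x y) (L0 FB bB z).
Proof.
rewrite /W7_L0 /W7_omega.
apply: etrans (linD (W7_Ytw_linear_l _ _) _ _) _.
apply: (congr2 +%R _ (W7_Ytw_B 2 x y z (conformal_par bB))).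
apply: etrans (linD (W7_Ytw_linear_l _ _) _ _) _.
exact: (congr2 +%R (W7_Ytw_E _ 2 x y z) (W7_Ytw_A 2 x y z (conformal_par bA))).
Qed.

End W7Operators.

Section TensorEigen.
Context (K : comNzRingType) (U V : lmodType K).
Implicit Types (u : U) (v : V).

Lemma tens_eigen_l u u' v a : u = a *: u' -> tens u v = a *: tens u' v.
Proof. by move=> ->; exact: (linZ (tens_linear_l v)). Qed.

Lemma tens_eigen_r u v v' a : v = a *: v' -> tens u v = a *: tens u v'.
Proof. by move=> ->; exact: (linZ (tens_linear_r u)). Qed.

Lemma tens_eigen u u' v v' a c : u = a *: u' -> v = c *: v' ->
  tens u v = (a * c) *: tens u' v'.
Proof. by move=> /tens_eigen_l -> /tens_eigen_r ->; rewrite scalerA. Qed.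

End TensorEigen.

Section ScaleSums.
Context (K : comNzRingType) (V : lmodType K).

Lemma scale4_add (u v t : V) (a c : K) : u = a *: t -> v = c *: t ->
  4 *: u + v = (4 * a + c) *: t.
Proof. by move=> -> ->; rewrite scalerA -scalerDl. Qed.

Lemma scale_add3 (u v w t : V) (a e c : K) : u = a *: t -> v = e *: t -> w = c *: t ->
  u + v + w = (a + e + c) *: t.
Proof. by move=> -> -> ->; rewrite -!scalerDl. Qed.

End ScaleSums.

Section W7Basis.
Context (K : numFieldType) (E A : polarized K true 2) (B : polarized K false 4).
Context (FE : fock_fields E) (FA : fock_fields A) (FB : fock_fields B).
Context (bE cE : dual_bases E) (bA cA : dual_bases A) (bB cB : dual_bases B).

Definition w7_index : Type := (seq nat * seq nat * seq nat)%type.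

Definition w7_adm (s : w7_index) : bool :=
  [&& sorted (pbw_rel true) s.1.1, sorted (pbw_rel true) s.1.2
    & sorted (pbw_rel false) s.2].

Definition w7_basis (s : w7_index) : W7tw E A B :=
  tens (tens (pbw cE h2_gt0 s.1.1) (pbw cA h2_gt0 s.1.2))
    (pbw cB h4_gt0 s.2).

Definition w7_coord (s : w7_index) : W7tw E A B -> K^o :=
  tensor_coord (tensor_coord (pbw_coord cE h2_gt0 s.1.1)
    (pbw_coord cA h2_gt0 s.1.2)) (pbw_coord cB h4_gt0 s.2).

Lemma w7_basis_span v : lspan [set u | exists2 s, w7_adm s & u = w7_basis s]%classic v.
Proof.
have H := tensor_span_basis (tensor_span_basis (pbw_span cE h2_gt0)
  (pbw_span cA h2_gt0)) (pbw_span cB h4_gt0) v.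
apply: lspan_mono H => _ [_ [_ [[_ [_ [[s1 a1 ->] [s2 a2 ->] ->]]] [s3 a3 ->] ->]]].
by apply: lspan_id; exists (s1, s2, s3); rewrite // /w7_adm a1 a2 a3.
Qed.

Lemma w7_coord_linear s : linear (w7_coord s).
Proof.
do 2 ?[apply: tensor_coord_linear]; exact: pbw_coord_linear.
Qed.

Lemma w7_coordE s t : w7_adm s -> w7_adm t -> w7_coord s (w7_basis t) = (s == t)%:R.
Proof.
case: s t => [[s1 s2] s3] [[t1 t2] t3] /and3P[/= a1 a2 a3] /and3P[/= b1 b2 b3].
rewrite /w7_coord /w7_basis tensor_coord_tens /=; last 2 first.
- by apply: tensor_coord_linear; apply: pbw_coord_linear.
- exact: pbw_coord_linear.
rewrite tensor_coord_tens /=; [|exact: pbw_coord_linear..].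
by rewrite !pbw_coordE // !xpair_eqE; case: (_ == _); case: (_ == _); case: (_ == _); rewrite ?mul1r ?mul0r ?mulr0.
Qed.

(** The constant 1 is the charge of the twisted vacuum, 4 times 1/2 from a and -1 from b. Its weight
    1/8 + 1/8 - 1/4 is zero, so [w7_weight] has no constant. *)
Definition w7_charge (s : w7_index) : int := 1 + 4 * pbw_charge s.1.2 + pbw_charge s.2.
Definition w7_weight (s : w7_index) : nat :=
  (pbw_weight 2 s.1.1 + pbw_weight 2 s.1.2 + pbw_weight 4 s.2)%N.

Lemma W7_J0_eigen x y z (a c : K) : J0 FA bA y = a *: y -> J0 FB bB z = c *: z ->
  W7_J0 FE FA FB bA bB (tens (tens x y) z) = (4 * a + c) *: tens (tens x y) z.
Proof.
move=> Ha Hc.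
have e1 := tens_eigen_l z (tens_eigen_r x Ha); have e2 := tens_eigen_r (tens x y) Hc.
exact: etrans (W7_J0_tens FE FA FB bA bB x y z) (scale4_add e1 e2).
Qed.

Lemma W7_L0_eigen x y z (a e c : K) :
  L0 FE bE x = a *: x -> L0 FA bA y = e *: y -> L0 FB bB z = c *: z ->
  W7_L0 FE FA FB bE bA bB (tens (tens x y) z) = (a + e + c) *: tens (tens x y) z.
Proof.
move=> Ha He Hc.
have e1 := tens_eigen_l z (tens_eigen_l y Ha); have e2 := tens_eigen_l z (tens_eigen_r x He).
have e3 := tens_eigen_r (tens x y) Hc.
exact: etrans (W7_L0_tens FE FA FB bE bA bB x y z) (scale_add3 e1 e2 e3).
Qed.

Lemma W7_Je0_eigen x y z (a : K) : J0 FE bE x = a *: x ->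
  W7_Je0 FE FA FB bE (tens (tens x y) z) = a *: tens (tens x y) z.
Proof.
move=> Ha; exact: etrans (W7_Je0_tens FE FA FB bE x y z) (tens_eigen_l z (tens_eigen_l y Ha)).
Qed.

Lemma W7_J0_basis s :
  W7_J0 FE FA FB bA bB (w7_basis s) = (w7_charge s)%:~R *: w7_basis s.
Proof.
have E1 := W7_J0_eigen (pbw cE isT s.1.1) (J0_pbw FA bA cA isT s.1.2) (J0_pbw FB bB cB isT s.2).
have e : 4 * (- (-1) ^+ true * (2./2)%:R / 2 + (pbw_charge s.1.2)%:~R)
  + (- (-1) ^+ false * (4./2)%:R / 2 + (pbw_charge s.2)%:~R) = (w7_charge s)%:~R :> K.
  by rewrite /w7_charge !rmorphD /= rmorphM /=; field.
by rewrite -e; exact: E1.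
Qed.

Lemma W7_L0_basis s :
  W7_L0 FE FA FB bE bA bB (w7_basis s) = (w7_weight s)%:R *: w7_basis s.
Proof.
have E1 := W7_L0_eigen (L0_pbw FE bE cE isT s.1.1) (L0_pbw FA bA cA isT s.1.2)
  (L0_pbw FB bB cB isT s.2).
have e : (- (-1) ^+ true * (2./2)%:R / 8 + (pbw_weight 2 s.1.1)%:R)
  + (- (-1) ^+ true * (2./2)%:R / 8 + (pbw_weight 2 s.1.2)%:R)
  + (- (-1) ^+ false * (4./2)%:R / 8 + (pbw_weight 4 s.2)%:R) = (w7_weight s)%:R :> K.
  by rewrite /w7_weight !natrD /=; field.
by rewrite -e; exact: E1.
Qed.

Lemma W7_Je0_basis s : W7_Je0 FE FA FB bE (w7_basis s) =
  (2^-1 + (pbw_charge s.1.1)%:~R) *: w7_basis s.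
Proof.
have E1 := W7_Je0_eigen (pbw cA isT s.1.2) (pbw cB isT s.2) (J0_pbw FE bE cE isT s.1.1).
have e : - (-1) ^+ true * (2./2)%:R / 2 = 2^-1 :> K by rewrite /=; field.
by rewrite -e; exact: E1.
Qed.

Section GL.
Context (gE : 'End(subvs_of (pol_pos E))) (gA : 'End(subvs_of (pol_pos A))).
Context (gB : 'End(subvs_of (pol_pos B))).
Context (lE lA : 'I_(2./2) -> K) (lB : 'I_(4./2) -> K).
Hypotheses (lE0 : forall i, lE i != 0) (lA0 : forall i, lA i != 0) (lB0 : forall i, lB i != 0).
Hypotheses (gE_diag : gl_diag cE gE lE) (gA_diag : gl_diag cA gA lA) (gB_diag : gl_diag cB gB lB).

Lemma W7_gl_linear : linear (@W7_gl _ E A B gE gA gB).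
Proof.
apply: tensor_map_linear; last exact: (gl_act_linear lB0 gB_diag).
apply: tensor_map_linear; [exact: (gl_act_linear lE0 gE_diag)|exact: (gl_act_linear lA0 gA_diag)].
Qed.

Lemma W7_gl_basis s : @W7_gl _ E A B gE gA gB (w7_basis s) =
  ((\prod_(k <- s.1.1) letter_eig h2_gt0 lE k)
  * (\prod_(k <- s.1.2) letter_eig h2_gt0 lA k)
  * (\prod_(k <- s.2) letter_eig h4_gt0 lB k)) *: w7_basis s.
Proof.
have lE' := gl_act_linear lE0 gE_diag (tw := true).
have lA' := gl_act_linear lA0 gA_diag (tw := true).
have lB' := gl_act_linear lB0 gB_diag (tw := true).
have e1 := gl_act_pbw h2_gt0 lE0 gE_diag s.1.1.
have e2 := gl_act_pbw h2_gt0 lA0 gA_diag s.1.2.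
have e3 := gl_act_pbw h4_gt0 lB0 gB_diag s.2.
have e12 := etrans (tensor_map_tens lE' lA' _ _) (tens_eigen e1 e2).
exact: etrans (tensor_map_tens (tensor_map_linear lE' lA') lB' _ _) (tens_eigen e12 e3).
Qed.

End GL.

End W7Basis.

(* All multiplicities < M of the letters k < N: over such boxes the          *)
(* character sums factor letter by letter.                                   *)
Fixpoint cfgs (M N : nat) : seq (seq nat) :=
  if N is N'.+1 then [seq s ++ nseq j N' | s <- cfgs M N', j <- iota 0 M]
  else [:: [::]].

Arguments cfgs : simpl never.

Lemma cfgs_lt M N s : s \in cfgs M N -> all (fun k => k < N)%N s.
Proof.
elim: N s => [|N IH] s; first by rewrite inE => /eqP->.
case/allpairsP => -[u j] /= [/IH uN _ ->]; rewrite all_cat all_nseq ltnSn orbT andbT.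
by apply: sub_all uN => k /ltnW.
Qed.

Lemma cfgs_filter N u j : all (fun k => k < N)%N u ->
  seq.filter (fun k => k < N)%N (u ++ nseq j N) = u.
Proof.
move=> uN; rewrite filter_cat (elimT seq.all_filterP uN) [X in _ ++ X](_ : _ = [::]) ?cats0 //.
by elim: j => //= j ->; rewrite ltnn.
Qed.

Lemma cfgs_uniq M N : uniq (cfgs M N).
Proof.
elim: N => // N IH; apply: allpairs_uniq; rewrite ?iota_uniq // => -[u i] [v j] /=.
case/allpairsP => -[u' i'] /= [uN _ [-> ->]] /allpairsP [[v' j'] /= [vN _ [-> ->]]] E.
have e : u' = v'.
  by rewrite -(cfgs_filter i' (cfgs_lt uN)) -(cfgs_filter j' (cfgs_lt vN)) E.
by congr (_, _) => //; have := congr1 size E; rewrite e !size_cat !size_nseq => /addnI.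
Qed.

Lemma cfgs_sorted M N s : s \in cfgs M N -> sorted leq s.
Proof.
elim: N s => [|N IH] s; first by rewrite inE => /eqP->.
case/allpairsP => -[u j] /= [uc _ ->]; rewrite (sorted_pairwise leq_trans) pairwise_cat.
rewrite -!(sorted_pairwise leq_trans) IH //=; apply/andP; split.
  apply/allrelP => x y xu /nseqP[-> _].
  by have /allP/(_ _ xu)/ltnW := cfgs_lt uc.
by rewrite (sorted_pairwise leq_trans); elim: j => //= j ->; rewrite all_nseq leqnn orbT.
Qed.

Lemma cfgs_count M N s k : (0 < M)%N -> s \in cfgs M N -> (count_mem k s < M)%N.
Proof.
move=> M0; elim: N s => [|N IH] s; first by rewrite inE => /eqP->.
case/allpairsP => -[u j] /= [uc]; rewrite mem_iota add0n /= => jM ->.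
rewrite count_cat count_nseq /=; have [kN|kN] := eqVneq N k; last by rewrite mul0n addn0 IH.
rewrite mul1n (count_memPn _) //; apply/negP => ku.
by have /allP/(_ _ ku) := cfgs_lt uc; rewrite kN ltnn.
Qed.

Lemma mem_cfgs M N s : sorted leq s -> all (fun k => k < N)%N s ->
  (forall k, count_mem k s < M)%N -> s \in cfgs M N.
Proof.
elim: N s => [|N IH] s ss sN sM; first by case: s ss sN sM.
have E : s = [seq k <- s | k < N]%N ++ nseq (count_mem N s) N.
  apply: (sorted_eq leq_trans anti_leq) => //.
    rewrite (sorted_pairwise leq_trans) pairwise_cat -!(sorted_pairwise leq_trans).
    rewrite (sorted_filter leq_trans) //= -[nseq _ _]/(nseq _ _); apply/andP; split.
      by apply/allrelP => x y; rewrite mem_filter => /andP[/ltnW ? _] /nseqP[-> _].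
    rewrite (sorted_pairwise leq_trans); elim: (count_mem N s) => //= j ->.
    by rewrite all_nseq leqnn orbT.
  have E2 : [seq k <- s | predC (fun k => k < N)%N k] = nseq (count_mem N s) N.
    have -> : [seq k <- s | predC (fun k => k < N)%N k] = [seq k <- s | pred1 N k].
      by apply: eq_in_filter => k /(allP sN) /=; rewrite ltnS -leqNgt eqn_leq => ->.
    by rewrite -size_filter; apply/all_pred1P; apply: filter_all.
  by rewrite perm_sym -E2; apply/permPl; apply: perm_filterC.
rewrite E; apply/allpairsP; exists ([seq k <- s | k < N]%N, count_mem N s); split=> //=.
- apply: IH; first exact: (sorted_filter leq_trans).
    exact: filter_all.
  move=> k; apply: leq_ltn_trans (sM k); rewrite count_filter; apply: sub_count.
  by move=> x /andP[].
- by rewrite mem_iota add0n sM.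
Qed.

Lemma big_cfgs (R : comPzSemiRingType) (w : nat -> R) M N :
  \sum_(s <- cfgs M N) \prod_(k <- s) w k = \prod_(k < N) \sum_(j < M) w k ^+ j.
Proof.
elim: N => [|N IH]; first by rewrite big_seq1 big_nil big_ord0.
rewrite big_allpairs_dep /= big_ord_recr /= -IH big_distrl /=; apply: eq_bigr => s _.
rewrite -[X in iota _ X](subn0 M) -/(index_iota 0 M) big_mkord big_distrr /=.
by apply: eq_bigr => j _; rewrite big_cat big_nseq iter_mulr_1.
Qed.

(* The additive weight differentiates a product whose k = 0 factor 1 + w 0   *)
(* vanishes, so that only the derivative of this factor survives.            *)
Lemma big_cfgs_weighted (R : comPzRingType) (w : nat -> R) (a : R) (c : nat -> R) N :
  w 0 = -1 -> \sum_(s <- cfgs 2 N.+1) (a + \sum_(k <- s) c k) * \prod_(k <- s) w k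
    = - c 0 * \prod_(k < N) (1 + w k.+1).
Proof.
move=> w0; elim: N => [|N IH].
  rewrite big_ord0 /= !big_cons !big_nil w0; ring.
(* Without the additive weight the sum vanishes by its factor k = 0. This removes the term in which
   the new letter contributes its own weight. *)
have Z : \sum_(s <- cfgs 2 N.+1) \prod_(k <- s) w k = 0.
  rewrite big_cfgs big_ord_recl /=.
  by rewrite [X in X * _](_ : _ = 0) ?mul0r // !big_ord_recl big_ord0 /= w0; ring.
rewrite -[cfgs 2 N.+2]/(allpairs (fun s j => s ++ nseq j N.+1) (cfgs 2 N.+1) (iota 0 2)).
move: (cfgs 2 N.+1) Z IH => C Z IH.
rewrite big_allpairs_dep big_ord_recr /= mulrA -{}IH.
rewrite (eq_bigr (fun s => (a + \sum_(k <- s) c k) * (\prod_(k <- s) w k) * (1 + w N.+1)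
   + (\prod_(k <- s) w k) * (c N.+1 * w N.+1))) => [|s _]; last first.
  by rewrite !big_cons big_nil /= cats0 !big_cat /= !big_cons !big_nil; ring.
by rewrite big_split /= -!big_distrl /= Z mul0r addr0.
Qed.

(** * Finiteness of the monomials of given charge and weight *)

Section Indices.

Lemma pbw_charge_size s : (`|pbw_charge s| <= size s)%N.
Proof.
rewrite /pbw_charge; elim: s => [|k s IH]; first by rewrite big_nil.
rewrite big_cons /=; move: IH; case: (odd k) => /=; rewrite ?expr0 ?expr1; lia.
Qed.

Lemma pbw_weight_bound d s k : (0 < d./2)%N -> k \in s ->
  (k < d./2 * (pbw_weight d s).+1 * 2)%N.
Proof.
move=> h0 ks; have : (k./2 %/ d./2 <= pbw_weight d s)%N.
  rewrite /pbw_weight (big_rem k ks) /=; apply: leq_trans (leq_addr _ _).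
  exact: leq_addr.
rewrite -ltnS ltn_divLR // mulnC => H.
rewrite -(odd_double_half k) -muln2; apply: (@leq_trans (2 * k./2.+1)); last first.
  by rewrite mulnC leq_mul2r.
by case: (odd k); lia.
Qed.

Lemma pbw_charge_weight d s : (pbw_charge s <= pbw_weight d s)%R.
Proof.
rewrite /pbw_charge /pbw_weight; elim: s => [|k s IH]; first by rewrite !big_nil.
rewrite !big_cons; move: IH; case: (odd k); rewrite /= ?expr0 ?expr1;
  move: (k./2 %/ d./2)%N; lia.
Qed.

(** The weight alone does not bound the size, since a_i^-(0) has weight 0; but such a letter lowers
    the charge. Letter by letter, 1 plus the charge is at most twice the weight. *)
Lemma pbw_size_weight d s : (size s <= (pbw_weight d s).*2 + `|pbw_charge s|)%N.
Proof.
suff : ((size s)%:Z + pbw_charge s <= (pbw_weight d s).*2%:Z)%R by lia.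
rewrite /pbw_charge /pbw_weight; elim: s => [|k s IH]; first by rewrite !big_nil.
rewrite !big_cons; move: IH; case: (odd k); rewrite /= ?expr0 ?expr1;
  move: (k./2 %/ d./2)%N; lia.
Qed.

Lemma pbw_rel_uniq s : sorted (pbw_rel true) s = sorted leq s && uniq s.
Proof.
by rewrite -[sorted _ s]/(sorted ltn s) ltn_sorted_uniq_leq andbC.
Qed.

(** The first factor has one letter more than the second, because letter 0 is consumed by
    [big_cfgs_weighted]; the other [M.*2] letters are then e^+(-n) and e^-(-n) for 1 <= n <= M.
    There are four letters of b for each mode number, hence [M * 4]. *)
Definition w7_cut (M : nat) : seq w7_index :=
  [seq (st, u) | st <- [seq (s, t) | s <- cfgs 2 M.*2.+1, t <- cfgs 2 M.*2],
                 u <- cfgs M (M * 4)].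

Lemma w7_cut_uniq M : uniq (w7_cut M).
Proof.
apply: allpairs_uniq; rewrite ?cfgs_uniq //; last by move=> [? ?] [? ?].
apply: allpairs_uniq; rewrite ?cfgs_uniq //; by move=> [? ?] [? ?].
Qed.

Lemma mem_cfgs2 N s : (s \in cfgs 2 N) =
  sorted (pbw_rel true) s && all (fun k => k < N)%N s.
Proof.
rewrite pbw_rel_uniq; apply/idP/andP => [sc|[/andP[ss us] sN]].
  rewrite (cfgs_sorted sc) (cfgs_lt sc); split=> //; apply/count_mem_uniq => k.
  have := @cfgs_count 2 N s k isT sc; rewrite -has_pred1 has_count.
  by case: (count_mem k s) => [|[|]].
by apply: mem_cfgs => // k; rewrite ltnS count_uniq_mem // leq_b1.
Qed.

Lemma w7_cut_adm M s : s \in w7_cut M -> w7_adm s.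
Proof.
case/allpairsP => -[[s1 s2] s3] /= [/allpairsP[[t1 t2] /= [h1 h2 [-> ->]]] h3 ->].
rewrite /w7_adm /=; move: h1 h2; rewrite !mem_cfgs2 => /andP[-> _] /andP[-> _].
exact: (cfgs_sorted h3).
Qed.

(** The letters of [s2] are distinct and below 2n + 2, which bounds its size and charge. The charge
    of [s3] is then at most |m| + 1 + 4 (2n + 2) in modulus, and [pbw_size_weight] bounds the size
    of [s3] by 10 n + |m| + 9. *)
Lemma mem_w7_cut M (m : int) n s : w7_adm s -> w7_charge s = m -> w7_weight s = n ->
  (10 * n + `|m| + 10 <= M)%N -> s \in w7_cut M.
Proof.
case: s => [[s1 s2] s3] /and3P[/= a1 a2 a3]; rewrite /w7_charge /w7_weight /= => cm wn MB.
have lt1 : all (fun k => k < M.*2.+1)%N s1.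
  apply/allP => k /(@pbw_weight_bound 2 _ _ isT); rewrite /= mul1n; lia.
have lt2 : all (fun k => k < n.+1.*2)%N s2.
  apply/allP => k /(@pbw_weight_bound 2 _ _ isT); rewrite /= mul1n; lia.
have lt3 : all (fun k => k < M * 4)%N s3.
  apply/allP => k /(@pbw_weight_bound 4 _ _ isT); rewrite /=; lia.
have sz2 : (size s2 <= n.+1.*2)%N.
  rewrite -[X in (_ <= X)%N](size_iota 0); apply: uniq_leq_size.
    by move: a2; rewrite pbw_rel_uniq => /andP[].
  by move=> k /(allP lt2); rewrite mem_iota.
apply/allpairsP; exists ((s1, s2), s3); split=> //=.
  apply/allpairsP; exists (s1, s2); split=> //=; rewrite mem_cfgs2 ?a1 ?a2 //=.
  by apply: sub_all lt2 => k; lia.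
apply: mem_cfgs => // k; apply: leq_ltn_trans (count_size _ _) _.
have := pbw_size_weight 4 s3; have := pbw_charge_size s2.
move: (size s2) (size s3) sz2 (pbw_charge s2) (pbw_charge s3) cm => z2 z3 sz2 c2 c3 cm.
move: (pbw_weight 4 s3) (pbw_weight 2 s2) (pbw_weight 2 s1) wn => w3 w2 w1 wn.
clear -sz2 cm wn MB. lia.
Qed.

Definition w7_fiber (m : int) (n : nat) : {fset w7_index} :=
  [fset s | s in w7_cut (10 * n + `|m| + 10) & (w7_charge s == m) && (w7_weight s == n)]%fset.

Lemma mem_w7_fiber m n s :
  (s \in w7_fiber m n) = [&& w7_adm s, w7_charge s == m & w7_weight s == n].
Proof.
rewrite !inE /=; apply/andP/and3P => [[/w7_cut_adm sa /andP[]]|[sa sm sn]] //.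
rewrite sm sn; split=> //; apply: (mem_w7_cut sa (eqP sm) (eqP sn)) => //.
Qed.

Lemma w7_charge_bound s : (w7_charge s <= 1 + 5 * (w7_weight s)%:Z)%R.
Proof.
rewrite /w7_charge /w7_weight; have := pbw_charge_weight 2 s.1.2.
have := pbw_charge_weight 4 s.2; lia.
Qed.

End Indices.

(** * Convergence over the complex numbers *)

Section ComplexModulus.
Context (R : realType).
Local Notation C := R[i].

(** The norm of a complex number is itself an element of [R[i]]; this is the same number in [R],
    where order and convergence are handled. *)
Definition cmod (z : C) : R := complex.Re `|z|.

Lemma cmodE (z : C) : `|z| = (cmod z)%:C%C.
Proof. by rewrite /cmod RRe_real // normr_real. Qed.

Lemma RC_inj : injective (fun x : R => x%:C%C).
Proof. by move=> x y []. Qed.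

Lemma cmod_ge0 z : 0 <= cmod z.
Proof. by rewrite -lecR -cmodE; exact: normr_ge0. Qed.

Lemma cmodM z w : cmod (z * w) = cmod z * cmod w.
Proof. by apply: RC_inj; rewrite /= rmorphM /= -!cmodE normrM. Qed.

Lemma cmodV z : cmod z^-1 = (cmod z)^-1.
Proof. by apply: RC_inj; rewrite /= fmorphV /= -!cmodE normfV. Qed.

Lemma cmodX z n : cmod (z ^+ n) = cmod z ^+ n.
Proof. by apply: RC_inj; rewrite /= rmorphXn /= -!cmodE normrX. Qed.

Lemma cmodN z : cmod (- z) = cmod z.
Proof. by apply: RC_inj; rewrite /= -!cmodE normrN. Qed.

Lemma cmodD z w : cmod (z + w) <= cmod z + cmod w.
Proof. by rewrite -lecR rmorphD /= -!cmodE ler_normD. Qed.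

Lemma cmod0 : cmod 0 = 0.
Proof. by apply: RC_inj; rewrite /= -cmodE normr0. Qed.

Lemma cmod1 : cmod 1 = 1.
Proof. by apply: RC_inj; rewrite /= -cmodE normr1. Qed.

Lemma cmod_eq0 z : (cmod z == 0) = (z == 0).
Proof. by rewrite -(inj_eq RC_inj) /= -cmodE normr_eq0. Qed.

Lemma cmod_real (x : R) : 0 <= x -> cmod x%:C%C = x.
Proof. by move=> x0; apply: RC_inj; rewrite /= -cmodE ger0_norm ?lecR. Qed.

Lemma cmod_nat n : cmod n%:R = n%:R.
Proof. by rewrite -(cmod_real (ler0n R n)); congr cmod; rewrite rmorph_nat. Qed.

Lemma cmod_prod (I : Type) (r : seq I) (F : I -> C) :
  cmod (\prod_(i <- r) F i) = \prod_(i <- r) cmod (F i).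
Proof. by apply: (big_morph cmod cmodM cmod1). Qed.

Lemma cmod_sum (I : Type) (r : seq I) (P : pred I) (F : I -> C) :
  cmod (\sum_(i <- r | P i) F i) <= \sum_(i <- r | P i) cmod (F i).
Proof.
elim/big_rec2: _ => [|i x y _ H]; first by rewrite cmod0.
by apply: le_trans (cmodD _ _) _; rewrite lerD2l.
Qed.

Lemma cmod_lt (z : C) (e : R) : (`|z| < e%:C%C) = (cmod z < e).
Proof. by rewrite cmodE ltcR. Qed.

Lemma Re_le_cmod (z : C) : `|complex.Re z| <= cmod z.
Proof. by rewrite -lecR -cmodE normc_ge_Re. Qed.

Lemma cmod_i : cmod 'i%C = 1.
Proof. by apply: RC_inj; rewrite /= -cmodE normc_def /= expr0n add0r expr1n sqrtr1. Qed.

Lemma Im_le_cmod (z : C) : `|complex.Im z| <= cmod z.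
Proof.
have := Re_le_cmod (z * 'i%C); rewrite ReiNIm normrN => /le_trans; apply.
by rewrite cmodM cmod_i mulr1.
Qed.

Lemma cmod_le_ReIm (z : C) : cmod z <= `|complex.Re z| + `|complex.Im z|.
Proof.
rewrite {1}[z]complexE; apply: le_trans (cmodD _ _) _; rewrite cmodM cmod_i.
rewrite mul1r; have E (x : R) : cmod x%:C%C = `|x|.
  by apply: RC_inj; rewrite /= -cmodE normc_def /= expr0n addr0 sqrtr_sqr.
by rewrite !E.
Qed.

Lemma ccvgP (u : nat -> C) (l : C) :
  ((u n : C^o) @[n --> \oo] --> (l : C^o))%classic <->
  (forall e : R, 0 < e -> exists N, forall n, (N <= n)%N -> cmod (u n - l) < e).
Proof.
split=> [/cvgrPdist_lt H e e0|H].
  have /H [N _ HN] : 0 < e%:C%C :> C by rewrite ltcR.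
  by exists N => n Nn; have := HN n Nn; rewrite /= cmod_lt -cmodN opprB.
apply/cvgrPdist_lt => e e0.
have ee : e = (complex.Re e)%:C%C by rewrite RRe_real // gtr0_real.
move: e0; rewrite ee ltcR => /H [N HN]; exists N => // n Nn /=.
by rewrite cmod_lt -cmodN opprB; apply: HN.
Qed.

End ComplexModulus.

(** * Infinite products and q-Pochhammer symbols *)

Section InfiniteProducts.
Context (R : realType).
Local Notation C := R[i].
Local Open Scope classical_set_scope.

Lemma prod_le_expR (a : nat -> R) n : (forall k, 0 <= a k) ->
  \prod_(k < n) (1 + a k) <= expR (\sum_(k < n) a k).
Proof.
move=> a0; elim: n => [|n IH]; first by rewrite !big_ord0 expR0.
rewrite !big_ord_recr /= expRD; apply: ler_pM => //.
- by apply: prodr_ge0 => k _; rewrite addr_ge0.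
- by rewrite addr_ge0.
- exact: expR_ge1Dx.
Qed.

Lemma real_series_cvg (r : nat -> R) (S : R) :
  (forall n, \sum_(k < n) `|r k| <= S) ->
  exists l : R, (\sum_(k < n) r k) @[n --> \oo] --> l.
Proof.
move=> rS; have : cvgn [normed series r].
  apply: nondecreasing_is_cvgn.
    by apply: nondecreasing_series => n _ _; apply: normr_ge0.
  by exists S => _ [n _ <-]; have := rS n; rewrite -(big_mkord xpredT (fun k => `|r k|)).
move=> /normed_cvg/cvg_ex [l Hl]; exists l.
by under eq_fun do rewrite -(big_mkord xpredT r).
Qed.

Lemma complex_series_cvg (d : nat -> C) (S : R) :
  (forall n, \sum_(k < n) cmod (d k) <= S) ->
  exists l : C, (\sum_(k < n) d k : C^o) @[n --> \oo] --> (l : C^o).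
Proof.
move=> dS.
have [a Ha] : exists l : R, (\sum_(k < n) complex.Re (d k)) @[n --> \oo] --> l.
  apply: (@real_series_cvg (fun k => complex.Re (d k)) S) => n; apply: le_trans (dS n).
  by apply: ler_sum => k _; apply: Re_le_cmod.
have [b Hb] : exists l : R, (\sum_(k < n) complex.Im (d k)) @[n --> \oo] --> l.
  apply: (@real_series_cvg (fun k => complex.Im (d k)) S) => n; apply: le_trans (dS n).
  by apply: ler_sum => k _; apply: Im_le_cmod.
exists (Complex a b); apply/ccvgP => e e0.
have e2 : 0 < e / 2 by rewrite divr_gt0.
have [N1 _ H1] := (cvgrPdist_lt _ _).1 Ha _ e2.
have [N2 _ H2] := (cvgrPdist_lt _ _).1 Hb _ e2.
exists (maxn N1 N2) => n; rewrite geq_max => /andP[n1 n2].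
apply: le_lt_trans (cmod_le_ReIm _) _; rewrite [e]splitr.
have ReS : complex.Re (\sum_(k < n) d k) = \sum_(k < n) complex.Re (d k).
  by apply: (big_morph (@complex.Re R)) => [[? ?] [? ?]|].
have ImS : complex.Im (\sum_(k < n) d k) = \sum_(k < n) complex.Im (d k).
  by apply: (big_morph (@complex.Im R)) => [[? ?] [? ?]|].
apply: ltrD.
- have -> : complex.Re (\sum_(k < n) d k - Complex a b) = \sum_(k < n) complex.Re (d k) - a.
    by rewrite -ReS; case: (\sum_(k < n) d k).
  by rewrite distrC; apply: H1.
- have -> : complex.Im (\sum_(k < n) d k - Complex a b) = \sum_(k < n) complex.Im (d k) - b.
    by rewrite -ImS; case: (\sum_(k < n) d k).
  by rewrite distrC; apply: H2.
Qed.

Lemma cmod_prod_le (a : nat -> C) n :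
  cmod (\prod_(k < n) (1 + a k)) <= expR (\sum_(k < n) cmod (a k)).
Proof.
rewrite cmod_prod.
apply: le_trans (@prod_le_expR (fun k => cmod (a k)) n (fun k => cmod_ge0 _)).
apply: ler_prod => k _; rewrite cmod_ge0 /=.
by apply: le_trans (cmodD _ _) _; rewrite cmod1.
Qed.

(** Consecutive partial products differ by [P k * a k], so the product is a series, and it converges
    absolutely because the partial products are bounded by exp S. *)
Lemma complex_prod_cvg (a : nat -> C) (S : R) :
  (forall n, \sum_(k < n) cmod (a k) <= S) ->
  exists l : C, (\prod_(k < n) (1 + a k) : C^o) @[n --> \oo] --> (l : C^o).
Proof.
move=> aS; pose P n := \prod_(k < n) (1 + a k).
have E n : P n = 1 + \sum_(k < n) (P k * a k).
  elim: n => [|n IH]; first by rewrite /P !big_ord0 addr0.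
  by rewrite /P big_ord_recr /= -/(P n) mulrDr mulr1 {1}IH big_ord_recr /= addrA.
have [l Hl] : exists l : C, (\sum_(k < n) (P k * a k) : C^o) @[n --> \oo] --> (l : C^o).
  apply: (@complex_series_cvg (fun k => P k * a k) (expR S * S)) => n.
  apply: (@le_trans _ _ (expR S * \sum_(k < n) cmod (a k))); last by rewrite ler_wpM2l ?expR_ge0.
  rewrite mulr_sumr; apply: ler_sum => k _; rewrite cmodM ler_wpM2r ?cmod_ge0 //.
  by apply: le_trans (cmod_prod_le _ _) _; rewrite ler_expR.
exists (1 + l); have -> : (fun n => \prod_(k < n) (1 + a k) : C^o) =
    (fun n => (1 : C^o) + (\sum_(k < n) (P k * a k) : C^o)) by apply/funext => n; exact: E.
by apply: cvgD Hl; apply: cvg_cst.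
Qed.

Lemma prod_dist1 (a : nat -> C) n :
  cmod (\prod_(k < n) (1 + a k) - 1) <=
  (\sum_(k < n) cmod (a k)) * expR (\sum_(k < n) cmod (a k)).
Proof.
elim: n => [|n IH]; first by rewrite !big_ord0 subrr cmod0 mul0r.
rewrite !big_ord_recr /=.
have s0 : 0 <= \sum_(k < n) cmod (a k) by apply: sumr_ge0 => k _; apply: cmod_ge0.
have H1 := cmod_prod_le a n; have a0 := cmod_ge0 (a n).
have e1 : expR (\sum_(k < n) cmod (a k)) <= expR (\sum_(k < n) cmod (a k) + cmod (a n)).
  by rewrite ler_expR lerDl.
have -> : \prod_(k < n) (1 + a k) * (1 + a n) - 1 =
   (\prod_(k < n) (1 + a k) - 1) + \prod_(k < n) (1 + a k) * a n by ring.
apply: le_trans (cmodD _ _) _; rewrite mulrDl cmodM; apply: lerD.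
  by apply: le_trans IH _; rewrite ler_wpM2l.
by rewrite mulrC ler_wpM2l // (le_trans H1).
Qed.

Lemma geometric_sum_le (c r : R) n : 0 <= c -> 0 <= r -> r < 1 ->
  \sum_(k < n) c * r ^+ k <= c / (1 - r).
Proof.
move=> c0 r0 r1; have r1' : 0 < 1 - r by rewrite subr_gt0.
rewrite -mulr_sumr ler_wpM2l // -[leRHS]mul1r ler_pdivlMr //.
have -> : (\sum_(k < n) r ^+ k) * (1 - r) = 1 - r ^+ n.
  by have := subrX1 r n; rewrite -!(opprB 1) => /eqP; rewrite mulNr eqr_opp => /eqP ->; rewrite mulrC.
by rewrite gerBl exprn_ge0.
Qed.

Section QPochhammer.
Variable q : C.
Hypothesis q_lt1 : cmod q < 1.

(** The infinite q-Pochhammer symbol (c; q). *)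
Definition qpoch (c : C) : C :=
  lim ((\prod_(k < n) (1 - c * q ^+ k) : C^o) @[n --> \oo]).

Lemma geom_cmod_sum c n : \sum_(k < n) cmod (c * q ^+ k) <= cmod c / (1 - cmod q).
Proof.
rewrite (eq_bigr (fun k : 'I_n => cmod c * cmod q ^+ k)) => [|k _]; last by rewrite cmodM cmodX.
by apply: geometric_sum_le; rewrite ?cmod_ge0.
Qed.

Lemma qpoch_cvg c :
  (\prod_(k < n) (1 - c * q ^+ k) : C^o) @[n --> \oo] --> (qpoch c : C^o).
Proof.
have [|l Hl] := @complex_prod_cvg (fun k => - (c * q ^+ k)) (cmod c / (1 - cmod q)).
  by move=> n; under eq_bigr do rewrite cmodN; apply: geom_cmod_sum.
by rewrite /qpoch (cvg_lim _ Hl) //; exact: norm_hausdorff.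
Qed.

Lemma cmod_qterm c k : cmod (c * q ^+ k) <= cmod c.
Proof.
rewrite cmodM cmodX -[leRHS]mulr1 ler_wpM2l ?cmod_ge0 //.
by rewrite exprn_ile1 ?cmod_ge0 // ltW.
Qed.

Lemma one_sub_qterm_neq0 c k : cmod c < 1 -> 1 - c * q ^+ k != 0.
Proof.
move=> c1; rewrite subr_eq0; apply/eqP => E.
by have := cmod_qterm c k; rewrite -E cmod1 leNgt c1.
Qed.

(** The inverse factors are 1 + x / (1 - x) with x = c q^k, so their product converges as well. The
    two limits multiply to 1, which shows at once that [qpoch c] is nonzero. *)
Lemma qpoch_inv_cvg c : cmod c < 1 -> qpoch c != 0 /\
  ((\prod_(k < n) (1 - c * q ^+ k)^-1 : C^o) @[n --> \oo] --> ((qpoch c)^-1 : C^o)).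
Proof.
move=> c1; pose a k := c * q ^+ k / (1 - c * q ^+ k).
have E k : (1 - c * q ^+ k)^-1 = 1 + a k.
  by have H := one_sub_qterm_neq0 k c1; rewrite /a; field.
have c1' : 0 < 1 - cmod c by rewrite subr_gt0.
have [|l Hl] := @complex_prod_cvg a (cmod c / (1 - cmod q) / (1 - cmod c)).
  move=> n; apply: (@le_trans _ _ (\sum_(k < n) cmod (c * q ^+ k) / (1 - cmod c))).
    apply: ler_sum => k _; rewrite /a cmodM ler_wpM2l ?cmod_ge0 // cmodV.
    have H : 1 - cmod c <= cmod (1 - c * q ^+ k).
      rewrite lerBlDr -{1}(cmod1 R) -{1}(subrK (c * q ^+ k) 1).
      by apply: le_trans (cmodD _ _) _; rewrite lerD2l cmod_qterm.
    by rewrite lef_pV2 // posrE (lt_le_trans c1').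
  by rewrite -mulr_suml ler_wpM2r ?invr_ge0 ?(ltW c1') // geom_cmod_sum.
have H1 : (\prod_(k < n) (1 - c * q ^+ k) * \prod_(k < n) (1 + a k) : C^o) @[n --> \oo]
   --> (qpoch c * l : C^o) by apply: cvgM; [exact: qpoch_cvg | exact: Hl].
have H2 : qpoch c * l = 1.
  have H3 : (\prod_(k < n) (1 - c * q ^+ k) * \prod_(k < n) (1 + a k) : C^o) @[n --> \oo] --> (1 : C^o).
    rewrite (_ : (fun n => _) = (fun=> 1 : C^o)); first exact: cvg_cst.
    apply/funext => n; rewrite -big_split /= big1 // => k _.
    by rewrite -E mulfV // one_sub_qterm_neq0.
  have L1 := cvg_lim (@norm_hausdorff _ _) H1; have L3 := cvg_lim (@norm_hausdorff _ _) H3.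
  by rewrite -L1 L3.
have nz : qpoch c != 0.
  by apply/eqP => z; move: H2; rewrite z mul0r => /esym/eqP; rewrite oner_eq0.
split; first exact: nz.
have e : l = (qpoch c)^-1 by apply: (mulfI nz); rewrite H2 mulfV.
have F : (fun n => \prod_(k < n) (1 - c * q ^+ k)^-1) = (fun n => \prod_(k < n) (1 + a k)).
  by apply/funext => n; apply: eq_bigr => k _; apply: E.
by rewrite -e F.
Qed.

(** Letters and multiplicities are cut off by the same n, as in the boxes of monomials. Each factor
    is (1 - x^n) / (1 - x) with x = c q^k, and the product of the numerators tends to 1 since the
    sum over k of |c q^k|^n is at most |c|^n / (1 - |q|). *)
Lemma qpoch_geom_cvg c : cmod c < 1 ->
  (\prod_(k < n) \sum_(j < n) (c * q ^+ k) ^+ j : C^o) @[n --> \oo] --> ((qpoch c)^-1 : C^o).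
Proof.
move=> c1; have [_ H] := qpoch_inv_cvg c1.
have q1' : 0 < 1 - cmod q by rewrite subr_gt0.
have G : (\prod_(k < n) (1 - (c * q ^+ k) ^+ n) : C^o) @[n --> \oo] --> (1 : C^o).
  have T n : (0 < n)%N -> \sum_(k < n) cmod (- (c * q ^+ k) ^+ n) <= cmod c ^+ n / (1 - cmod q).
    move=> n0; apply: le_trans (geometric_sum_le n _ _ _); rewrite ?cmod_ge0 ?exprn_ge0 ?cmod_ge0 //.
    apply: ler_sum => k _; rewrite cmodN cmodX cmodM cmodX exprMn ler_wpM2l ?exprn_ge0 ?cmod_ge0 //.
    rewrite -exprM; apply: ler_wiXn2l; rewrite ?cmod_ge0 ?(ltW q_lt1) //.
    by rewrite leq_pmulr.
  (* By [prod_dist1] the distance to 1 is at most s exp(s) with s <= |c|^n / (1 - |q|) <= 1 / (1 -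
     |q|), hence at most |c|^n times [B]. *)
  apply/ccvgP => e e0; pose B := expR ((1 - cmod q)^-1) / (1 - cmod q).
  have B0 : 0 < B by rewrite divr_gt0 ?expR_gt0.
  have : (cmod c ^+ n) @[n --> \oo] --> 0 by apply: cvg_expr; rewrite ger0_norm ?cmod_ge0.
  move/cvgrPdist_lt/(_ _ (divr_gt0 e0 B0)) => [N _ HN].
  exists N.+1 => n Nn; have n0 : (0 < n)%N by apply: leq_trans Nn.
  apply: le_lt_trans (prod_dist1 (fun k => - (c * q ^+ k) ^+ n) n) _.
  have := HN n (ltnW Nn); rewrite /= sub0r normrN ger0_norm ?exprn_ge0 ?cmod_ge0 //.
  rewrite ltr_pdivlMr // => /(le_lt_trans _); apply.
  have Tn := T n n0; rewrite /B mulrA mulrAC; apply: ler_pM; rewrite ?expR_ge0 //.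
    by apply: sumr_ge0 => k _; apply: cmod_ge0.
  rewrite ler_expR; apply: le_trans Tn _; rewrite -[leRHS]mul1r ler_wpM2r ?invr_ge0 ?(ltW q1') //.
  by rewrite exprn_ile1 ?cmod_ge0 // ltW.
have : (\prod_(k < n) (1 - (c * q ^+ k) ^+ n) * \prod_(k < n) (1 - c * q ^+ k)^-1 : C^o)
  @[n --> \oo] --> (1 * (qpoch c)^-1 : C^o) by apply: cvgM; [exact: G | exact: H].
rewrite mul1r; have -> // : (fun n => \prod_(k < n) (1 - (c * q ^+ k) ^+ n) * \prod_(k < n) (1 - c * q ^+ k)^-1 : C^o)
  = (fun n => \prod_(k < n) \sum_(j < n) (c * q ^+ k) ^+ j : C^o).
apply/funext => n; rewrite -big_split; apply: eq_bigr => k _ /=.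
have nz := one_sub_qterm_neq0 k c1; apply: (mulIf nz); rewrite mulfVK //.
by rewrite -[1 - _ ^+ n]opprB subrX1 -mulNr opprB mulrC.
Qed.

End QPochhammer.
End InfiniteProducts.

(** * Regrouping an absolutely convergent sum by fibres *)

Section GroupedSum.
Context (R : realType) (X Y : choiceType).
Local Notation C := R[i].
Local Open Scope classical_set_scope.
Variables (f : X -> C) (phi : X -> Y) (D : nat -> seq X) (bnd : Y -> nat).
Variables (t : Y -> C) (S : R) (s : C).
Hypothesis D_uniq : forall M, uniq (D M).
Hypothesis D_mono : forall M M', (M <= M')%N -> {subset D M <= D M'}.
Hypothesis tE : forall y M, (bnd y <= M)%N -> t y = \sum_(x <- D M | phi x == y) f x.
Hypothesis f_bound : forall M, \sum_(x <- D M) cmod (f x) <= S.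
Hypothesis f_cvg : (\sum_(x <- D M) f x : C^o) @[M --> \oo] --> (s : C^o).

Let g M := \sum_(x <- D M) cmod (f x).

Let g_split M M' : (M <= M')%N ->
  g M' = g M + \sum_(x <- D M' | x \notin D M) cmod (f x).
Proof.
move=> MM; rewrite /g (bigID (fun x => x \in D M)) /=; congr (_ + _).
rewrite -big_filter; apply: perm_big; apply: uniq_perm; rewrite ?filter_uniq //.
move=> x; rewrite mem_filter; case: (boolP (x \in D M)) => //= xM.
exact: (D_mono MM).
Qed.

(** The sums of moduli over the boxes are bounded and increasing, so beyond some [D M0] the
    remaining terms of any larger box have total modulus below e/2. A finite set [F] containing the
    values of [phi] on [D M0] omits only such terms. *)
Lemma grouped_has_sum : has_sum t s.
Proof.
move=> e e0; have e2 : 0 < e / 2 by rewrite divr_gt0.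
have g_nd : {homo g : M M' / (M <= M')%N >-> M <= M'}.
  by move=> M M' MM; rewrite (g_split MM) lerDl; apply: sumr_ge0 => x _; apply: cmod_ge0.
have g_ub : has_ubound (range g) by exists S => _ [M _ <-]; apply: f_bound.
have g_cvg : cvgn g by apply: nondecreasing_is_cvgn.
have [N1 _ H1] := (cvgrPdist_lt _ _).1 g_cvg _ e2.
have [N2 H2] := (ccvgP _ _).1 f_cvg _ e2.
pose M0 := maxn N1 N2; exists [fset phi x | x in D M0]%fset => F sF.
(* In this box every fibre over [F] is complete, so [tE] applies. *)
pose M := maxn M0 (\max_(y <- F) bnd y).
have MM : (M0 <= M)%N by apply: leq_maxl.
have -> : \sum_(y <- F) t y = \sum_(x <- D M | phi x \in F) f x.
  rewrite big_seq (eq_bigr (fun y => \sum_(x <- D M | phi x == y) f x)) => [|y yF]; last first.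
    by apply: tE; rewrite leq_max (leq_bigmax_seq _ yF) ?orbT.
  rewrite -big_seq; under eq_bigr do rewrite big_mkcond.
  rewrite exchange_big [RHS]big_mkcond /=; apply: eq_bigr => x _.
  case: ifP => [xF|xF].
    rewrite (big_fsetD1 (phi x)) //= eqxx big_seq big1 ?addr0 // => y.
    by rewrite !inE eq_sym => /andP[/negPf -> _].
  rewrite big_seq big1 // => y yF; case: eqP => // E.
  by move: xF; rewrite E yF.
have E : \sum_(x <- D M | phi x \in F) f x - s =
   (\sum_(x <- D M) f x - s) - \sum_(x <- D M | phi x \notin F) f x.
  by rewrite [\sum_(x <- D M) f x](bigID (fun x => phi x \in F)) /=; ring.
rewrite cmod_lt E; apply: le_lt_trans (cmodD _ _) _; rewrite cmodN [e]splitr.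
apply: ltr_leD.
  by apply: H2; apply: leq_trans MM; apply: leq_maxr.
apply: le_trans (cmod_sum _ _ _) _.
apply: (@le_trans _ _ (g M - g M0)).
  rewrite (g_split MM) addrC addKr [leLHS]big_mkcond [leRHS]big_mkcond /=.
  apply: ler_sum => x _; case: ifP => xF; last by case: ifP; rewrite ?cmod_ge0.
  case: ifP => // /negbFE xM; move: xF; rewrite (fsubsetP sF) //.
  by apply/imfsetP; exists x.
have gl := nondecreasing_cvgn_le g_nd g_cvg M.
have := H1 M0 (leq_maxl _ _); rewrite /= ltr_norml => /andP[_ H3].
by apply: ltW; apply: le_lt_trans H3; rewrite lerD2r.
Qed.

End GroupedSum.

(** * Summation over monomials *)

Lemma prod_double (T : comPzSemiRingType) (G : nat -> T) n :
  \prod_(k < n.*2) G k = (\prod_(k < n) G k.*2) * (\prod_(k < n) G k.*2.+1).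
Proof.
elim: n => [|n IH]; first by rewrite !big_ord0 mulr1.
by rewrite doubleS !big_ord_recr /= IH; ring.
Qed.

Lemma prod_quadruple (T : comPzSemiRingType) (G : nat -> T) n :
  \prod_(k < n * 4) G k = (\prod_(k < n) G (k * 4)%N) * (\prod_(k < n) G (k * 4).+1) *
    (\prod_(k < n) G (k * 4).+2) * (\prod_(k < n) G (k * 4).+3).
Proof.
elim: n => [|n IH]; first by rewrite !big_ord0 !mulr1.
by rewrite mulSn addnC addn4 !big_ord_recr /= IH; ring.
Qed.

Lemma w7_cut_mono M M' : (M <= M')%N -> {subset w7_cut M <= w7_cut M'}.
Proof.
have mono2 N N' s : (N <= N')%N -> s \in cfgs 2 N -> s \in cfgs 2 N'.
  move=> NN; rewrite !mem_cfgs2 => /andP[-> /=]; apply: sub_all => k kN.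
  exact: leq_trans kN NN.
move=> MM _ /allpairsP[[[s1 s2] s3] /= [/allpairsP[[t1 t2] /= [h1 h2 [-> ->]]] h3 ->]].
apply/allpairsP; exists ((t1, t2), s3); split=> //=.
  apply/allpairsP; exists (t1, t2); split=> //=.
    by apply: mono2 h1; rewrite ltnS leq_double.
  by apply: mono2 h2; rewrite leq_double.
(* For M = 0 the multiplicity bound is 0 although the empty word is present, and [cfgs_count] needs
   a positive bound. *)
case: M MM h3 {h1 h2} => [|M] MM h3.
  move: h3; rewrite mul0n inE => /eqP ->.
  by case: M' MM => [|M'] _; [rewrite mul0n inE | apply: mem_cfgs].
apply: mem_cfgs; first exact: cfgs_sorted h3.
  apply: sub_all (cfgs_lt h3) => k kM; apply: leq_trans kM _.
  by rewrite leq_mul2r MM orbT.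
by move=> k; apply: leq_trans (cfgs_count _ _ h3) MM.
Qed.

Section ProductBounds.
Context (R : realType).
Variables (r : R).
Hypotheses (r_ge0 : 0 <= r) (r_lt1 : r < 1).

Lemma prod_geometric_le (c : R) n : 0 <= c ->
  \prod_(k < n) (1 + c * r ^+ k) <= expR (c / (1 - r)).
Proof.
move=> c0; apply: le_trans (@prod_le_expR _ (fun k => c * r ^+ k) n _) _.
  by move=> k; rewrite mulr_ge0 ?exprn_ge0.
by rewrite ler_expR geometric_sum_le.
Qed.

(** The inner sum is at most 1 / (1 - x) = 1 + x / (1 - x) with x = c r^k <= c, hence at most 1 + c
    / (1 - c) r^k. *)
Lemma prod_geom_geom_le (c : R) n m : 0 <= c -> c < 1 ->
  \prod_(k < n) \sum_(j < m) (c * r ^+ k) ^+ j <= expR (c / (1 - c) / (1 - r)).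
Proof.
move=> c0 c1; have c1' : 0 < 1 - c by rewrite subr_gt0.
apply: le_trans (prod_geometric_le n (divr_ge0 c0 (ltW c1'))).
apply: ler_prod => k _; set x := c * r ^+ k.
have x0 : 0 <= x by rewrite mulr_ge0 ?exprn_ge0.
have xc : x <= c by rewrite -[leRHS]mulr1 ler_wpM2l // exprn_ile1 // ltW.
apply/andP; split; first by apply: sumr_ge0 => j _; rewrite exprn_ge0.
have x1 : x < 1 by apply: le_lt_trans c1.
have H := geometric_sum_le m ler01 x0 x1.
apply: (@le_trans _ _ (1 / (1 - x))).
  by apply: le_trans H; apply: ler_sum => j _; rewrite mul1r.
have x1' : 0 < 1 - x by rewrite subr_gt0.
have -> : 1 / (1 - x) = 1 + x / (1 - x) by field; rewrite gt_eqF.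
have E : c / (1 - c) * r ^+ k = x / (1 - c) by rewrite /x mulrAC.
by rewrite lerD2l E ler_wpM2l // lef_pV2 ?posrE // lerD2l lerN2.
Qed.

(** The additive factor from J_e(0) is bounded by 2 to the size, a product over letters, so that
    sums of moduli still factor. *)
Lemma half_add_le (c : nat -> R[i]) s : (forall k, cmod (c k) = 1) ->
  cmod (2^-1 + \sum_(k <- s) c k) <= \prod_(k <- s) 2.
Proof.
move=> c1; have H : cmod (2^-1 + \sum_(k <- s) c k) <= 1 + (size s)%:R.
  apply: le_trans (cmodD _ _) _; apply: lerD.
    by rewrite cmodV (cmod_nat R 2) invf_le1 ?ler1n ?ltr0n.
  apply: le_trans (cmod_sum _ _ _) _; rewrite (eq_bigr (fun=> 1)) => [|k _]; last exact: c1.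
  by rewrite big_const_seq count_predT iter_addr addr0.
apply: le_trans H _; rewrite big_const_seq count_predT iter_mulr mulr1 nat1r -natrX ler_nat.
exact: ltn_expl.
Qed.

End ProductBounds.

Section CharacterSum.
Context (R : realType).
Local Notation C := R[i].
Local Open Scope classical_set_scope.
Variables (q y : C).
Hypotheses (q_lt1 : cmod q < 1) (y_neq0 : y != 0).
Hypotheses (y_gt1 : cmod y^-1 < 1) (yq_lt1 : cmod (y * q) < 1).

Variables (lA : 'I_(2./2) -> C) (lB : 'I_(4./2) -> C).
Hypothesis lB1 : forall i, cmod (lB i) = 1.

(* The eigenvalue of g J_e(0) (-1)^F on the monomial s, when g has           *)
(* eigenvalues lA on a^+ and lB on b^+.                                       *)
Definition w7_eig (s : w7_index) : C :=
  (2^-1 + (pbw_charge s.1.1)%:~R) * (\prod_(k <- s.1.1) -1 * \prod_(k <- s.1.2) -1) *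
  (\prod_(k <- s.1.2) letter_eig h2_gt0 lA k * \prod_(k <- s.2) letter_eig h4_gt0 lB k).

Definition w7_term (s : w7_index) : C :=
  w7_eig s * y ^ (w7_charge s) * q ^+ (w7_weight s).

(** The charge of one letter, and the factor with which one letter of e, a or b enters a term. The
    minus signs come from (-1)^F; no power of y occurs in [wE] because J(0) does not involve e. *)
Let ch (k : nat) : int := (-1) ^+ (~~ odd k).
Let wE (k : nat) : C := - q ^+ (k./2 %/ 2./2 + odd k).
Let wA (k : nat) : C := - (letter_eig h2_gt0 lA k * (y ^ 4) ^ (ch k) * q ^+ (k./2 %/ 2./2 + odd k)).
Let wB (k : nat) : C := letter_eig h4_gt0 lB k * y ^ (ch k) * q ^+ (k./2 %/ 4./2 + odd k).

Let prod_ch (x : C) s : x != 0 -> x ^ (pbw_charge s) = \prod_(k <- s) x ^ (ch k).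
Proof.
move=> x0; rewrite /pbw_charge; elim: s => [|k s IH]; first by rewrite !big_nil.
by rewrite !big_cons expfzDr // IH.
Qed.

Let prod_wt d s : q ^+ (pbw_weight d s) = \prod_(k <- s) q ^+ (k./2 %/ d./2 + odd k).
Proof. by rewrite /pbw_weight prodrXr. Qed.

Lemma w7_term_factor s : w7_term s =
  y * ((2^-1 + \sum_(k <- s.1.1) (ch k)%:~R) * \prod_(k <- s.1.1) wE k)
    * \prod_(k <- s.1.2) wA k * \prod_(k <- s.2) wB k.
Proof.
case: s => [[s1 s2] s3]; rewrite /w7_term /w7_eig /w7_charge /w7_weight /=.
have y4 : y ^ 4 != 0 by rewrite expfz_neq0.
rewrite !expfzDr // expr1z -exprz_exp !prod_ch // !exprD !prod_wt.
have -> : \prod_(k <- s1) wE k = \prod_(k <- s1) -1 * \prod_(k <- s1) q ^+ (k./2 %/ 2./2 + odd k).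
  by rewrite -big_split /=; apply: eq_bigr => k _; rewrite mulN1r.
have -> : \prod_(k <- s2) wA k = \prod_(k <- s2) -1 * \prod_(k <- s2) letter_eig h2_gt0 lA k
   * \prod_(k <- s2) (y ^ 4) ^ (ch k) * \prod_(k <- s2) q ^+ (k./2 %/ 2./2 + odd k).
  by rewrite -!big_split /=; apply: eq_bigr => k _; rewrite /wA mulN1r !mulNr.
rewrite [\prod_(k <- s3) wB k]big_split big_split /=.
rewrite {1}/pbw_charge rmorph_sum /=; ring.
Qed.

Lemma w7_cut_sum (T : comPzSemiRingType) (F1 F2 F3 : seq nat -> T) M :
  \sum_(s <- w7_cut M) (F1 s.1.1 * F2 s.1.2 * F3 s.2) =
  (\sum_(s <- cfgs 2 M.*2.+1) F1 s) * (\sum_(s <- cfgs 2 M.*2) F2 s) *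
  (\sum_(s <- cfgs M (M * 4)) F3 s).
Proof.
rewrite big_allpairs_dep big_allpairs_dep /= -mulrA mulr_suml; apply: eq_bigr => s _.
rewrite mulrCA mulr_suml mulr_sumr; apply: eq_bigr => t _.
by rewrite !mulr_sumr; apply: eq_bigr => u _; ring.
Qed.

(** Letter 0 of e is the zero mode e^-(0), of factor -1 and charge -1. In [big_cfgs_weighted] it
    leaves the constant -(-1) = 1, and the vacuum charge 1/2 drops out. *)
Lemma w7_term_sum M : \sum_(s <- w7_cut M) w7_term s =
  y * (\prod_(k < M.*2) (1 + wE k.+1)) * (\prod_(k < M.*2) (1 + wA k))
   * (\prod_(k < M * 4) \sum_(j < M) wB k ^+ j).
Proof.
under eq_bigr do rewrite w7_term_factor.
rewrite (w7_cut_sum (fun s => y * ((2^-1 + \sum_(k <- s) (ch k)%:~R) * \prod_(k <- s) wE k))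
  (fun s => \prod_(k <- s) wA k) (fun s => \prod_(k <- s) wB k)).
rewrite !big_cfgs -mulr_sumr big_cfgs_weighted; last by rewrite /wE /= expr0.
rewrite /ch /= expr1 mulrN1z opprK mul1r; congr (_ * _ * _).
by apply: eq_bigr => k _; rewrite !big_ord_recl big_ord0 expr0 expr1 addr0.
Qed.

Let wE1 n : wE n.*2.+1 = - (q * q ^+ n).
Proof. by rewrite /wE /= uphalf_double odd_double /= divn1 addn1 exprS. Qed.

Let wE2 n : wE n.*2.+2 = - (q * q ^+ n).
Proof. by rewrite /wE /= doubleK odd_double /= divn1 addn0 exprS. Qed.

Let wA0 n : wA n.*2 = - ((lA ord0)^-1 * y ^- 4 * q ^+ n).
Proof.
rewrite /wA /ch /letter_eig odd_double /= expr1 exprN1 doubleK divn1 addn0.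
by rewrite (_ : Ordinal _ = ord0) //; apply: val_inj; rewrite /= modn1.
Qed.

Let wA1 n : wA n.*2.+1 = - (lA ord0 * y ^+ 4 * q * q ^+ n).
Proof.
rewrite /wA /ch /letter_eig /= odd_double /= expr0 expr1z uphalf_double divn1 addn1.
rewrite (_ : Ordinal _ = ord0); last by apply: val_inj; rewrite /= modn1.
by rewrite exprS mulrA.
Qed.

Let wBE n i : (i < 2)%N -> forall (e : bool),
  wB (n * 4 + i * 2 + e) = (if e then lB (inord i) * y * q else (lB (inord i))^-1 * y^-1) * q ^+ n.
Proof.
move=> i2 e; have o : odd (n * 4 + i * 2 + e) = e.
  by rewrite !oddD !oddM andbF andbF addFb oddb.
have h : (n * 4 + i * 2 + e)./2 = (n * 2 + i)%N by case: (e); lia.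
rewrite /wB /ch /letter_eig o h.
rewrite (_ : Ordinal _ = inord i); last first.
  by apply: val_inj; rewrite /= inordK // modnMDl modn_small.
rewrite divnMDl // (divn_small i2) addn0; case: e {o h} => /=.
  by rewrite expr0 expr1z addn1 exprS; ring.
by rewrite expr1 exprN1 addn0.
Qed.

Let wB0 n : wB (n * 4) = (lB (inord 0))^-1 * y^-1 * q ^+ n.
Proof. by rewrite -(wBE n (isT : 0 < 2)%N false) !addn0. Qed.
Let wB1 n : wB (n * 4).+1 = lB (inord 0) * y * q * q ^+ n.
Proof. by rewrite -(wBE n (isT : 0 < 2)%N true) addn0 addn1. Qed.
Let wB2 n : wB (n * 4).+2 = (lB (inord 1))^-1 * y^-1 * q ^+ n.
Proof. by rewrite -(wBE n (isT : 1 < 2)%N false) addn0 addn2. Qed.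
Let wB3 n : wB (n * 4).+3 = lB (inord 1) * y * q * q ^+ n.
Proof. by rewrite -(wBE n (isT : 1 < 2)%N true) addn2 addn1. Qed.

Definition w7_limit : C :=
  y * qpoch q q ^+ 2 * (qpoch q ((lA ord0)^-1 * y ^- 4) * qpoch q (lA ord0 * y ^+ 4 * q)) *
  ((qpoch q ((lB (inord 0))^-1 * y^-1))^-1 * (qpoch q (lB (inord 0) * y * q))^-1 *
   (qpoch q ((lB (inord 1))^-1 * y^-1))^-1 * (qpoch q (lB (inord 1) * y * q))^-1).

Lemma cmod_lB_neg i : cmod ((lB i)^-1 * y^-1) < 1.
Proof. by rewrite cmodM cmodV lB1 invr1 mul1r. Qed.

Lemma cmod_lB_pos i : cmod (lB i * y * q) < 1.
Proof. by rewrite -mulrA cmodM lB1 mul1r. Qed.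

Lemma w7_term_cvg :
  (\sum_(s <- w7_cut M) w7_term s : C^o) @[M --> \oo] --> (w7_limit : C^o).
Proof.
pose P c n := \prod_(k < n) (1 - c * q ^+ k).
pose Q c n := \prod_(k < n) \sum_(j < n) (c * q ^+ k) ^+ j.
rewrite (_ : (fun M => _) = (fun M => y * (P q M ^+ 2) *
  (P ((lA ord0)^-1 * y ^- 4) M * P (lA ord0 * y ^+ 4 * q) M) *
  (Q ((lB (inord 0))^-1 * y^-1) M * Q (lB (inord 0) * y * q) M *
   Q ((lB (inord 1))^-1 * y^-1) M * Q (lB (inord 1) * y * q) M))).
  have HP c : (P c n : C^o) @[n --> \oo] --> (qpoch q c : C^o) by apply: qpoch_cvg.
  have HQ c : cmod c < 1 -> (Q c n : C^o) @[n --> \oo] --> ((qpoch q c)^-1 : C^o).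
    by move=> c1; apply: qpoch_geom_cvg.
  apply: cvgM.
    apply: cvgM; last by apply: cvgM; apply: HP.
    by apply: cvgM; [exact: cvg_cst | apply: cvgM; apply: HP].
  apply: cvgM; last by apply/HQ/cmod_lB_pos.
  apply: cvgM; last by apply/HQ/cmod_lB_neg.
  by apply: cvgM; [apply/HQ/cmod_lB_neg | apply/HQ/cmod_lB_pos].
apply/funext => M; rewrite w7_term_sum (prod_double (fun k => 1 + wE k.+1)).
rewrite (prod_double (fun k => 1 + wA k)) (prod_quadruple (fun k => \sum_(j < M) wB k ^+ j)).
rewrite /P /Q; congr (_ * _ * _ * _).
- by congr (_ * _); apply: eq_bigr => k _; rewrite ?wE1 ?wE2.
- by congr (_ * _); apply: eq_bigr => k _; rewrite ?wA0 ?wA1.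
- congr (_ * _ * _ * _); apply: eq_bigr => k _; apply: eq_bigr => j _;
  by rewrite ?wB0 ?wB1 ?wB2 ?wB3.
Qed.

(** The moduli factor like the terms themselves once [half_add_le] has replaced the additive factor
    by a factor 2 for each letter of e. The zero mode of e no longer cancels and contributes 1 + 2 =
    3. *)
Lemma w7_term_bound : exists S : R, forall M, \sum_(s <- w7_cut M) cmod (w7_term s) <= S.
Proof.
pose r := cmod q; have r0 : 0 <= r by apply: cmod_ge0.
pose A0 := cmod ((lA ord0)^-1 * y ^- 4); pose A1 := cmod (lA ord0 * y ^+ 4 * q).
pose B i := cmod ((lB i)^-1 * y^-1); pose B' i := cmod (lB i * y * q).
pose X c := expR (c / (1 - r)); pose Z c := X (c / (1 - c)).
exists (cmod y * (3 * (X (2 * r) * X (2 * r))) * (X A0 * X A1) *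
  (Z (B (inord 0)) * Z (B' (inord 0)) * Z (B (inord 1)) * Z (B' (inord 1)))) => M.
have ch1 k : cmod ((ch k)%:~R : C) = 1.
  by rewrite /ch rmorphXn /= rmorphN1 cmodX cmodN cmod1 expr1n.
apply: (@le_trans _ _ (\sum_(s <- w7_cut M)
   ((cmod y * \prod_(k <- s.1.1) (2 * cmod (wE k))) *
   (\prod_(k <- s.1.2) cmod (wA k)) * \prod_(k <- s.2) cmod (wB k)))).
  apply: ler_sum => s _; rewrite w7_term_factor !cmodM !cmod_prod.
  have p0 (f : nat -> C) u : 0 <= \prod_(k <- u) cmod (f k).
    by apply: prodr_ge0 => k _; apply: cmod_ge0.
  rewrite ler_wpM2r // ler_wpM2r // ler_wpM2l ?cmod_ge0 // big_split ler_wpM2r //.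
  exact: half_add_le.
rewrite (w7_cut_sum (fun s => cmod y * \prod_(k <- s) (2 * cmod (wE k)))
  (fun s => \prod_(k <- s) cmod (wA k)) (fun s => \prod_(k <- s) cmod (wB k))).
rewrite !big_cfgs -mulr_sumr big_cfgs.
have two (x : R) : \sum_(j < 2) x ^+ j = 1 + x.
  by rewrite !big_ord_recl big_ord0 expr0 expr1 addr0.
rewrite big_ord_recl !two.
have -> : 1 + 2 * cmod (wE 0) = 3 by rewrite /wE /= expr0 cmodN cmod1; ring.
under eq_bigr do rewrite two; under [X in _ * X * _]eq_bigr do rewrite two.
have pos (x : nat -> R) n : (forall k, 0 <= x k) -> 0 <= \prod_(k < n) (1 + x k).
  by move=> x0; apply: prodr_ge0 => k _; rewrite addr_ge0.
have X0 c : 0 <= X c by apply: expR_ge0.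
have Z0 c : 0 <= Z c by apply: X0.
have sum0 (x : nat -> R) n m : (forall k, 0 <= x k) -> 0 <= \prod_(k < n) \sum_(j < m) x k ^+ j.
  by move=> x0; apply: prodr_ge0 => k _; apply: sumr_ge0 => j _; apply: exprn_ge0.
have PX c n : 0 <= c -> \prod_(k < n) (1 + c * r ^+ k) <= X c.
  by move=> c0; apply: prod_geometric_le.
have PZ c n m : 0 <= c -> c < 1 -> \prod_(k < n) \sum_(j < m) (c * r ^+ k) ^+ j <= Z c.
  by move=> c0 c1; apply: prod_geom_geom_le.
have EP : \prod_(i < M.*2) (1 + 2 * cmod (wE (lift ord0 i))) <= X (2 * r) * X (2 * r).
  rewrite (prod_double (fun k => 1 + 2 * cmod (wE k.+1))).
  under eq_bigr do rewrite wE1 cmodN cmodM cmodX mulrA.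
  under [X in _ * X <= _]eq_bigr do rewrite wE2 cmodN cmodM cmodX mulrA.
  have r2 : 0 <= 2 * r by rewrite mulr_ge0.
  have H0 : 0 <= \prod_(i < M) (1 + 2 * cmod q * cmod q ^+ i).
    by apply: (pos (fun k => 2 * cmod q * cmod q ^+ k)) => k; rewrite mulr_ge0 ?exprn_ge0.
  by apply: ler_pM => //; apply: PX.
have AP : \prod_(i < M.*2) (1 + cmod (wA i)) <= X A0 * X A1.
  rewrite (prod_double (fun k => 1 + cmod (wA k))).
  under eq_bigr do rewrite wA0 cmodN cmodM cmodX.
  under [X in _ * X <= _]eq_bigr do rewrite wA1 cmodN cmodM cmodX.
  have P0 c : 0 <= \prod_(i < M) (1 + cmod c * cmod q ^+ i).
    by apply: prodr_ge0 => k _; rewrite addr_ge0 // mulr_ge0 ?exprn_ge0 ?cmod_ge0.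
  by apply: ler_pM => //; apply: PX; apply: cmod_ge0.
have BP : \prod_(k < M * 4) \sum_(j < M) cmod (wB k) ^+ j <=
    Z (B (inord 0)) * Z (B' (inord 0)) * Z (B (inord 1)) * Z (B' (inord 1)).
  rewrite (prod_quadruple (fun k => \sum_(j < M) cmod (wB k) ^+ j)).
  have Q0 (u : nat -> C) : 0 <= \prod_(k < M) \sum_(j < M) cmod (u k) ^+ j.
    by apply: (sum0 (fun k => cmod (u k))) => k; apply: cmod_ge0.
  have QZ c (u : nat -> C) : cmod c < 1 -> (forall k, u k = c * q ^+ k) ->
      \prod_(k < M) \sum_(j < M) cmod (u k) ^+ j <= Z (cmod c).
    move=> c1 uE; apply: le_trans (PZ (cmod c) M M (cmod_ge0 _) c1).
    by under eq_bigr do under eq_bigr do rewrite uE cmodM (cmodX q).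
  have HB i := cmod_lB_neg i; have HB' i := cmod_lB_pos i.
  have [q0 q1] := (Q0 (fun k => wB (k * 4)%N), Q0 (fun k => wB (k * 4).+1)).
  have [q2 q3] := (Q0 (fun k => wB (k * 4).+2), Q0 (fun k => wB (k * 4).+3)).
  apply: ler_pM; rewrite ?mulr_ge0 ?q0 ?q1 ?q2 ?q3 //; last exact: QZ wB3.
  apply: ler_pM; rewrite ?mulr_ge0 ?q0 ?q1 ?q2 //; last exact: QZ wB2.
  apply: ler_pM; rewrite ?q0 ?q1 //.
    exact: QZ wB0.
  exact: QZ wB1.
have E0 : 0 <= \prod_(i < M.*2) (1 + 2 * cmod (wE (lift ord0 i))).
  by apply: prodr_ge0 => k _; rewrite addr_ge0 // mulr_ge0 ?cmod_ge0.
have Ap0 : 0 <= \prod_(i < M.*2) (1 + cmod (wA i)).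
  by apply: prodr_ge0 => k _; rewrite addr_ge0 ?cmod_ge0.
have Bp0 : 0 <= \prod_(k < M * 4) \sum_(j < M) cmod (wB k) ^+ j.
  by apply: (sum0 (fun k => cmod (wB k))) => k; apply: cmod_ge0.
apply: ler_pM => //; first by rewrite !mulr_ge0 ?cmod_ge0.
apply: ler_pM => //; first by rewrite !mulr_ge0 ?cmod_ge0.
by rewrite ler_wpM2l ?cmod_ge0 // ler_wpM2l.
Qed.

End CharacterSum.

(** * Theta functions *)

Section Theta.
Context (R : realType).
Local Notation C := R[i].
Local Notation ii := ('i%C : C).

Lemma cexpD (a b : C) : cexp (a + b) = cexp a * cexp b.
Proof.
case: a b => [a a'] [b b']; rewrite /cexp /= expRD cosD sinD.
by apply/eqP; rewrite eq_complex /=; apply/andP; split; apply/eqP; ring.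
Qed.

Lemma cexp0 : cexp (0 : C) = 1.
Proof. by rewrite /cexp /= expR0 cos0 sin0 mulr0 mulr1. Qed.

Lemma e2piD (a b : C) : e2pi (a + b) = e2pi a * e2pi b.
Proof. by rewrite /e2pi mulrDr cexpD. Qed.

Lemma e2pi0 : e2pi (0 : C) = 1.
Proof. by rewrite /e2pi mulr0 cexp0. Qed.

Lemma e2piVM (a : C) : e2pi (- a) * e2pi a = 1.
Proof. by rewrite -e2piD addNr e2pi0. Qed.

Lemma e2pi_neq0 (a : C) : e2pi a != 0.
Proof.
by apply/eqP => e; have := e2piVM a; rewrite e mulr0 => /esym/eqP; rewrite oner_eq0.
Qed.

Lemma e2piN (a : C) : e2pi (- a) = (e2pi a)^-1.
Proof. by apply: (mulIf (e2pi_neq0 a)); rewrite e2piVM mulVf ?e2pi_neq0. Qed.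

Lemma e2piX (a : C) n : e2pi (n%:R * a) = e2pi a ^+ n.
Proof.
elim: n => [|n IH]; first by rewrite mul0r e2pi0.
by rewrite -natr1 mulrDl mul1r e2piD IH exprSr.
Qed.

Lemma e2piE (a : C) : e2pi a = cexp (Complex (- (2 * pi * complex.Im a)) (2 * pi * complex.Re a)).
Proof.
rewrite /e2pi; congr cexp; case: a => a b.
apply/eqP; rewrite eq_complex /=; apply/andP; split; apply/eqP; ring.
Qed.

Lemma cmod_e2pi (a : C) : cmod (e2pi a) = expR (- (2 * pi * complex.Im a)).
Proof.
apply: RC_inj; rewrite /= -cmodE e2piE normc_def /cexp /=; congr (_%:C%C).
by rewrite !exprMn -mulrDr cos2Dsin2 mulr1 sqrtr_sqr ger0_norm ?expR_ge0.
Qed.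

Lemma e2pi_real (x : R) : e2pi (x%:C%C) = Complex (cos (2 * pi * x)) (sin (2 * pi * x)).
Proof. by rewrite e2piE /cexp /= mulr0 oppr0 expR0 !mul1r. Qed.

Lemma e2pi_half : e2pi (1 / 2 : C) = -1.
Proof.
have -> : (1 / 2 : C) = (2^-1)%:C%C by rewrite fmorphV rmorph_nat div1r.
rewrite e2pi_real mulrAC divff ?pnatr_eq0 // mul1r cospi sinpi.
by apply/eqP; rewrite eq_complex /= oppr0 !eqxx.
Qed.

Lemma e2pi_quarter : e2pi (1 / 4 : C) = ii.
Proof.
have -> : (1 / 4 : C) = (4^-1)%:C%C by rewrite fmorphV rmorph_nat div1r.
rewrite e2pi_real (_ : 2 * pi * 4^-1 = pi / 2); last by field.
by rewrite cos_pihalf sin_pihalf.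
Qed.

(** A cube root of unity other than 1 is a root of w^2 + w + 1; the positive sine of 2 pi / 3
    selects the one in the upper half plane. *)
Lemma e2pi_third : e2pi (1 / 3 : C) = b3 R.
Proof.
set w := e2pi _.
have w3 : w ^+ 3 = 1.
  have := e2piX (1 / 3) 3; rewrite -/w => <-.
  by rewrite (_ : 3%:R * (1 / 3) = 1 / 2 + 1 / 2 :> C) ?e2piD ?e2pi_half ?mulrNN ?mulr1 //; field.
have wim : 0 < complex.Im w.
  rewrite /w (_ : (1 / 3 : C) = (3^-1)%:C%C) ?e2pi_real /=; last by rewrite fmorphV rmorph_nat div1r.
  have p0 := pi_gt0 R; apply: sin_gt0_pi; apply/andP; split; nra.
have w1 : w - 1 != 0.
  by apply/eqP => E; move: wim; have -> : w = 1 by [apply/eqP; rewrite -subr_eq0 E]; rewrite /= ltxx.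
have w2 : w ^+ 2 + w + 1 = 0.
  by apply: (mulfI w1); rewrite mulr0; apply/eqP; move: w3 => /eqP; rewrite -subr_eq0 => /eqP E;
     apply/eqP; rewrite -[RHS]E; ring.
move: w2 wim; case: w {w3 w1} => a b /eqP; rewrite eq_complex /= => /andP[/eqP E1 /eqP E2] b0.
have a2 : a = - 2^-1.
  have : b * (2 * a + 1) = 0 by rewrite -[RHS]E2; ring.
  by move/eqP; rewrite mulf_eq0 gt_eqF //= => /eqP; lra.
have b2 : b ^+ 2 = (Num.sqrt 3 / 2) ^+ 2.
  rewrite exprMn sqr_sqrtr // exprVn; move: E1; rewrite a2; lra.
have bE : b = Num.sqrt 3 / 2.
  by apply/eqP; rewrite -(@eqrXn2 _ 2) ?b2 // ?ltW // divr_ge0 ?sqrtr_ge0.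
have two : 2 != 0 :> C by rewrite pnatr_eq0.
rewrite a2 bE; apply: (mulIf two); rewrite /b3 mulfVK // mulr_natr mulr2n.
by apply/eqP; rewrite eq_complex /=; apply/andP; split; apply/eqP; field.
Qed.

Lemma e2pi_sixth : e2pi (1 / 6 : C) = - (b3 R)^-1.
Proof.
have nz := e2pi_neq0 (1 / 3 : C); rewrite -e2pi_third.
apply: (mulIf nz); rewrite mulNr mulVf // -e2piD.
by rewrite (_ : 1 / 6 + 1 / 3 = 1 / 2) ?e2pi_half //; field.
Qed.

Lemma b3_cube : b3 R ^+ 3 = 1.
Proof.
rewrite -e2pi_third -e2piX (_ : 3%:R * (1 / 3) = 1 / 2 + 1 / 2 :> C); last by field.
by rewrite e2piD e2pi_half mulrNN mulr1.
Qed.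

Lemma b3_sum : b3 R ^+ 2 + b3 R + 1 = 0.
Proof.
have i2 : ii ^+ 2 = -1.
  by rewrite expr2; apply/eqP; rewrite eq_complex /=; apply/andP; split; apply/eqP; ring.
have s3 : ((Num.sqrt (3 : R))%:C%C : C) ^+ 2 = 3.
  by rewrite -rmorphXn /= sqr_sqrtr // rmorph_nat.
have two : 2 != 0 :> C by rewrite pnatr_eq0.
have four : 4 != 0 :> C by rewrite pnatr_eq0.
have E : b3 R * 2 = -1 + ii * (Num.sqrt (3 : R))%:C%C by rewrite /b3 mulfVK.
apply: (mulIf four); rewrite mul0r.
have -> : (b3 R ^+ 2 + b3 R + 1) * 4 = (b3 R * 2) ^+ 2 + 2 * (b3 R * 2) + 4 by ring.
rewrite E; move: (Num.sqrt _)%:C%C s3 ii i2 => s s3 j j2.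
have -> : (-1 + j * s) ^+ 2 + 2 * (-1 + j * s) + 4 = j ^+ 2 * s ^+ 2 + 3 by ring.
by rewrite j2 s3 mulN1r addNr.
Qed.

Lemma b3_neq0 : b3 R != 0.
Proof. by rewrite -e2pi_third e2pi_neq0. Qed.

Lemma cmod_b3 : cmod (b3 R) = 1.
Proof.
have := congr1 (@cmod R) b3_cube; rewrite cmodX cmod1 => /eqP.
by rewrite pexpr_eq1 ?cmod_ge0 // => /eqP.
Qed.

Lemma infprod_cvg (f : nat -> C) (l : C) :
  ((\prod_(k < m) f k.+1 : C^o) @[m --> \oo] --> (l : C^o))%classic -> infprod f = l.
Proof.
have -> : (fun m => \prod_(k < m) f k.+1 : C^o) = (fun m => \prod_(1 <= n < m.+1) f n : C^o).
  by apply/funext => m; rewrite big_add1 big_mkord.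
by move=> H; rewrite /infprod (cvg_lim _ H) //; exact: norm_hausdorff.
Qed.

Section Nome.
Variables (q : C).
Hypothesis q_lt1 : cmod q < 1.

Lemma infprod_eta : infprod (fun n => 1 - q ^+ n) = qpoch q q.
Proof.
apply: infprod_cvg; have := qpoch_cvg q_lt1 (c := q).
by under eq_fun do under eq_bigr do rewrite -exprS.
Qed.

Lemma infprod_theta (a b : C) :
  infprod (fun n => (1 - a * q ^+ n.-1) * (1 - b * q ^+ n) * (1 - q ^+ n)) =
  qpoch q a * qpoch q (b * q) * qpoch q q.
Proof.
apply: infprod_cvg => /=.
rewrite (_ : (fun m => _) = (fun m => (\prod_(k < m) (1 - a * q ^+ k)) *
  (\prod_(k < m) (1 - (b * q) * q ^+ k)) * (\prod_(k < m) (1 - q * q ^+ k)) : C^o)).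
  by apply: cvgM; [apply: cvgM|]; apply: qpoch_cvg.
by apply/funext => m; rewrite -!big_split /=; apply: eq_bigr => k _; rewrite !exprS mulrA.
Qed.

(** The theta function without its prefactor and without the product of the 1 - q^n. *)
Definition theta_prod (y : C) : C := qpoch q y^-1 * qpoch q (y * q).

Lemma theta_prod_neq0 y : cmod y^-1 < 1 -> cmod (y * q) < 1 -> theta_prod y != 0.
Proof.
by move=> y1 y2; rewrite mulf_neq0 // (qpoch_inv_cvg q_lt1 _).1.
Qed.

Lemma qpoch_unique c (l : C) :
  ((\prod_(k < n) (1 - c * q ^+ k) : C^o) @[n --> \oo] --> (l : C^o))%classic -> qpoch q c = l.
Proof. by move=> H; rewrite /qpoch (cvg_lim _ H) //; exact: norm_hausdorff. Qed.

End Nome.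

Lemma cmodX_lt1 (q : C) n : cmod q < 1 -> cmod (q ^+ n.+1) < 1.
Proof. by move=> q1; rewrite cmodX exprn_ilt1 ?cmod_ge0. Qed.

(** Holds factor by factor: 1 - x^3 = (1 - x) (1 - w x) (1 - w^-1 x) with x = c q^k. *)
Lemma qpoch_cube (q c w : C) : cmod q < 1 -> w ^+ 3 = 1 -> w ^+ 2 + w + 1 = 0 ->
  qpoch (q ^+ 3) (c ^+ 3) = qpoch q c * qpoch q (w * c) * qpoch q (w^-1 * c).
Proof.
move=> q1 w3 ws; apply: qpoch_unique.
have w0 : w != 0 by apply/eqP => z; move: w3; rewrite z expr0n /= => /esym/eqP; rewrite oner_eq0.
have wV : w^-1 = w ^+ 2 by apply: (mulIf w0); rewrite mulVf // -exprSr w3.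
rewrite (_ : (fun n => _) = (fun n => (\prod_(k < n) (1 - c * q ^+ k)) *
  (\prod_(k < n) (1 - (w * c) * q ^+ k)) * (\prod_(k < n) (1 - (w^-1 * c) * q ^+ k)) : C^o)).
  by apply: cvgM; [apply: cvgM|]; apply: qpoch_cvg.
apply/funext => m; rewrite -!big_split /=; apply: eq_bigr => k _.
rewrite wV exprAC -exprMn -!mulrA; move: (c * q ^+ k) => x.
have -> : (1 - x) * ((1 - w * x) * (1 - w * (w * x))) =
  (1 - x) * (1 + x - (w ^+ 2 + w + 1) * x + w ^+ 3 * x ^+ 2) by ring.
by rewrite ws w3; ring.
Qed.

Lemma qpoch_square (q c : C) : cmod q < 1 ->
  qpoch (q ^+ 2) (c ^+ 2) = qpoch q c * qpoch q (- c).
Proof.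
move=> q1; apply: qpoch_unique.
rewrite (_ : (fun n => _) = (fun n => (\prod_(k < n) (1 - c * q ^+ k)) *
  (\prod_(k < n) (1 - (- c) * q ^+ k)) : C^o)).
  by apply: cvgM; apply: qpoch_cvg.
apply/funext => m; rewrite -!big_split /=; apply: eq_bigr => k _.
by rewrite exprAC -exprMn mulNr; move: (c * q ^+ k) => x; ring.
Qed.

Lemma theta_prod_cube (q y w : C) : cmod q < 1 -> w ^+ 3 = 1 -> w ^+ 2 + w + 1 = 0 ->
  theta_prod (q ^+ 3) (y ^+ 3) =
  theta_prod q y * theta_prod q (w * y) * theta_prod q (w^-1 * y).
Proof.
move=> q1 w3 ws; rewrite /theta_prod -exprVn -exprMn !(qpoch_cube _ q1 w3 ws).
by rewrite !invfM invrK !mulrA; ring.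
Qed.

Lemma theta_prod_square (q y : C) : cmod q < 1 ->
  theta_prod (q ^+ 2) (y ^+ 2) = theta_prod q y * theta_prod q (- y).
Proof.
move=> q1; rewrite /theta_prod -exprVn -exprMn !(qpoch_square _ q1).
by rewrite invrN mulNr; ring.
Qed.

Lemma theta_prod_cube1 (q y w : C) : cmod q < 1 -> w ^+ 3 = 1 -> w ^+ 2 + w + 1 = 0 ->
  theta_prod (q ^+ 3) (y ^+ 3) =
  theta_prod q (1 * y) * theta_prod q (w * y) * theta_prod q (w^-1 * y).
Proof. by move=> q1 w3 ws; rewrite mul1r; apply: theta_prod_cube. Qed.

Lemma theta_prod_cubeN (q y w : C) : cmod q < 1 -> w ^+ 3 = 1 -> w ^+ 2 + w + 1 = 0 ->
  theta_prod (q ^+ 3) (- y ^+ 3) =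
  theta_prod q (-1 * y) * theta_prod q (- w * y) * theta_prod q (- w^-1 * y).
Proof.
move=> q1 w3 ws; have -> : - y ^+ 3 = (- y) ^+ 3 by rewrite exprNn -signr_odd /= expr1 mulN1r.
by rewrite (theta_prod_cube _ q1 w3 ws) !mulrN mulN1r !mulNr.
Qed.

Lemma theta_prod_squarei (q y j : C) : cmod q < 1 -> j * j = -1 ->
  theta_prod (q ^+ 2) (- y ^+ 2) = theta_prod q (j * y) * theta_prod q (- j * y).
Proof.
move=> q1 j2; have -> : - y ^+ 2 = (j * y) ^+ 2 by rewrite exprMn [j ^+ 2]j2 mulN1r.
by rewrite (theta_prod_square _ q1) mulNr.
Qed.

(** * The identities for psi as identities of rational functions *)

Section Algebra.
Variables (j A B y P T0 T1 T2 X X' u v : C).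
Hypotheses (j2 : j * j = -1) (j0 : j != 0) (A0 : A != 0) (B0 : B != 0) (yB : y = B ^+ 2).
Hypotheses (P0 : P != 0) (T00 : T0 != 0) (T10 : T1 != 0) (T20 : T2 != 0).

(** With e(x) = exp(2 pi i x), the variables stand for j = i, A = e(tau/24), B = e(z/2), u = e(1/6)
    and v = e(1/12). [P] is the product of the 1 - q^n and [P'] its analogue at q^2 or q^3; [T0],
    [T1], [T2] are theta products at multiples of y, [X] and [X'] at multiples of y^4. *)
Lemma algebra_1A : 2 * j * (A * P) ^+ 3 * (- j * A ^+ 3 * B ^+ 4 * (X * P))
    / (- j * A ^+ 3 * B * (T0 * P)) ^+ 2 =
  - (y * P ^+ 2 * X / (T0 * T0) + y * P ^+ 2 * X / (T0 * T0)).
Proof.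
(* [field] does not know the relation for [j], so j is isolated in the form j * j before [j2] is
   applied. *)
rewrite yB (_ : _ / _ = (- (j * j)) * 2 * (B ^+ 2 * P ^+ 2 * X / T0 ^+ 2) / (j * j)).
  by rewrite j2; field.
by field; rewrite T00 P0 A0 B0 j0.
Qed.

Lemma algebra_2A : - 2 * j * (A * P) ^+ 3 * (- j * A ^+ 3 * B ^+ 4 * (X * P))
    / (A ^+ 3 * B * (T0 * P)) ^+ 2 =
  - (y * P ^+ 2 * X / (T0 * T0) + y * P ^+ 2 * X / (T0 * T0)).
Proof.
rewrite yB (_ : _ / _ = (j * j) * 2 * (B ^+ 2 * P ^+ 2 * X / T0 ^+ 2)).
  by rewrite j2; field.
by field; rewrite T00 P0 A0 B0.
Qed.

Variable P' : C.
Hypothesis P'0 : P' != 0.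

Lemma algebra_4A : - 2 * j * (A * P) * (A ^+ 2 * P') * (- j * A ^+ 3 * B ^+ 4 * (X * P))
    / (A ^+ 6 * B ^+ 2 * (T1 * T2 * P')) =
  - (y * P ^+ 2 * X / (T1 * T2) + y * P ^+ 2 * X / (T2 * T1)).
Proof.
rewrite yB (_ : _ / _ = (j * j) * 2 * (B ^+ 2 * P ^+ 2 * X / (T1 * T2))).
  by rewrite j2; field; rewrite T10 T20.
by field; rewrite T10 T20 P'0 A0 B0.
Qed.

Hypotheses (u0 : u != 0) (v0 : v != 0).

Lemma algebra_3A : - j * (A ^+ 3 * P' / (- j * A ^+ 9 * B ^+ 3 * (T0 * T1 * T2 * P'))) *
   ((- j * A ^+ 3 * (B ^+ 4 * u) * (X * P)) * (- j * A ^+ 3 * (B * u^-1) * (T2 * P)) +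
    (- j * A ^+ 3 * (B ^+ 4 * u^-1) * (X' * P)) * (- j * A ^+ 3 * (B * u) * (T1 * P))) =
  - (y * P ^+ 2 * X / (T0 * T1) + y * P ^+ 2 * X' / (T0 * T2)).
Proof.
rewrite yB (_ : - j * _ * _ = (j * j) * (B ^+ 2 * P ^+ 2 * (X * T2 + X' * T1) / (T0 * T1 * T2))).
  by rewrite j2; field; rewrite T00 T10 T20.
by field; rewrite T00 T10 T20 P'0 u0 A0 B0 j0.
Qed.

(** The phases of the two terms are u v = j and its inverse -j, which turns the difference of theta
    products into a sum. *)
Lemma algebra_6A : u * v = j ->
  - j * (A ^+ 3 * P' / (A ^+ 9 * B ^+ 3 * (T0 * T1 * T2 * P'))) *
   ((- j * A ^+ 3 * (B ^+ 4 * u) * (X * P)) * (- j * A ^+ 3 * (B * v) * (T2 * P)) -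
    (- j * A ^+ 3 * (B ^+ 4 * u^-1) * (X' * P)) * (- j * A ^+ 3 * (B * v^-1) * (T1 * P))) =
  - (y * P ^+ 2 * X' / (T0 * T2) + y * P ^+ 2 * X / (T0 * T1)).
Proof.
move=> uv; have jE : u = j / v by rewrite -uv mulfK.
rewrite yB jE.
rewrite (_ : - j * _ * _ = (j * j) * (B ^+ 2 * P ^+ 2 * (- (j * j) * X * T2 + X' * T1) / (T0 * T1 * T2))).
  by rewrite j2; field; rewrite T00 T10 T20.
by field; rewrite T00 T10 T20 P'0 v0 A0 B0 j0.
Qed.

End Algebra.

Section Congruences.
(* The factors are replaced through these equations over variables because   *)
(* rewriting would compare distinct values of e2pi by conversion.            *)
Variables (e e' t t' a1 a1' a2 a2' a3 a3' a4 a4' j : C).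

Lemma congr_12A k : e = e' -> a1 = a1' -> t = t' ->
  k * j * e ^+ 3 * a1 / t ^+ 2 = k * j * e' ^+ 3 * a1' / t' ^+ 2.
Proof. by move=> -> -> ->. Qed.

Lemma congr_4A : e = e' -> a2 = a2' -> a1 = a1' -> t = t' ->
  - 2 * j * e * a2 * a1 / t = - 2 * j * e' * a2' * a1' / t'.
Proof. by move=> -> -> -> ->. Qed.

Lemma congr_3A : e = e' -> t = t' -> a1 = a1' -> a2 = a2' -> a3 = a3' -> a4 = a4' ->
  - j * (e / t) * (a1 * a2 + a3 * a4) = - j * (e' / t') * (a1' * a2' + a3' * a4').
Proof. by move=> -> -> -> -> -> ->. Qed.

Lemma congr_6A : e = e' -> t = t' -> a1 = a1' -> a2 = a2' -> a3 = a3' -> a4 = a4' ->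
  - j * (e / t) * (a1 * a2 - a3 * a4) = - j * (e' / t') * (a1' * a2' - a3' * a4').
Proof. by move=> -> -> -> -> -> ->. Qed.

End Congruences.

Lemma eta_e2pi (tau : C) : cmod (e2pi tau) < 1 ->
  Defs.eta tau = e2pi (tau / 24) * qpoch (e2pi tau) (e2pi tau).
Proof. by move=> q1; rewrite /Defs.eta; congr (_ * _); exact: infprod_eta. Qed.

Lemma theta1_e2pi (tau z : C) : cmod (e2pi tau) < 1 ->
  theta1 tau z = - ii * e2pi (tau / 8) * e2pi (z / 2) *
    (theta_prod (e2pi tau) (e2pi z) * qpoch (e2pi tau) (e2pi tau)).
Proof. by move=> q1; rewrite /theta1; congr (_ * _); exact: infprod_theta. Qed.

Lemma theta2_e2pi (tau z : C) : cmod (e2pi tau) < 1 ->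
  theta2 tau z = e2pi (tau / 8) * e2pi (z / 2) *
    (theta_prod (e2pi tau) (- e2pi z) * qpoch (e2pi tau) (e2pi tau)).
Proof.
move=> q1; rewrite /theta2 /theta_prod invrN -infprod_theta //.
by congr (_ * infprod _); apply/funext => n; rewrite !mulNr !opprK.
Qed.

(** * The functions psi as sums of two twined products *)

Section Match.
Variables (tau z : C).
Hypothesis tau_gt0 : 0 < complex.Im tau.
Hypothesis z_lt0 : 0 < - complex.Im z.
Hypothesis z_tau : - complex.Im z < complex.Im tau.
Local Notation q := (e2pi tau).
Local Notation y := (e2pi z).
Local Notation Th := (theta_prod q).
Local Notation w := (b3 R).

Lemma nome_lt1 : cmod q < 1.
Proof. by rewrite cmod_e2pi -expR0 ltr_expR oppr_lt0 mulr_gt0 // mulr_gt0 ?pi_gt0. Qed.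

Lemma ellV_lt1 : cmod y^-1 < 1.
Proof.
rewrite -e2piN cmod_e2pi -expR0 ltr_expR oppr_lt0 mulr_gt0 ?mulr_gt0 ?pi_gt0 //.
by rewrite raddfN.
Qed.

Lemma ell_nome_lt1 : cmod (y * q) < 1.
Proof.
rewrite -e2piD cmod_e2pi -expR0 ltr_expR oppr_lt0 mulr_gt0 ?mulr_gt0 ?pi_gt0 //.
by rewrite raddfD /= -ltrBlDl sub0r.
Qed.

(** A factor [l] of modulus one preserves the two inequalities |y^-1| < 1 and |y q| < 1 of the
    domain, so no denominator vanishes there. *)
Lemma Th_neq0 (l : C) : cmod l = 1 -> Th (l * y) != 0.
Proof.
move=> l1; apply: theta_prod_neq0; first exact: nome_lt1.
  by rewrite invfM cmodM cmodV l1 invr1 mul1r ellV_lt1.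
by rewrite -mulrA cmodM l1 mul1r ell_nome_lt1.
Qed.

(* The series of g alone, for g with eigenvalue chi on a^+ and l1, l2 on b^+. *)
Definition twined (chi l1 l2 : C) : C :=
  y * qpoch q q ^+ 2 * Th (chi * y ^+ 4) / (Th (l1 * y) * Th (l2 * y)).

Lemma qpochqq_neq0 n : qpoch (q ^+ n.+1) (q ^+ n.+1) != 0.
Proof. by apply: (qpoch_inv_cvg _ _).1; apply: cmodX_lt1; apply: nome_lt1. Qed.

Let A := e2pi (tau / 24).
Let B := e2pi (z / 2).

Let A8 : e2pi (tau / 8) = A ^+ 3.
Proof. by rewrite -e2piX; congr e2pi; field. Qed.

Let yB : y = B ^+ 2.
Proof. by rewrite -e2piX; congr e2pi; field. Qed.

Let mulq n : e2pi (n%:R * tau) = q ^+ n. Proof. exact: e2piX. Qed.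
Let muly n : e2pi (n%:R * z) = y ^+ n. Proof. exact: e2piX. Qed.

Let A0 : A != 0. Proof. exact: e2pi_neq0. Qed.
Let B0 : B != 0. Proof. exact: e2pi_neq0. Qed.
Let i0 : ii != 0. Proof. by rewrite eq_complex /= oner_eq0 andbF. Qed.
Let ii2 : ii * ii = -1.
Proof. by apply/eqP; rewrite eq_complex /=; apply/andP; split; apply/eqP; ring. Qed.

Let cmod1' : cmod (1 : C) = 1. Proof. exact: cmod1. Qed.

Let e1 (n : nat) a : a = n%:R * (tau / 24) -> e2pi a = A ^+ n.
Proof. by move=> ->; rewrite e2piX. Qed.

Let e2 (n : nat) a c : a = n%:R * (z / 2) + c -> e2pi a = B ^+ n * e2pi c.
Proof. by move=> ->; rewrite e2piD e2piX. Qed.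

Let e2' (n : nat) a c : a = n%:R * (z / 2) - c -> e2pi a = B ^+ n * (e2pi c)^-1.
Proof. by move=> ->; rewrite e2piD e2piX e2piN. Qed.

Let Q2_lt1 : cmod (e2pi (2 * tau)) < 1.
Proof. by rewrite (mulq 2); exact: cmodX_lt1 nome_lt1. Qed.

Let Q3_lt1 : cmod (e2pi (3 * tau)) < 1.
Proof. by rewrite (mulq 3); exact: cmodX_lt1 nome_lt1. Qed.

Let P1_neq0 : qpoch q q != 0. Proof. exact: (qpochqq_neq0 0). Qed.
Let P2_neq0 : qpoch (q ^+ 2) (q ^+ 2) != 0. Proof. exact: (qpochqq_neq0 1). Qed.
Let P3_neq0 : qpoch (q ^+ 3) (q ^+ 3) != 0. Proof. exact: (qpochqq_neq0 2). Qed.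

Let eta1 : Defs.eta tau = A * qpoch q q.
Proof. exact: eta_e2pi nome_lt1. Qed.

Let eta_mul n : Defs.eta (n.+1%:R * tau) = A ^+ n.+1 * qpoch (q ^+ n.+1) (q ^+ n.+1).
Proof.
have Q : cmod (e2pi (n.+1%:R * tau)) < 1 by rewrite mulq; exact: cmodX_lt1 nome_lt1.
by rewrite (eta_e2pi Q) mulq; congr (_ * _); apply: e1; rewrite mulrA.
Qed.

Let th1_4 : theta1 tau (4 * z) = - ii * A ^+ 3 * B ^+ 4 * (Th (1 * y ^+ 4) * qpoch q q).
Proof.
rewrite (theta1_e2pi _ nome_lt1) A8 (muly 4) mul1r (_ : 4 * z / 2 = 4%:R * (z / 2)) ?e2piX //.
by rewrite mulrA.
Qed.

Let th1_third : theta1 tau (4 * z + 1 / 3) =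
  - ii * A ^+ 3 * (B ^+ 4 * e2pi (1 / 6)) * (Th (w * y ^+ 4) * qpoch q q).
Proof.
rewrite (theta1_e2pi _ nome_lt1) A8 e2piD (muly 4) e2pi_third [y ^+ 4 * w]mulrC.
by rewrite (@e2 4 ((4 * z + 1 / 3) / 2) (1 / 6)); [ring | field].
Qed.

Let th1_third' : theta1 tau (4 * z - 1 / 3) =
  - ii * A ^+ 3 * (B ^+ 4 * (e2pi (1 / 6))^-1) * (Th (w^-1 * y ^+ 4) * qpoch q q).
Proof.
rewrite (theta1_e2pi _ nome_lt1) A8 e2piD e2piN (muly 4) e2pi_third [y ^+ 4 * w^-1]mulrC.
by rewrite (@e2' 4 ((4 * z - 1 / 3) / 2) (1 / 6)); [ring | field].
Qed.

Let th1_z : theta1 tau z = - ii * A ^+ 3 * B * (Th (1 * y) * qpoch q q).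
Proof. by rewrite (theta1_e2pi _ nome_lt1) A8 -/B mul1r. Qed.

Let th1_zthird : theta1 tau (z + 1 / 3) =
  - ii * A ^+ 3 * (B * e2pi (1 / 6)) * (Th (w * y) * qpoch q q).
Proof.
rewrite (theta1_e2pi _ nome_lt1) A8 e2piD e2pi_third [y * w]mulrC.
by rewrite (@e2 1 ((z + 1 / 3) / 2) (1 / 6)); [ring | field].
Qed.

Let th1_zthird' : theta1 tau (z - 1 / 3) =
  - ii * A ^+ 3 * (B * (e2pi (1 / 6))^-1) * (Th (w^-1 * y) * qpoch q q).
Proof.
rewrite (theta1_e2pi _ nome_lt1) A8 e2piD e2piN e2pi_third [y * w^-1]mulrC.
by rewrite (@e2' 1 ((z - 1 / 3) / 2) (1 / 6)); [ring | field].
Qed.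

Let th1_zsixth : theta1 tau (z + 1 / 6) =
  - ii * A ^+ 3 * (B * e2pi (1 / 12)) * (Th (- w^-1 * y) * qpoch q q).
Proof.
rewrite (theta1_e2pi _ nome_lt1) A8 e2piD e2pi_sixth [y * - _]mulrC.
by rewrite (@e2 1 ((z + 1 / 6) / 2) (1 / 12)); [ring | field].
Qed.

Let th1_zsixth' : theta1 tau (z - 1 / 6) =
  - ii * A ^+ 3 * (B * (e2pi (1 / 12))^-1) * (Th (- w * y) * qpoch q q).
Proof.
rewrite (theta1_e2pi _ nome_lt1) A8 e2piD e2piN e2pi_sixth invrN invrK [y * - _]mulrC.
by rewrite (@e2' 1 ((z - 1 / 6) / 2) (1 / 12)); [ring | field].
Qed.

Let th2_z : theta2 tau z = A ^+ 3 * B * (Th (-1 * y) * qpoch q q).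
Proof. by rewrite (theta2_e2pi _ nome_lt1) A8 -/B mulN1r. Qed.

Let th2_2 : theta2 (2 * tau) (2 * z) =
  A ^+ 6 * B ^+ 2 * (Th (ii * y) * Th (- ii * y) * qpoch (q ^+ 2) (q ^+ 2)).
Proof.
rewrite (theta2_e2pi _ Q2_lt1) (mulq 2) (muly 2) (@e1 6 (2 * tau / 8)); last by field.
rewrite (_ : 2 * z / 2 = 2%:R * (z / 2)) ?e2piX -/B; last by rewrite mulrA.
exact: (congr1 (fun t => A ^+ 6 * B ^+ 2 * (t * qpoch (q ^+ 2) (q ^+ 2)))
  (theta_prod_squarei y nome_lt1 ii2)).
Qed.

Let th1_3 : theta1 (3 * tau) (3 * z) =
  - ii * A ^+ 9 * B ^+ 3 * (Th (1 * y) * Th (w * y) * Th (w^-1 * y) * qpoch (q ^+ 3) (q ^+ 3)).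
Proof.
rewrite (theta1_e2pi _ Q3_lt1) (mulq 3) (muly 3) (@e1 9 (3 * tau / 8)); last by field.
rewrite (_ : 3 * z / 2 = 3%:R * (z / 2)) ?e2piX -/B; last by rewrite mulrA.
exact: (congr1 (fun t => - ii * A ^+ 9 * B ^+ 3 * (t * qpoch (q ^+ 3) (q ^+ 3)))
  (theta_prod_cube1 y nome_lt1 b3_cube b3_sum)).
Qed.

Let th2_3 : theta2 (3 * tau) (3 * z) =
  A ^+ 9 * B ^+ 3 * (Th (-1 * y) * Th (- w * y) * Th (- w^-1 * y) * qpoch (q ^+ 3) (q ^+ 3)).
Proof.
rewrite (theta2_e2pi _ Q3_lt1) (mulq 3) (muly 3) (@e1 9 (3 * tau / 8)); last by field.
rewrite (_ : 3 * z / 2 = 3%:R * (z / 2)) ?e2piX -/B; last by rewrite mulrA.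
exact: (congr1 (fun t => A ^+ 9 * B ^+ 3 * (t * qpoch (q ^+ 3) (q ^+ 3)))
  (theta_prod_cubeN y nome_lt1 b3_cube b3_sum)).
Qed.

Let cmodN1 : cmod (-1 : C) = 1. Proof. by rewrite cmodN cmod1. Qed.
Let cmod_w : cmod w = 1. Proof. exact: cmod_b3. Qed.
Let cmod_wV : cmod w^-1 = 1. Proof. by rewrite cmodV cmod_w invr1. Qed.
Let cmod_Nw : cmod (- w) = 1. Proof. by rewrite cmodN. Qed.
Let cmod_NwV : cmod (- w^-1) = 1. Proof. by rewrite cmodN. Qed.
Let cmod_Ni : cmod (- ii) = 1. Proof. by rewrite cmodN cmod_i. Qed.

Lemma psi_1A : psi7 c1A tau z = - (twined 1 1 1 + twined 1 1 1).
Proof.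
exact: etrans (congr_12A _ _ eta1 th1_4 th1_z)
  (algebra_1A _ ii2 i0 A0 B0 yB P1_neq0 (Th_neq0 cmod1')).
Qed.

Lemma psi_2A : psi7 c2A tau z = - (twined 1 (-1) (-1) + twined 1 (-1) (-1)).
Proof.
exact: etrans (congr_12A _ _ eta1 th1_4 th2_z)
  (algebra_2A _ ii2 A0 B0 yB P1_neq0 (Th_neq0 cmodN1)).
Qed.

Lemma psi_4A : psi7 c4A tau z = - (twined 1 ii (- ii) + twined 1 (- ii) ii).
Proof.
exact: etrans (congr_4A _ eta1 (eta_mul 1) th1_4 th2_2)
  (algebra_4A _ _ ii2 A0 B0 yB (Th_neq0 (cmod_i R)) (Th_neq0 cmod_Ni) P2_neq0).
Qed.

Lemma psi_3A : psi7 c3A tau z = - (twined w 1 w + twined w^-1 1 w^-1).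
Proof.
exact: etrans (congr_3A _ (eta_mul 2) th1_3 th1_third th1_zthird' th1_third' th1_zthird)
  (algebra_3A _ _ _ ii2 i0 A0 B0 yB (Th_neq0 cmod1') (Th_neq0 cmod_w) (Th_neq0 cmod_wV)
    P3_neq0 (e2pi_neq0 _)).
Qed.

Lemma psi_6A : psi7 c6A tau z = - (twined w^-1 (-1) (- w^-1) + twined w (-1) (- w)).
Proof.
have uv : e2pi (1 / 6) * e2pi (1 / 12) = ii.
  by rewrite -e2piD -e2pi_quarter; congr e2pi; field.
exact: etrans (congr_6A _ (eta_mul 2) th2_3 th1_third th1_zsixth th1_third' th1_zsixth')
  (algebra_6A _ _ _ ii2 i0 A0 B0 yB (Th_neq0 cmodN1) (Th_neq0 cmod_Nw) (Th_neq0 cmod_NwV)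
    P3_neq0 (e2pi_neq0 _) uv).
Qed.

End Match.

End Theta.

(** * Eigenvalues of the group elements *)

Section DualBasis.
Context (K : fieldType) (p : bool) (d : nat) (X : polarized K p d).
Context (b : dual_bases X) (u : (d./2).-tuple X).
Hypothesis u_basis : basis_of (pol_pos X) u.

(** The elements of the negative summand that represent the coordinate functionals [coord u i]
    through the form. Thus an eigenbasis of g on b^+ is completed to dual bases. *)
Definition dual_neg : (d./2).-tuple X :=
  [tuple \sum_k coord u i (dpos b k) *: dneg b k | i < d./2].

Lemma dual_neg_form i j : pol_form (tnth dual_neg i) (tnth u j) = (i == j)%:R.
Proof.
have uj : tnth u j \in pol_pos X by apply: (basis_mem u_basis); apply: mem_tnth.
have -> : (i == j)%:R = coord u i (pos_part b (tnth u j)).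
  rewrite (pos_part_id b uj) (tnth_nth 0) (coord_free _ _ (basis_free u_basis)).
  by rewrite eq_sym.
rewrite tnth_mktuple pform_suml /pos_part linear_sum /=.
by apply: eq_bigr => k _; rewrite pformZl linearZ /= mulrC.
Qed.

Lemma dual_neg_basis : basis_of (pol_neg X) dual_neg.
Proof.
rewrite basisEfree; apply/and3P; split.
- apply/freeP => k k0 i; have := congr1 (fun x => pol_form x (tnth u i)) k0.
  rewrite pform0l pform_suml (bigD1 i) // big1 => [|j ji].
    by rewrite pformZl -tnth_nth dual_neg_form eqxx mulr1 /= addr0.
  by rewrite pformZl -tnth_nth dual_neg_form (negPf ji) mulr0.
- apply/span_subvP => _ /tnthP[i ->]; rewrite tnth_mktuple.
  by apply: memv_suml => k _; apply/memvZ/dneg_mem.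
by rewrite (size_basis (db_neg_basis b)) size_tuple.
Qed.

Lemma dual_bases_of : exists b' : dual_bases X, forall i, dpos b' i = tnth u i.
Proof. by exists (DualBases u_basis dual_neg_basis dual_neg_form). Qed.

End DualBasis.

Section Trace12.
Context (K : numFieldType) (U : vectType K) (T : 'End(U)) (t : K).
Hypothesis T_trace : has_trace setT T t.

(** The basis inside [has_trace] has an unspecified length; being free and spanning, it has the
    length of the dimension. *)
Lemma has_trace_setT m : \dim {:U} = m ->
  exists (e : 'I_m -> U) (A : 'M[K]_m),
  [/\ forall x, exists c : 'I_m -> K, x = \sum_i c i *: e i,
      forall c : 'I_m -> K, \sum_i c i *: e i = 0 -> forall i, c i = 0,
      forall i, T (e i) = \sum_j A i j *: e j & t = \tr A].
Proof.
move=> dm; have [n [e [A [eT e0 Te tA]]]] := T_trace.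
have es x : exists c : 'I_n -> K, x = \sum_i c i *: e i.
  by have : [set: U]%classic x by []; rewrite eT.
suff En : n = m by subst n; exists e, A.
pose r := [tuple e i | i < n].
have rfree : free r.
  apply/freeP => k k0; apply: e0; rewrite -[RHS]k0.
  by apply: eq_bigr => i _; rewrite -tnth_nth tnth_mktuple.
have rspan : span r = fullv.
  apply/eqP; rewrite eqEsubv subvf; apply/subvP => x _.
  have [c ->] := es x; apply: memv_suml => i _; apply/memvZ/memv_span.
  by apply/tnthP; exists i; rewrite tnth_mktuple.
by move: rfree; rewrite /free rspan dm size_tuple => /eqP.
Qed.

Lemma trace_dim1 : \dim {:U} = 1%N -> forall x, T x = t *: x.
Proof.
move=> /has_trace_setT[e [A [es _ Te ->]]] x.
have [c ->] := es x; rewrite linear_sum scaler_sumr; apply: eq_bigr => i _.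
rewrite linearZ /= Te big_ord1 /mxtrace big_ord1 ord1 !scalerA.
by rewrite mulrC.
Qed.

(** The first half is the Cayley-Hamilton identity, with the determinant as [delta]; the second
    detects the trace of a scalar. *)
Lemma trace_dim2 : \dim {:U} = 2%N ->
  (exists delta, forall x, T (T x) = t *: T x - delta *: x) /\
  (forall c, (forall x, T x = c *: x) -> t = 2 * c).
Proof.
move=> /has_trace_setT[e [A [es e0 Te ->]]].
have A2 i : T (e i) = A i ord0 *: e ord0 + A i ord_max *: e ord_max.
  by rewrite Te big_ord_recl big_ord1; congr (_ + A _ _ *: e _); apply: val_inj.
have trA : \tr A = A ord0 ord0 + A ord_max ord_max.
  by rewrite /mxtrace big_ord_recl big_ord1; congr (_ + A _ _); apply: val_inj.
split.
  exists (A ord0 ord0 * A ord_max ord_max - A ord0 ord_max * A ord_max ord0) => x.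
  have TE c1 c2 : T (c1 *: e ord0 + c2 *: e ord_max) =
      (c1 * A ord0 ord0 + c2 * A ord_max ord0) *: e ord0 +
      (c1 * A ord0 ord_max + c2 * A ord_max ord_max) *: e ord_max.
    by rewrite linearD !linearZ /= !A2 !scalerDr !scalerA addrACA -!scalerDl.
  have [c ->] := es x.
  have -> : \sum_i c i *: e i = c ord0 *: e ord0 + c ord_max *: e ord_max.
    by rewrite big_ord_recl big_ord1; congr (_ + c _ *: e _); apply: val_inj.
  rewrite !TE trA !scalerDr !scalerA opprD addrACA -!scalerBl.
  move: (A ord0 ord0) (A ord0 ord_max) (A ord_max ord0) (A ord_max ord_max) => a00 a01 a10 a11.
  have ch (c0 c1 u00 u01 u10 u11 : K) :
      (c0 * u00 + c1 * u10) * u00 + (c0 * u01 + c1 * u11) * u10 =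
      (u00 + u11) * (c0 * u00 + c1 * u10) - (u00 * u11 - u01 * u10) * c0 by ring.
  have ch' (c0 c1 u00 u01 u10 u11 : K) :
      (c0 * u00 + c1 * u10) * u01 + (c0 * u01 + c1 * u11) * u11 =
      (u00 + u11) * (c0 * u01 + c1 * u11) - (u00 * u11 - u01 * u10) * c1 by ring.
  by congr (_ *: _ + _ *: _); [exact: ch | exact: ch'].
move=> c Tc.
have coef i j : A i j = c * (i == j)%:R.
  apply/eqP; rewrite -subr_eq0; apply/eqP; move: j.
  apply: e0; under eq_bigr do rewrite scalerBl.
  rewrite sumrB -Te Tc (bigD1 i) //= big1 => [|j ji].
    by rewrite eqxx mulr1 addr0 subrr.
  by rewrite eq_sym (negPf ji) mulr0 scale0r.
by rewrite trA !coef !eqxx !mulr1 mulr_natl mulr2n.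
Qed.

End Trace12.

Section Diag2.
Context (K : numFieldType) (p : bool) (X : polarized K p 4) (bX : dual_bases X).
Local Notation P := (subvs_of (pol_pos X)).
Implicit Types (T : 'End(P)) (a b : K).

Definition pair_fun a b (i : 'I_(4./2)) : K := if i == 0 :> nat then a else b.

Lemma dim_pos : \dim {: P} = 2%N.
Proof.
by rewrite dimvf; exact: (size_basis (db_pos_basis bX)).
Qed.

Lemma gl_diag_scalar T a : (forall x, T x = a *: x) -> gl_diag bX T (pair_fun a a).
Proof. by move=> Ta i x xE; rewrite Ta /= xE /pair_fun if_same. Qed.

Lemma gl_diag_eigenbasis T a b (u v : P) : a != b -> u != 0 -> v != 0 ->
  T u = a *: u -> T v = b *: v ->
  exists c : dual_bases X, gl_diag c T (pair_fun a b).
Proof.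
move=> ab u0 v0 Tu Tv.
pose r : (4./2).-tuple X := [tuple of [:: vsval u; vsval v]].
have rfree : free r.
  apply/freeP => k; rewrite big_ord_recl big_ord1 /= => k0.
  set k1 := k _ in k0; set k2 := k _ in k0.
  have E : k1 *: u + k2 *: v = 0 by apply: val_inj.
  have E' : (a * k1) *: u + (b * k2) *: v = 0.
    have := congr1 T E; rewrite linearD !linearZ /= Tu Tv linear0 !scalerA.
    by rewrite ![k1 * _]mulrC [k2 * _]mulrC.
  have k20 : k2 = 0.
    have /eqP : (b * k2 - a * k2) *: v = 0.
      rewrite scalerBl -[X in _ - X]scalerA; apply/eqP; rewrite subr_eq0; apply/eqP.
      rewrite -[k2 *: v](addKr (k1 *: u)) E addr0 scalerN scalerA.
      by apply/eqP; rewrite -addr_eq0 addrC; apply/eqP.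
    rewrite -mulrBl scaler_eq0 (negPf v0) orbF mulf_eq0 subr_eq0 eq_sym (negPf ab) /=.
    by move/eqP.
  have k10 : k1 = 0.
    by move/eqP: E; rewrite k20 scale0r addr0 scaler_eq0 (negPf u0) orbF => /eqP.
  move=> i; case: (unliftP ord0 i) => [j ->|->]; last exact: k10.
  by rewrite (ord1 j); exact: k20.
have rbasis : basis_of (pol_pos X) r.
  rewrite basisEfree rfree /=; apply/andP; split.
    apply/span_subvP => x; rewrite !inE => /orP[] /eqP ->; exact: subvsP.
  by rewrite (size_basis (db_pos_basis bX)).
have [c cE] := dual_bases_of bX rbasis.
exists c => i x; rewrite cE /pair_fun.
case: (unliftP ord0 i) => [j ->|->] /= xE.
  have -> : x = v by apply: val_inj; apply: (etrans xE); rewrite (ord1 j).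
  by rewrite Tv (ord1 j).
have -> : x = u by apply: val_inj.
by rewrite Tu.
Qed.

(** The hypothesis reads (T - a) (T - b) = 0. Since [T] is not scalar, neither factor is zero, and
    nonzero vectors in the images of T - b and T - a are eigenvectors for a and b. *)
Lemma gl_diag_quadratic T a b : a != b ->
  (forall x, T (T x) = (a + b) *: T x - (a * b) *: x) ->
  (forall c, ~ forall x, T x = c *: x) ->
  exists c : dual_bases X, gl_diag c T (pair_fun a b).
Proof.
move=> ab TT Tns.
have ex c : exists x, T x - c *: x != 0.
  apply: contrapT => nx; apply: (Tns c) => x; apply/eqP; rewrite -subr_eq0.
  by apply/eqP; apply: contrapT => /eqP x0; apply: nx; exists x.
have eig c e x : c + e = a + b -> c * e = a * b -> T (T x - c *: x) = e *: (T x - c *: x).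
  move=> cd ce; rewrite linearB linearZ /= TT -cd -ce scalerBr !scalerA scalerDl.
  by rewrite [e * c]mulrC addrAC [_ + e *: _]addrC addrK.
have [[x x0] [y y0]] := (ex b, ex a).
apply: (@gl_diag_eigenbasis T a b (T x - b *: x) (T y - a *: y)) => //.
  by apply: eig; rewrite ?[b + _]addrC ?[b * _]mulrC.
exact: eig.
Qed.

End Diag2.

Lemma gl_diag_inv (K : numFieldType) (p : bool) (d : nat) (X : polarized K p d)
    (b : dual_bases X) (T T' : 'End(subvs_of (pol_pos X))) lam :
  (forall i, lam i != 0) -> (forall x, T' (T x) = x) -> gl_diag b T lam ->
  gl_diag b T' (fun i => (lam i)^-1).
Proof.
move=> l0 TT D i x xE.
have -> : vsval (T' x) = (lam i)^-1 *: vsval (T' (T x)).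
  have -> : T x = lam i *: x.
    by apply: val_inj; apply: etrans (D i x xE) _; rewrite -xE.
  by rewrite linearZ /= scalerA mulVf ?scale1r.
by rewrite TT xE.
Qed.

Section CubicDiag.
Context (K : numFieldType) (p : bool) (X : polarized K p 4) (bX : dual_bases X).
Local Notation P := (subvs_of (pol_pos X)).
Context (T : 'End(P)) (eps w t : K).
Hypotheses (eps2 : eps * eps = 1) (w_root : w ^+ 2 + w + 1 = 0).

Lemma pos_neq0 : exists x : P, x != 0.
Proof.
exists (vpick {: P}); rewrite vpick0 -dimv_eq0.
by rewrite (dim_pos bX).
Qed.

Hypothesis T_trace : has_trace setT T t.

(* By Cayley-Hamilton, T^3 = eps forces det T = t^2 unless T is scalar, and  *)
(* a scalar T would have t^3 = 8 eps instead of - eps.                       *)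
Lemma gl_diag_trace_cube : t = eps * (1 + w) -> (forall x, T (T (T x)) = eps *: x) ->
  exists c : dual_bases X, gl_diag c T (pair_fun eps (eps * w)).
Proof.
move=> tE T3; have [[delta TT] sc] := trace_dim2 T_trace (dim_pos bX).
have w3 : w ^+ 3 = 1.
  apply/eqP; rewrite -subr_eq0; have -> : w ^+ 3 - 1 = (w - 1) * (w ^+ 2 + w + 1) by ring.
  by rewrite w_root mulr0.
have eps0 : eps != 0 by apply/eqP => e0; move/eqP: eps2; rewrite e0 mulr0 eq_sym oner_eq0.
have w1 : w != 1.
  apply/eqP => e1; move: w_root; rewrite e1 => /eqP.
  by rewrite (_ : 1 ^+ 2 + 1 + 1 = 3%:R) ?pnatr_eq0 //; ring.
have Tns c : ~ forall x, T x = c *: x.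
  move=> Tc; have [x x0] := pos_neq0.
  have c3 : c ^+ 3 = eps.
    have := T3 x; rewrite !Tc !scalerA => /eqP.
    by rewrite -subr_eq0 -scalerBl scaler_eq0 (negPf x0) orbF subr_eq0 => /eqP <-; ring.
  have t3 : t ^+ 3 = - eps.
    have -> : t ^+ 3 = eps * (eps * eps) * (w ^+ 3 + 3 * w * (w ^+ 2 + w + 1) - 3 * w ^+ 3 + 1).
      by rewrite tE; ring.
    by rewrite eps2 w_root w3; ring.
  have /eqP : 9%:R * eps = 0.
    by rewrite -[in LHS]c3 (_ : 9%:R * c ^+ 3 = (2 * c) ^+ 3 + c ^+ 3); [rewrite -sc // t3 c3; ring|ring].
  by rewrite mulf_eq0 (negPf eps0) pnatr_eq0.
have dE : delta = t ^+ 2.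
  apply/eqP; rewrite eq_sym -subr_eq0; apply/negPn/negP => td0.
  (* Substituting T^2 = t T - delta into T^3 = eps gives (t^2 - delta) T = eps + t delta, so an
     invertible coefficient would make [T] this scalar. *)
  apply: (Tns ((t ^+ 2 - delta)^-1 * (eps + t * delta))) => x.
  have E : (t ^+ 2 - delta) *: T x = (eps + t * delta) *: x.
    rewrite [RHS]scalerDl -T3 2!TT scalerBr !scalerA -expr2.
    rewrite scalerBl addrAC; congr (_ - _).
    by rewrite -addrA addNr addr0.
  by rewrite -scalerA -E scalerA mulVf ?scale1r.
have t2 : t ^+ 2 = w.
  have -> : t ^+ 2 = (eps * eps) * (w ^+ 2 + w + 1 + w) by rewrite tE; ring.
  by rewrite eps2 w_root; ring.
apply: (gl_diag_quadratic bX _ _ Tns).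
  by rewrite -subr_eq0 (_ : _ - _ = eps * (1 - w)); [rewrite mulf_neq0 // subr_eq0 eq_sym|ring].
by move=> x; rewrite TT tE dE t2 mulrDr mulr1 mulrA eps2 mul1r.
Qed.

(** T^2 = -1 is the quadratic equation with roots j and -j. A scalar of trace 0 would be zero,
    contrary to T^2 = -1. *)
Lemma gl_diag_trace_square (j : K) : t = 0 -> j * j = -1 -> (forall x, T (T x) = - x) ->
  exists c : dual_bases X, gl_diag c T (pair_fun j (- j)).
Proof.
move=> t0 j2 T2; have [_ sc] := trace_dim2 T_trace (dim_pos bX).
have j0 : j != 0 by apply/eqP => e0; move/eqP: j2; rewrite e0 mulr0 eq_sym oppr_eq0 oner_eq0.
apply: (gl_diag_quadratic bX).
- by rewrite -subr_eq0 opprK -mulr2n mulrn_eq0 negb_or.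
- by move=> x; rewrite subrr mulrN j2 T2 opprK scale0r sub0r scale1r.
move=> c Tc; have [x x0] := pos_neq0; have /eqP := sc c Tc.
rewrite t0 eq_sym mulf_eq0 pnatr_eq0 /= => /eqP c0.
by have /eqP := T2 x; rewrite !Tc c0 !scale0r eq_sym oppr_eq0 (negPf x0).
Qed.

(** With T^2 = 1 and t = -2 the Cayley-Hamilton identity is linear in [T] and makes it a scalar,
    which the trace determines. *)
Lemma scalar_trace_involution : t = -2 -> (forall x, T (T x) = x) -> forall x, T x = - x.
Proof.
move=> tE T2; have [[delta TT] sc] := trace_dim2 T_trace (dim_pos bX).
have Tc x : T x = (- (1 + delta) / 2) *: x.
  have := TT x; rewrite T2 tE => /eqP; rewrite eq_sym subr_eq => /eqP E.
  have -> : T x = (-2)^-1 *: ((-2) *: T x) by rewrite scalerA mulVf ?scale1r // oppr_eq0 pnatr_eq0.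
  rewrite E scalerDr scalerA -scalerDl.
  by apply: (congr1 (fun c : K => c *: x)); field.
have E : - (1 + delta) / 2 = -1.
  by have := sc _ Tc; rewrite tE => E; apply: (@mulfI _ 2); rewrite ?pnatr_eq0 // -E; ring.
by move=> x; rewrite Tc E scaleN1r.
Qed.

End CubicDiag.

Lemma b3_conj (R : realType) : (b3 R)^* = (b3 R)^-1.
Proof.
have n1 : `|b3 R| = 1.
  by apply/eqP; rewrite -(@pexpr_eq1 _ _ 3) // -normrX b3_cube normr1.
have := normCK (b3 R); rewrite n1 expr1n => E.
by rewrite -[LHS](mulKf (b3_neq0 R)) -E mulr1.
Qed.

Section ClassPowers.
Context (G : groupType) (cl : G -> class7) (cl_classes : class_labelling cl).

Lemma class_order2 (x : G) : (x ^+ 2 = 1)%g -> x != 1%g -> cl x = c2A.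
Proof.
move=> x2 x1; have [_ _ ord] := cl_classes; have [xo] := ord x.
move=> /(_ 2%N); rewrite x2 eqxx.
case: (cl x) xo => //= xo H; try by have := H isT.
by rewrite -[x]expg1 xo eqxx in x1.
Qed.

End ClassPowers.

Section Twisting.
Context (R : realType) (A : polarized R[i] true 2) (B : polarized R[i] false 4).
Local Notation C := R[i].
Local Notation w := (b3 R).
Local Notation ii := ('i%C : C).
Context (bA : dual_bases A) (bB : dual_bases B).
Context (G : groupType) (cl : G -> class7) (cl_classes : class_labelling cl).
Context (rho : G -> 'End(subvs_of (pol_pos A))).
Context (rho_char : forall g, has_trace setT (rho g) (chi2 R (cl g))).
Context (rho' : G -> 'End(subvs_of (pol_pos B))) (rho'_hom : gl_hom rho').
Context (rho'_char : forall g, has_trace setT (rho' g) (chi6 R (cl g))).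

Lemma rho_scalar g x : rho g x = chi2 R (cl g) *: x.
Proof.
apply: trace_dim1; first exact: rho_char.
by rewrite dimvf; exact: (size_basis (db_pos_basis bA)).
Qed.

Lemma rho'1 v : rho' 1%g v = v.
Proof. by rewrite rho'_hom.1 id_lfunE. Qed.

Lemma rho'M x y v : rho' (x * y)%g v = rho' x (rho' y v).
Proof. by rewrite rho'_hom.2 comp_lfunE. Qed.

Lemma rho'_c2A x v : cl x = c2A -> rho' x v = - v.
Proof.
move=> clx; have [_ _ ord] := cl_classes; have [xo _] := ord x.
apply: (scalar_trace_involution bB (rho'_char x)); first by rewrite clx.
by move=> u; rewrite -rho'M; move: xo; rewrite clx /= expgS expg1 => ->; rewrite rho'1.
Qed.

(** Half of an even order gives an involution, and involutions lie in 2A, which acts on b^+ as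
    -1. *)
Lemma rho'_half g n v : class_order (cl g) = (2 * n)%N -> (0 < n)%N ->
  rho' (g ^+ n)%g v = - v.
Proof.
move=> gn n0; have [_ _ ord] := cl_classes; have [go gm] := ord g.
apply: rho'_c2A; apply: (class_order2 cl_classes).
  by rewrite -expgnA mulnC -gn.
by apply: gm; rewrite gn n0 mul2n -addnn -[X in (X < _)%N]addn0 ltn_add2l.
Qed.

Lemma b3V_root : (w^-1) ^+ 2 + w^-1 + 1 = 0.
Proof.
have := b3_sum R; have w0 := b3_neq0 R => E.
have -> : w^-1 ^+ 2 + w^-1 + 1 = (w ^+ 2 + w + 1) / w ^+ 2 by field.
by rewrite E mul0r.
Qed.

Lemma b3V : w^-1 = - (1 + w).
Proof.
have := b3_sum R; have w0 := b3_neq0 R => E.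
have -> : w^-1 = (w ^+ 2 + w + 1) / w - (1 + w) by field.
by rewrite E mul0r sub0r.
Qed.

Lemma rho'_cube_diag g (eps u : C) : eps * eps = 1 -> u ^+ 2 + u + 1 = 0 ->
  chi6 R (cl g) = eps * (1 + u) -> (forall v, rho' (g ^+ 3)%g v = eps *: v) ->
  exists c : dual_bases B, gl_diag c (rho' g) (pair_fun eps (eps * u)).
Proof.
move=> e2 u0 tE T3; apply: (gl_diag_trace_cube bB e2 u0 (rho'_char g) tE).
by move=> v; rewrite -T3 2!expgS expg1 !rho'M.
Qed.

(** On the classes of order 3 and 6 the cube of g acts on b^+ as eps = 1 or -1, and chi6 equals eps
    (1 + u) with u a primitive cube root of unity; the eigenvalues are then eps and eps u. On 4A
    they are i and -i, and on 1A and 2A the action is scalar. *)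
Lemma twisting g : exists (c : dual_bases B) (chi l1 l2 : C),
  [/\ [/\ cmod l1 = 1, cmod l2 = 1 & chi != 0], forall x, rho g x = chi *: x,
      gl_diag c (rho' g) (pair_fun l1 l2)
    & forall tau z : C, 0 < complex.Im tau -> 0 < - complex.Im z ->
      - complex.Im z < complex.Im tau ->
      psi7 (cl g) tau z = - (twined tau z chi l1 l2 + twined tau z chi^-1 l1^-1 l2^-1)].
Proof.
have rhoE := rho_scalar g; have [_ _ ord] := cl_classes; have [go _] := ord g.
have half := @rho'_half g; have cube := @rho'_cube_diag g.
have T1 n v : class_order (cl g) = n -> rho' (g ^+ n)%g v = 1 *: v.
  by move=> <-; rewrite go rho'1 scale1r.
have TN n v : class_order (cl g) = (2 * n)%N -> (0 < n)%N -> rho' (g ^+ n)%g v = -1 *: v.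
  by move=> gn n0; rewrite half // scaleN1r.
have w0 := b3_neq0 R; have wV0 : w^-1 != 0 by rewrite invr_eq0.
have wS := b3_sum R; have wVS := b3V_root.
have cw := cmod_b3 R; have c1 := cmod1 R; have ci := cmod_i R.
have NN : -1 * -1 = 1 :> C by rewrite mulrNN mulr1.
have cwV : cmod w^-1 = 1 by rewrite cmodV cw invr1.
case E: (cl g) (rho'_char g) rhoE cube T1 TN => tr rhoE cube T1 TN.
- exists bB, 1, 1, 1; split; [by rewrite oner_eq0|by []|..].
    by apply: gl_diag_scalar => x; have := T1 1%N x erefl; rewrite expg1.
  by move=> tau z t0 z0 zt; rewrite psi_1A // !invr1.
- exists bB, 1, (-1), (-1); split; [by rewrite cmodN c1 oner_eq0|by []|..].
    by apply: gl_diag_scalar => x; have := TN 1%N x erefl isT; rewrite expg1.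
  by move=> tau z t0 z0 zt; rewrite psi_2A // !invrN !invr1.
- have ii2 : ii * ii = -1.
    by apply/eqP; rewrite eq_complex /= !(mulr0, mul0r, mulr1, add0r, addr0, sub0r, oppr0) !eqxx.
  have i0 : ii != 0 by rewrite -cmod_eq0 ci oner_eq0.
  have iV : ii^-1 = - ii by apply: (mulfI i0); rewrite mulfV // mulrN ii2 opprK.
  have [c cD] : exists c : dual_bases B, gl_diag c (rho' g) (pair_fun ii (- ii)).
    apply: (gl_diag_trace_square bB tr erefl ii2).
    by move=> v; have := TN 2%N v erefl isT; rewrite expgS expg1 rho'M scaleN1r.
  exists c, 1, ii, (- ii); split=> //; first by rewrite cmodN ci oner_eq0.
  move=> tau z t0 z0 zt; rewrite psi_4A // invr1 invrN.
  by rewrite iV opprK.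
- have [|v|c cD] := cube 1 w (mulr1 1) wS.
  + by rewrite /= b3_conj b3V opprK mul1r.
  + exact: T1.
  exists c, w, 1, w; split; [by []|by []|by rewrite mul1r in cD|].
  by move=> tau z t0 z0 zt; rewrite psi_3A // !invr1.
- have [|v|c cD] := cube (-1) w^-1 NN wVS.
  + by rewrite /= b3V mulN1r; ring.
  + exact: TN.
  exists c, w^-1, (-1), (- w^-1); split.
  + by rewrite !cmodN.
  + by move=> x; rewrite rhoE /= b3_conj.
  + by rewrite mulN1r in cD.
  by move=> tau z t0 z0 zt; rewrite psi_6A // !invrN invr1 invrK.
(* On 3B and 6B the eigenvalues are inverse to those on 3A and 6A, which exchanges the two terms of
   psi. *)
- have [|v|c cD] := cube 1 w^-1 (mulr1 1) wVS.
  + by rewrite /= b3V mul1r; ring.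
  + exact: T1.
  exists c, w^-1, 1, w^-1; split; [by []| |by rewrite mul1r in cD|].
  + by move=> x; rewrite rhoE /= b3_conj.
  move=> tau z t0 z0 zt; rewrite invr1 invrK addrC; exact: psi_3A.
- have [|v|c cD] := cube (-1) w NN wS.
  + by rewrite /= b3_conj b3V mulN1r.
  + exact: TN.
  exists c, w, (-1), (- w); split.
  + by rewrite !cmodN.
  + by move=> x; rewrite rhoE.
  + by rewrite mulN1r in cD.
  by move=> tau z t0 z0 zt; rewrite !invrN invr1 addrC; exact: psi_6A.
Qed.

End Twisting.

(** * The twined trace *)

Lemma eigen_twined (K : nzRingType) (V : lmodType K) (F J S T : V -> V) (v : V) (f j a b : K) :
  linear J -> linear S -> linear T ->
  F v = f *: v -> J v = j *: v -> S v = a *: v -> T v = b *: v ->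
  S (J (F v)) + T (J (F v)) = (f * j * a + f * j * b) *: v.
Proof.
move=> lJ lS lT -> Jv Sv Tv.
by rewrite (linZ lJ) Jv !(linZ lS) Sv !(linZ lT) Tv !scalerA scalerDl.
Qed.

Lemma gl_diag_homothety (K : numFieldType) (p : bool) d (X : polarized K p d)
    (b : dual_bases X) a (T : 'End(subvs_of (pol_pos X))) :
  (forall x, T x = a *: x) -> gl_diag b T (fun=> a).
Proof. by move=> Ta i x xE; rewrite Ta /= xE. Qed.

Lemma prod_letter_eig_cst (K : numFieldType) (a : K) d (h_gt0 : (0 < d./2)%N) s :
  a^-1 = a -> \prod_(k <- s) letter_eig h_gt0 (fun=> a) k = \prod_(k <- s) a.
Proof. by move=> aV; apply: eq_bigr => k _; rewrite /letter_eig aV if_same. Qed.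

Lemma pair_fun_neq0 (R : realType) (a b : R[i]) i : cmod a = 1 -> cmod b = 1 ->
  pair_fun a b i != 0.
Proof. by move=> a1 b1; rewrite -cmod_eq0 /pair_fun; case: ifP; rewrite ?a1 ?b1 oner_eq0. Qed.

Lemma eigen_eq (K : nzRingType) (V : lmodType K) (u v : V) (a b : K) :
  u = a *: v -> a = b -> u = b *: v.
Proof. by move=> -> ->. Qed.

Section TwinedTrace.
Context (R : realType).
Local Notation C := R[i].
Context (E A : polarized C true 2) (B : polarized C false 4).
Context (bE : dual_bases E) (bA : dual_bases A) (bB : dual_bases B).
Context (FE : fock_fields E) (FA : fock_fields A) (FB : fock_fields B).
Context (c : dual_bases B) (chi l1 l2 : C).
Hypotheses (l1_unit : cmod l1 = 1) (l2_unit : cmod l2 = 1) (chi_neq0 : chi != 0).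
Context (gA hA : 'End(subvs_of (pol_pos A))) (gB hB : 'End(subvs_of (pol_pos B))).
Hypotheses (gA_scal : forall x, gA x = chi *: x) (hA_scal : forall x, hA x = chi^-1 *: x).
Hypotheses (gB_diag : gl_diag c gB (pair_fun l1 l2)).
Hypotheses (hB_diag : gl_diag c hB (pair_fun l1^-1 l2^-1)).

Local Notation S g h := (@W7_gl _ E A B \1%VF g h).
Local Notation JF w := (W7_Je0 FE FA FB bE (@W7_F _ E A B w)).
Local Notation lam := (@pair_fun C).

Definition twined_coef (m : int) (n : nat) : C :=
  \sum_(s <- w7_fiber m n)
    (w7_eig (fun=> chi) (lam l1 l2) s + w7_eig (fun=> chi^-1) (lam l1^-1 l2^-1) s).

Let V1 : (1 : C)^-1 = 1. Proof. exact: invr1. Qed.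
Let VN1 : (-1 : C)^-1 = -1. Proof. by rewrite invrN invr1. Qed.
Let N1_neq0 (i : 'I_(2./2)) : (-1 : C) != 0. Proof. by rewrite oppr_eq0 oner_eq0. Qed.
Let one_neq0 d (i : 'I_d) : (1 : C) != 0. Proof. exact: oner_neq0. Qed.
Let diag_id p d (X : polarized C p d) (b : dual_bases X) : gl_diag b \1%VF (fun=> 1).
Proof. by apply: gl_diag_homothety => x; rewrite id_lfunE scale1r. Qed.
Let diag_opp p d (X : polarized C p d) (b : dual_bases X) : gl_diag b (- \1%VF) (fun=> -1).
Proof. by apply: gl_diag_homothety => x; rewrite opp_lfunE id_lfunE scaleN1r. Qed.

Local Notation basis := (w7_basis bE bA c).

Lemma W7_F_basis s : @W7_F _ E A B (basis s) =
  (\prod_(k <- s.1.1) -1 * \prod_(k <- s.1.2) -1) *: basis s.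
Proof.
have H := W7_gl_basis N1_neq0 N1_neq0 (@one_neq0 _) (@diag_opp _ _ _ bE) (@diag_opp _ _ _ bA) (@diag_id _ _ _ c) s.
have e : (\prod_(k <- s.1.1) letter_eig h2_gt0 (fun=> -1 : C) k)
  * (\prod_(k <- s.1.2) letter_eig h2_gt0 (fun=> -1) k)
  * (\prod_(k <- s.2) letter_eig h4_gt0 (fun=> 1) k) =
  \prod_(k <- s.1.1) -1 * \prod_(k <- s.1.2) -1.
  by rewrite !(prod_letter_eig_cst _ _ VN1) (prod_letter_eig_cst _ _ V1) [X in _ * X]big1 // mulr1.
rewrite /W7_F; exact: eigen_eq H e.
Qed.

Lemma W7_twist_basis (a b1 b2 : C) (g : 'End(subvs_of (pol_pos A)))
    (h : 'End(subvs_of (pol_pos B))) s :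
  a != 0 -> cmod b1 = 1 -> cmod b2 = 1 -> (forall x, g x = a *: x) ->
  gl_diag c h (lam b1 b2) ->
  linear (S g h) /\ S g h (basis s) =
    (\prod_(k <- s.1.2) letter_eig h2_gt0 (fun=> a) k *
     \prod_(k <- s.2) letter_eig h4_gt0 (lam b1 b2) k) *: basis s.
Proof.
move=> a0 b11 b21 ga hb.
have ga' : gl_diag bA g (fun=> a) by exact: gl_diag_homothety.
have b0 i : lam b1 b2 i != 0 by exact: pair_fun_neq0.
split; first exact: (W7_gl_linear (@one_neq0 _) (fun=> a0) b0 (@diag_id _ _ _ bE) ga' hb).
have H := W7_gl_basis (@one_neq0 _) (fun=> a0) b0 (@diag_id _ _ _ bE) ga' hb s.
apply: eigen_eq H _.
by rewrite (prod_letter_eig_cst _ _ V1) big1 // mul1r.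
Qed.

Lemma twined_graded_trace :
  graded_trace (fun w => S gA gB (JF w) + S hA hB (JF w))
    (W7_J0 FE FA FB bA bB) (W7_L0 FE FA FB bE bA bB) twined_coef.
Proof.
have chiV : chi^-1 != 0 by rewrite invr_eq0.
have l1V : cmod l1^-1 = 1 by rewrite cmodV l1_unit invr1.
have l2V : cmod l2^-1 = 1 by rewrite cmodV l2_unit invr1.
have g1 s := W7_twist_basis s chi_neq0 l1_unit l2_unit gA_scal gB_diag.
have h1 s := W7_twist_basis s chiV l1V l2V hA_scal hB_diag.
have lS := (g1 ([::], [::], [::])).1; have lS' := (h1 ([::], [::], [::])).1.
have T_basis s : w7_adm s -> S gA gB (JF (basis s)) + S hA hB (JF (basis s)) =
    (w7_eig (fun=> chi) (lam l1 l2) s + w7_eig (fun=> chi^-1) (lam l1^-1 l2^-1) s) *: basis s.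
  move=> _.
  have H := eigen_twined (W7_Je0_linear FE FA FB bE) lS lS' (W7_F_basis s)
    (W7_Je0_basis FE FA FB bE bE bA c s) (g1 s).2 (h1 s).2.
  apply: eigen_eq H _.
  by rewrite /w7_eig; congr (_ * _ + _ * _); exact: mulrC.
exact: (diagonal_graded_trace (w7_basis_span bE bA c) (w7_coord_linear bE bA c)
  (w7_coordE bE bA c) (W7_J0_linear FE FA FB bA bB) (W7_L0_linear FE FA FB bE bA bB)
  (fun s _ => W7_J0_basis FE FA FB bE bA bA bB c s)
  (fun s _ => W7_L0_basis FE FA FB bE bE bA bA bB c s) T_basis mem_w7_fiber).
Qed.

Lemma twined_coef_eq0 m n : (1 + 5 * n%:Z < m)%R -> twined_coef m n = 0.
Proof.
move=> mn; rewrite /twined_coef big1_fset // => s; rewrite mem_w7_fiber => /and3P[_ /eqP sm /eqP sn].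
by have := w7_charge_bound s; rewrite sm sn leNgt mn.
Qed.

Lemma w7_limit_twined (tau z a b1 b2 : C) :
  w7_limit (e2pi tau) (e2pi z) (fun=> a) (lam b1 b2) = twined tau z a b1 b2.
Proof.
rewrite /w7_limit /twined /theta_prod /pair_fun !inordK //= !invfM.
by rewrite -!mulrA.
Qed.

(** The coefficients are sums over fibres of charge and weight, while the limits concern boxes.
    [grouped_has_sum] connects them, the box of size 10 n + |m| + 10 containing the whole fibre over
    (m, n). *)
Lemma twined_has_sum (tau z : C) : 0 < complex.Im tau -> 0 < - complex.Im z ->
  - complex.Im z < complex.Im tau ->
  has_sum (fun mn : int * nat => - twined_coef mn.1 mn.2 * e2pi z ^ mn.1 * e2pi tau ^+ mn.2)
    (- (twined tau z chi l1 l2 + twined tau z chi^-1 l1^-1 l2^-1)).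
Proof.
move=> t0 z0 zt.
have q1 := nome_lt1 t0; have y0 := e2pi_neq0 z.
have y1 := ellV_lt1 z0; have yq1 := ell_nome_lt1 zt.
have unit_pair b1 b2 i : cmod b1 = 1 -> cmod b2 = 1 -> cmod (lam b1 b2 i) = 1.
  by rewrite /pair_fun; case: ifP.
have cV (x : C) : cmod x = 1 -> cmod x^-1 = 1 by move=> x1; rewrite cmodV x1 invr1.
pose f1 := w7_term (e2pi tau) (e2pi z) (fun=> chi) (lam l1 l2).
pose f2 := w7_term (e2pi tau) (e2pi z) (fun=> chi^-1) (lam l1^-1 l2^-1).
have u1 i : cmod (lam l1 l2 i) = 1 by exact: unit_pair.
have u2 i : cmod (lam l1^-1 l2^-1 i) = 1 by apply: unit_pair; apply: cV.
have [S1 B1] := w7_term_bound q1 y0 y1 yq1 (fun=> chi) u1.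
have [S2 B2] := w7_term_bound q1 y0 y1 yq1 (fun=> chi^-1) u2.
have L1 := @w7_term_cvg _ _ _ q1 y0 y1 yq1 (fun=> chi) _ u1.
have L2 := @w7_term_cvg _ _ _ q1 y0 y1 yq1 (fun=> chi^-1) _ u2.
apply: (@grouped_has_sum _ _ _ (fun s => - (f1 s + f2 s))
  (fun s => (w7_charge s, w7_weight s)) w7_cut
  (fun mn => 10 * mn.2 + `|mn.1| + 10)%N _ (S1 + S2) _).
- exact: w7_cut_uniq.
- exact: w7_cut_mono.
- move=> [m n] M /= bM; rewrite /twined_coef mulNr mulNr !mulr_suml sumrN; congr (- _).
  rewrite -[RHS]big_filter.
  have fE : perm_eq (w7_fiber m n) [seq s <- w7_cut M | (w7_charge s, w7_weight s) == (m, n)].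
    apply: uniq_perm; [exact: fset_uniq|exact: filter_uniq (w7_cut_uniq M)|].
    move=> s; rewrite mem_filter xpair_eqE; apply/idP/andP => [|[sE sM]].
      rewrite !inE /= => /andP[sM sE]; split=> //; exact: w7_cut_mono sM.
    by rewrite mem_w7_fiber (w7_cut_adm sM).
  rewrite (perm_big _ fE) /= [LHS]big_filter [RHS]big_filter; apply: eq_bigr => s.
  by rewrite xpair_eqE => /andP[/eqP sm /eqP sn]; rewrite /f1 /f2 /w7_term sm sn !mulrDl.
- move=> M; apply: le_trans (lerD (B1 M) (B2 M)); rewrite -big_split /=.
  by apply: ler_sum => s _; rewrite cmodN; exact: cmodD.
rewrite -!w7_limit_twined.
under eq_fun do rewrite sumrN big_split.
apply: cvgN; exact: cvgD L1 L2.
Qed.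

End TwinedTrace.

Theorem theorem4p1 (R : realType)
  (E A : polarized R[i] true 2) (B : polarized R[i] false 4)
  (bE : dual_bases E) (bA : dual_bases A) (bB : dual_bases B)
  (FE : fock_fields E) (FA : fock_fields A) (FB : fock_fields B)
  (N : 'M[int]_24) (N_niemeier : even_unimodular N)
  (N_roots : root_system_A6_4 N)
  (G : groupType) (pi : 'M[int]_24 -> G) (pi_quotient : umbral_quotient N pi)
  (cl : G -> class7) (cl_classes : class_labelling cl)
  (rho : G -> 'End(subvs_of (pol_pos A))) (rho_hom : gl_hom rho)
  (rho_char : forall g, has_trace setT (rho g) (chi2 R (cl g)))
  (rho' : G -> 'End(subvs_of (pol_pos B))) (rho'_hom : gl_hom rho')
  (rho'_char : forall g, has_trace setT (rho' g) (chi6 R (cl g)))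
  (g : G) :
  let act (h : G) := @W7_gl _ E A B \1%VF (rho h) (rho' h) in
  let Je0F w := W7_Je0 FE FA FB bE (@W7_F _ E A B w) in
  exists t : int -> nat -> R[i],
    [/\ graded_trace (fun w => act g (Je0F w) + act (g^-1)%g (Je0F w))
          (W7_J0 FE FA FB bA bB) (W7_L0 FE FA FB bE bA bB) t,
        forall n, exists M : int, forall m, M < m -> t m n = 0
      & forall tau z : R[i],
          0 < complex.Im tau -> 0 < - complex.Im z ->
          - complex.Im z < complex.Im tau ->
          has_sum (fun mn : int * nat =>
              - t mn.1 mn.2 * e2pi z ^ mn.1 * e2pi tau ^+ mn.2)
            (psi7 (cl g) tau z)].
Proof.
move=> act Je0F.
have [c [chi [l1 [l2 [[u1 u2 chi0] rhoE rhoD psiE]]]]] :=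
  twisting bA bB cl_classes rho_char rho'_hom rho'_char g.
have rhoV x : rho (g^-1)%g x = chi^-1 *: x.
  have -> : x = chi^-1 *: rho g x by rewrite rhoE scalerA mulVf ?scale1r.
  by rewrite linearZ /= -comp_lfunE -rho_hom.2 mulVg rho_hom.1 id_lfunE rhoE !scalerA -mulrA mulVf ?mulr1.
have rhoDV : gl_diag c (rho' (g^-1)%g) (pair_fun l1^-1 l2^-1).
  have -> : pair_fun l1^-1 l2^-1 = fun i => (pair_fun l1 l2 i)^-1.
    by apply/funext => i; rewrite /pair_fun; case: ifP.
  apply: (gl_diag_inv _ _ rhoD) => [i|x]; first exact: pair_fun_neq0.
  by rewrite -comp_lfunE -rho'_hom.2 mulVg rho'_hom.1 id_lfunE.
exists (twined_coef chi l1 l2); split.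
- exact: (twined_graded_trace bE bA bB FE FA FB u1 u2 chi0 rhoE rhoV rhoD rhoDV).
(* Charge is at most 1 + 5 times weight, so each power of q carries finitely many positive powers of
   y, as membership in C[y][[y^-1]][[q]] demands. *)
- by move=> n; exists (1 + 5 * n%:Z) => m; exact: twined_coef_eq0.
by move=> tau z t0 z0 zt; rewrite psiE //; exact: twined_has_sum.
Qed.
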